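(* Let $\Omega$ be a bounded quasi $B$-regular domain in $\mathbb{C}^n$ and let $\phi:\Omega\to[-\infty,\infty]$ be a nearly continuous function, i.e. the set $E_\phi=\{z\in\overline{\Omega}:\phi^*(z)\ne\phi_*(z)\}$ is $\Omega$-pluripolar. Suppose that $\phi^*$ admits a superharmonic majorant $v\not\equiv+\infty$ on $\overline{\Omega}$. Then: (i) The envelope $$P_{\phi^*}(z)=\sup\{u(z): u\in PSH(\Omega),\ u^*\le\phi^*\text{ on }\overline{\Omega}\},\qquad z\in\Omega,$$ is plurisubharmonic on $\Omega$. (ii) If $\phi\ge\theta$ on $\Omega$ for some $\theta\in PSH^*(\Omega)$, and if $v$ is a strong plurisuperharmonic majorant of $\phi^*$, then $P_{\phi^*}\in PSH^*(\Omega)$ and $P_{\phi^*}$ is quasi upper bounded on $\Omega$. (iii) If, in addition to the hypotheses of (ii), $\theta$ is bounded from below on $\Omega$, then $$\lim_{\Omega\ni z\to z_0}P_{\phi^*}(z)=\phi(z_0)\qquad\forall z_0\in\partial\Omega\setminus(B_\Omega\cup E_\phi),$$ where $\phi(z_0)$ denotes the common value $\phi^*(z_0)=\phi_*(z_0)$. Moreover, $P_{\phi^*}$ is continuous at every point of $\Omega\setminus Y$, where $$Y=\{z\in\overline{\Omega}: v^*(z)=+\infty\}\cup\widehat{B_\Omega}\cup\widehat{E_\phi}.$$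
   Context: $SH(\Omega)$, $PSH(\Omega)$ are the cones of subharmonic and plurisubharmonic functions on $\Omega$ (the function identically $-\infty$ is allowed); $SH^*(\Omega)$, $PSH^*(\Omega)$ are the subsets of those not identically $-\infty$. For a function $f$ with domain $D\in\{\Omega,\overline{\Omega}\}$, $f^*(z)=\limsup_{D\ni\xi\to z}f(\xi)$ and $f_*(z)=\liminf_{D\ni\xi\to z}f(\xi)$ for $z\in\overline{\Omega}$ ($\xi=z$ allowed if $z\in D$). A set $A\subset\overline{\Omega}$ is $\Omega$-pluripolar if there is $w\in PSH^*(\Omega)$, $w<0$, with $w^*=-\infty$ on $A$. The $\Omega$-pluripolar hull of an $\Omega$-pluripolar set $A$ is $$\widehat A=\bigcap\{\{z\in\overline{\Omega}:w^*(z)=-\infty\}: w\in PSH^*(\Omega),\ w<0,\ w^*|_A\equiv-\infty\}.$$ $u\in PSH(\Omega)$ is quasi upper bounded if there is a sequence $\{u_j\}$ of plurisubharmonic functions on $\Omega$, each bounded from above, with $u_j\nearrow u$ outside a pluripolar subset of $\Omega$. A bounded domain $\Omega$ that is regular (for the classical Dirichlet problem for harmonic functions) is quasi $B$-regular if for every continuous $\phi:\partial\Omega\to\mathbb{R}$ there exist an $\Omega$-pluripolar set $A\subset\partial\Omega$ and a quasi upper bounded $u\in PSH(\Omega)$ with $\lim_{z\to x}u(z)=\phi(x)$ for all $x\in(\partial\Omega)\setminus A$. On such a domain, for continuous $g:\overline{\Omega}\to\mathbb{R}$ let $P_g=\sup\{u\in PSH(\Omega):u^*\le g\text{ on }\overline{\Omega}\}$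 and $\tilde P_g=\sup\{u\in PSH(\Omega):u^*|_{\partial\Omega}\le g\}$. It is known that there are $\Omega$-pluripolar sets $A\subset\partial\Omega$ such that $\lim_{z\to x}\tilde P_g(z)=\lim_{z\to x}P_g(z)=g(x)$ for every continuous $g:\overline{\Omega}\to\mathbb{R}$ and every $x\in(\partial\Omega)\setminus A$. The $B$-singular set $B_\Omega$ is the intersection of all $\Omega$-pluripolar sets $A\subset\partial\Omega$ with this property. A superharmonic majorant of $f:\overline{\Omega}\to[-\infty,\infty]$ is a lower semicontinuous $v:\overline{\Omega}\to(-\infty,\infty]$, superharmonic on $\Omega$, with $f\le v$ on $\overline{\Omega}$. A lower semicontinuous $\psi:\overline{\Omega}\to(-\infty,\infty]$ is a strong plurisuperharmonic majorant of $f$ if $-\psi\in PSH^*(\Omega)$, $\{f=+\infty\}\subset\{\psi=+\infty\}$, and $\psi(z)/f(z)\to+\infty$ as $f(z)\to+\infty$ (i.e. for every $M>0$ there is $N>0$ such that $\psi(z)\ge M f(z)$ whenever $f(z)>N$).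
   Formalization: The condition that v is not identically +∞ on the closure of Ω is read as: v is finite at some point of Ω itself; with v ≡ +∞ on Ω and finite only on the boundary, (i) fails, e.g. in the unit disc with φ = 1/|Re z| for Re z < 0 and +∞ otherwise. *)

(* Defs.v *)
(* Pluripotential theory on domains of C^n, over MathComp-Analysis.
   A function whose domain is a set D of C^n is a total function on C^n; every
   notion below depends only on its values on D. *)
From HB Require Import structures.
From mathcomp Require Import all_boot all_order all_algebra.
From mathcomp Require Import complex.
From mathcomp Require Import all_classical all_reals all_analysis.

Set Implicit Arguments.
Unset Strict Implicit.
Unset Printing Implicit Defensive.

Import Order.TTheory GRing.Theory Num.Theory.
Import numFieldNormedType.Exports.

Local Open Scope classical_set_scope.
Local Open Scope ring_scope.

(* The cast makes the topology of numeric fields available on R[i]. *)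
Notation "''Cn[' R ]_ n" := ('rV[(R[i]%C : numClosedFieldType)]_n)
  (at level 8, n at level 2, format "''Cn[' R ]_ n") : type_scope.

Definition is_domain (R : realType) (n : nat) (Omega : set 'Cn[R]_n) : Prop :=
  [/\ open Omega, connected Omega & Omega !=set0].

Definition bdry (R : realType) (n : nat) (Omega : set 'Cn[R]_n) : set 'Cn[R]_n :=
  closure Omega `\` Omega°.

(* f^* and f_* for f with domain D; the point z itself is included if z \in D. *)
Definition usc_reg (R : realType) (n : nat) (D : set 'Cn[R]_n)
    (f : 'Cn[R]_n -> \bar R) (z : 'Cn[R]_n) : \bar R :=
  limf_esup f (within D (nbhs z)).

Definition lsc_reg (R : realType) (n : nat) (D : set 'Cn[R]_n)
    (f : 'Cn[R]_n -> \bar R) (z : 'Cn[R]_n) : \bar R :=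
  limf_einf f (within D (nbhs z)).

(* Points outside D are isolated in [subspace D], so that these conditions
   bear on the restriction of f to D only. *)
Definition lsc_on (R : realType) (n : nat) (D : set 'Cn[R]_n)
    (f : 'Cn[R]_n -> \bar R) : Prop :=
  lower_semicontinuous (f : subspace D -> \bar R).

Definition usc_on (R : realType) (n : nat) (D : set 'Cn[R]_n)
    (f : 'Cn[R]_n -> \bar R) : Prop :=
  lsc_on D (fun z => - f z)%E.

(* The closed Euclidean ball (the library norm on row vectors is the maximum
   norm). *)
Definition eball (R : realType) (n : nat) (a : 'Cn[R]_n) (r : R) :
    set 'Cn[R]_n :=
  [set z | \sum_(j < n) (complex.Re (z 0 j - a 0 j) ^+ 2 +
                         complex.Im (z 0 j - a 0 j) ^+ 2) <= r ^+ 2].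

(* The Lebesgue integral over C^n = R^2n, as an iterated integral over the real
   coordinates. It is only used below on upper semicontinuous functions on a
   closed ball, extended by 0; these are measurable and bounded above, so that
   the Fubini-Tonelli theorem applies. *)
Fixpoint Cn_integral (R : realType) (n : nat) :
    ('Cn[R]_n -> \bar R) -> \bar R :=
  match n with
  | 0 => fun f => f 0
  | m.+1 => fun f =>
      (\int[@lebesgue_measure R]_x \int[@lebesgue_measure R]_y
         Cn_integral (fun w : 'Cn[R]_m =>
           f (row_mx ((x +i* y)%C%:M : 'Cn[R]_1) w)))%E
  end.

(* Both cones contain the function identically -oo. *)
Definition sh (R : realType) (n : nat) (Omega : set 'Cn[R]_n)
    (u : 'Cn[R]_n -> \bar R) : Prop :=
  [/\ forall z, Omega z -> (u z < +oo)%E,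
      usc_on Omega u &
      forall (a : 'Cn[R]_n) (r : R), 0 < r -> eball a r `<=` Omega ->
        (u a * Cn_integral (fun z => (\1_(eball a r) z)%:E)
         <= Cn_integral (u \_ (eball a r)))%E].

Definition psh (R : realType) (n : nat) (Omega : set 'Cn[R]_n)
    (u : 'Cn[R]_n -> \bar R) : Prop :=
  [/\ forall z, Omega z -> (u z < +oo)%E,
      usc_on Omega u &
      forall a b : 'Cn[R]_n,
        (forall c : R[i]%C, `|c| <= 1 -> Omega (a + c *: b)) ->
        (u a * (2 * pi)%:E
         <= \int[@lebesgue_measure R]_(t in `[0%R, (2 * pi)%R])
              u (a + (cos t +i* sin t)%C *: b)%R)%E].

Definition psh_star (R : realType) (n : nat) (Omega : set 'Cn[R]_n)
    (u : 'Cn[R]_n -> \bar R) : Prop :=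
  psh Omega u /\ exists2 z, Omega z & u z != -oo%E.

(* The derivative of f at z in the real direction v. The library operator 'D_v
   would require f to take values in a normed module over R[i]. *)
Definition rderivable (R : realType) (n : nat) (v : 'Cn[R]_n)
    (f : 'Cn[R]_n -> R) (z : 'Cn[R]_n) : Prop :=
  derivable (fun t : R => f (z + t%:C%C *: v)) 0 1.

Definition rderive (R : realType) (n : nat) (v : 'Cn[R]_n)
    (f : 'Cn[R]_n -> R) (z : 'Cn[R]_n) : R :=
  derive1 (fun t : R => f (z + t%:C%C *: v)) 0.

(* e_j for b = false, i e_j for b = true. *)
Definition rbasis (R : realType) (n : nat) (d : bool * 'I_n) : 'Cn[R]_n :=
  (if d.1 then 'i%C else 1) *: delta_mx 0 d.2.

Definition harmonic_on (R : realType) (n : nat) (G : set 'Cn[R]_n)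
    (h : 'Cn[R]_n -> R) : Prop :=
  [/\ forall d z, G z -> rderivable (rbasis R d) h z,
      forall d e z, G z ->
        rderivable (rbasis R d) (rderive (rbasis R e) h) z,
      forall d e, {within G, continuous
        rderive (rbasis R d) (rderive (rbasis R e) h)} &
      forall z, G z ->
        \sum_(d : bool * 'I_n) rderive (rbasis R d) (rderive (rbasis R d) h) z
        = 0].

Definition dirichlet_regular (R : realType) (n : nat) (Omega : set 'Cn[R]_n) :
    Prop :=
  forall f : 'Cn[R]_n -> R, {within bdry Omega, continuous f} ->
  exists h : 'Cn[R]_n -> R,
    [/\ {within closure Omega, continuous h}, harmonic_on Omega h &
        forall x, bdry Omega x -> h x = f x].

Definition Omega_pluripolar (R : realType) (n : nat) (Omega A : set 'Cn[R]_n) :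
    Prop :=
  A `<=` closure Omega /\
  exists w : 'Cn[R]_n -> \bar R,
    [/\ psh_star Omega w, forall z, Omega z -> (w z < 0)%E &
        forall z, A z -> usc_reg Omega w z = -oo%E].

Definition pluripolar_hull (R : realType) (n : nat) (Omega A : set 'Cn[R]_n) :
    set 'Cn[R]_n :=
  [set z | closure Omega z /\
    forall w : 'Cn[R]_n -> \bar R,
      psh_star Omega w -> (forall x, Omega x -> (w x < 0)%E) ->
      (forall x, A x -> usc_reg Omega w x = -oo%E) ->
      usc_reg Omega w z = -oo%E].

(* Pluripolarity in the usual local sense. *)
Definition pluripolar (R : realType) (n : nat) (E : set 'Cn[R]_n) : Prop :=
  forall a, E a ->
  exists V : set 'Cn[R]_n, exists w : 'Cn[R]_n -> \bar R,
    [/\ is_domain V, V a, psh_star V w &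
        forall z, E z -> V z -> w z = -oo%E].

Definition quasi_upper_bounded (R : realType) (n : nat) (Omega : set 'Cn[R]_n)
    (u : 'Cn[R]_n -> \bar R) : Prop :=
  psh Omega u /\
  exists (u_ : nat -> 'Cn[R]_n -> \bar R) (E : set 'Cn[R]_n),
    [/\ E `<=` Omega, pluripolar E,
        forall j, psh Omega (u_ j),
        forall j, exists M : R, forall z, Omega z -> (u_ j z <= M%:E)%E &
        forall z, Omega z -> ~ E z ->
          nondecreasing_seq (fun j => u_ j z) /\
          (u_ j z @[j --> \oo] --> u z)].

Definition quasi_B_regular (R : realType) (n : nat) (Omega : set 'Cn[R]_n) :
    Prop :=
  [/\ is_domain Omega, bounded_set Omega, dirichlet_regular Omega &
    forall f : 'Cn[R]_n -> R, {within bdry Omega, continuous f} ->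
    exists (A : set 'Cn[R]_n) (u : 'Cn[R]_n -> \bar R),
      [/\ A `<=` bdry Omega, Omega_pluripolar Omega A,
          quasi_upper_bounded Omega u &
          forall x, bdry Omega x -> ~ A x ->
            u z @[z --> within Omega (nbhs x)] --> (f x)%:E]].

(* P_f, and the variant in which u^* <= f is only required on the boundary. *)
Definition envelope (R : realType) (n : nat) (Omega : set 'Cn[R]_n)
    (f : 'Cn[R]_n -> \bar R) (z : 'Cn[R]_n) : \bar R :=
  ereal_sup [set u z | u in [set u : 'Cn[R]_n -> \bar R |
    psh Omega u /\
    forall x, closure Omega x -> (usc_reg Omega u x <= f x)%E]].

Definition bdry_envelope (R : realType) (n : nat) (Omega : set 'Cn[R]_n)
    (f : 'Cn[R]_n -> \bar R) (z : 'Cn[R]_n) : \bar R :=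
  ereal_sup [set u z | u in [set u : 'Cn[R]_n -> \bar R |
    psh Omega u /\
    forall x, bdry Omega x -> (usc_reg Omega u x <= f x)%E]].

Definition B_singular (R : realType) (n : nat) (Omega : set 'Cn[R]_n) :
    set 'Cn[R]_n :=
  [set x | bdry Omega x /\
    forall A : set 'Cn[R]_n,
      A `<=` bdry Omega -> Omega_pluripolar Omega A ->
      (forall g : 'Cn[R]_n -> R, {within closure Omega, continuous g} ->
       forall y, bdry Omega y -> ~ A y ->
         (bdry_envelope Omega (EFin \o g) z @[z --> within Omega (nbhs y)]
            --> (g y)%:E) /\
         (envelope Omega (EFin \o g) z @[z --> within Omega (nbhs y)]
            --> (g y)%:E)) ->
      A x].

(* The set E_phi, for phi with domain Omega. *)
Definition discontinuity_set (R : realType) (n : nat) (Omega : set 'Cn[R]_n)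
    (phi : 'Cn[R]_n -> \bar R) : set 'Cn[R]_n :=
  [set z | closure Omega z /\ usc_reg Omega phi z != lsc_reg Omega phi z].

Definition nearly_continuous (R : realType) (n : nat) (Omega : set 'Cn[R]_n)
    (phi : 'Cn[R]_n -> \bar R) : Prop :=
  Omega_pluripolar Omega (discontinuity_set Omega phi).

Definition superharmonic_majorant (R : realType) (n : nat)
    (Omega : set 'Cn[R]_n) (f v : 'Cn[R]_n -> \bar R) : Prop :=
  [/\ forall z, closure Omega z -> v z != -oo%E,
      lsc_on (closure Omega) v,
      sh Omega (fun z => - v z)%E &
      forall z, closure Omega z -> (f z <= v z)%E].

Definition strong_psh_majorant (R : realType) (n : nat)
    (Omega : set 'Cn[R]_n) (f psi : 'Cn[R]_n -> \bar R) : Prop :=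
  [/\ forall z, closure Omega z -> psi z != -oo%E,
      lsc_on (closure Omega) psi,
      psh_star Omega (fun z => - psi z)%E,
      forall z, closure Omega z -> f z = +oo%E -> psi z = +oo%E &
      forall M : R, 0 < M -> exists2 N : R, 0 < N &
        forall z, closure Omega z -> (N%:E < f z)%E ->
          (M%:E * f z <= psi z)%E].

(* Main.v *)
(** Let F be the class of psh functions u with u <= phi^* on Omega; as phi^* is upper
    semicontinuous, the boundary condition on u^* is then automatic. Volume integrals over balls,
    compared through rotation invariance with circle averages of psh functions, bound F locally
    near every point, because v is integrable near the dense set where it is finite. Hence the
    regularization P^* of the envelope P is psh, and P^* <= phi^* puts it in F, so P = P^*.

    The functions P - (v + K)/(j + 1) are bounded above, by the growth of v along phi^*, and
    increase to P outside {v = +oo}. At a good boundary point z0 a continuous minorant of phi^*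
    of the form max(c', L - k|z - z0|) gives the lower limit of P.

    For the continuity inside Omega take W = w1 + w2 psh, negative, with W^* = -oo on B_Omega and
    on E_phi and W(z0) finite, and Q = P - eta (v + K) + eps W - eps. Compactness of the closure
    yields one delta such that every z in Omega is either well inside, with Q(z + k) <= phi^*(z)
    for |k| < delta, or satisfies Q(z + k) <= P(z) whenever |k| < delta. Gluing the translate
    Q(. + h) to P by a maximum therefore stays psh and in F, so Q(z + h) <= P(z); letting
    eta, eps -> 0 shows that P is lower semicontinuous at z0. *)
Require Import Defs.
From HB Require Import structures.
From mathcomp Require Import all_boot all_order all_algebra.
From mathcomp Require Import complex.
From mathcomp Require Import all_classical all_reals all_analysis.
From mathcomp Require Import measurable_realfun.
From mathcomp Require Import ring lra.
Set Implicit Arguments.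
Unset Strict Implicit.
Unset Printing Implicit Defensive.
Import Order.TTheory GRing.Theory Num.Theory.
Import numFieldNormedType.Exports.
Local Open Scope classical_set_scope.
Local Open Scope ring_scope.

(** [psh] tests every disc contained in $\Omega$, but a function glued by a maximum is only seen to
    satisfy the mean value inequality on short circles; [psh_of_small_circles] passes from short
    circles to all of them, given one radius valid at every centre. This is why $\delta$ must be
    uniform up to the boundary and why the boundary behaviour of $P$ enters the proof of interior
    continuity: where a translate may leave $\Omega$, the glued function has to agree with $P$.

    Each term of $Q$ meets one obstacle. The term $-\eta(v+K)$ keeps $Q$ below a constant plus
    $\varepsilon W$ although $P$ may be unbounded, so that $\varepsilon W$ forces $Q$ below the
    lower bound of $P$ near the points where $W^*=-\infty$. The final $-\varepsilon$ absorbs the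
    oscillation of $\phi^*$ near the points where $\phi^*=\phi_*$ is finite.

    Mean values of functions that may be $-\infty$ are handled through $M-u\ge0$, with $M$ an upper
    bound of $u$ on the disc, so that Tonelli, Fatou and monotonicity apply without integrability
    assumptions. *)

(** * Real-valued norms on complex normed spaces, and compactness in $\mathbb{C}^n$ *)

Section RealNorm.
Variable R : realType.
Local Notation C := (R[i]%C : numClosedFieldType).
Local Notation Re := (@complex.Re R).
Local Notation Im := (@complex.Im R).

Lemma ReB (x y : C) : Re (x - y) = Re x - Re y.
Proof. by case: x y => [a b] [c d]. Qed.

Lemma ImB (x y : C) : Im (x - y) = Im x - Im y.
Proof. by case: x y => [a b] [c d]. Qed.

(** The norm of a normed space over [R[i]] is itself a complex number, with zero imaginary part; its
    real part brings estimates back to the ordered field [R]. *)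
Definition rnorm (V : normedModType C) (z : V) : R := Re `|z|.
Arguments rnorm {V} z.

Lemma normE (V : normedModType C) (z : V) : `|z| = (rnorm z)%:C%C.
Proof.
have := normr_ge0 z; rewrite /rnorm; case: `|z| => x y /=.
by rewrite lecE /= => /andP[/eqP-> _].
Qed.

Lemma rnorm_ge0 (V : normedModType C) (z : V) : 0 <= rnorm z.
Proof. by have := normr_ge0 z; rewrite normE lecR. Qed.

Lemma rnormD (V : normedModType C) (z w : V) : rnorm (z + w) <= rnorm z + rnorm w.
Proof. by have := ler_normD z w; rewrite !normE -rmorphD /= lecR. Qed.

Lemma rnormN (V : normedModType C) (z : V) : rnorm (- z) = rnorm z.
Proof. by rewrite /rnorm normrN. Qed.

Lemma rnormB (V : normedModType C) (z w : V) : rnorm (z - w) = rnorm (w - z).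
Proof. by rewrite -rnormN opprB. Qed.

Lemma rnorm0 (V : normedModType C) : rnorm (0 : V) = 0.
Proof. by rewrite /rnorm normr0. Qed.

Lemma rnorm0_eq0 (V : normedModType C) (z : V) : rnorm z = 0 -> z = 0.
Proof. by move=> z0; apply: normr0_eq0; rewrite normE z0. Qed.

Lemma rnormZ (V : normedModType C) (c : C) (z : V) :
  rnorm (c *: z) = rnorm c * rnorm z.
Proof.
apply: (@complexI R); have := normrZ c z; rewrite !normE => ->.
by rewrite -rmorphM.
Qed.

Lemma rnorm_complex (c : C) : rnorm c = Num.sqrt (Re c ^+ 2 + Im c ^+ 2).
Proof. by rewrite /rnorm normc_def. Qed.

Lemma rnorm_real (x : R) : rnorm (x%:C%C : C) = `|x|.
Proof. by rewrite rnorm_complex /= expr0n addr0 sqrtr_sqr. Qed.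

Lemma rnorm_expi (t : R) : rnorm ((cos t +i* sin t)%C : C) = 1.
Proof. by rewrite rnorm_complex /= cos2Dsin2 sqrtr1. Qed.

(** A positive element of [R[i]] is real, so balls of real radius form a base. *)
Lemma nbhs_rnormP (V : normedModType C) (z : V) (P : set V) :
  nbhs z P <-> exists2 e : R, 0 < e & forall y, rnorm (y - z) < e -> P y.
Proof.
split.
  move=> /nbhs_normP[[e e'] /= + eP]; rewrite ltcE /= => /andP[/eqP e'0 e0].
  exists e => // y yz; apply: eP => /=.
  by rewrite distrC normE e'0 (_ : (e +i* 0)%C = e%:C%C) // ltcR.
move=> [e e0 eP]; apply/nbhs_normP; exists (e%:C%C); first by rewrite /= (ltcR 0).
by move=> y; rewrite /= distrC normE ltcR => /eP.
Qed.

Lemma nbhs_rball (V : normedModType C) (z : V) (e : R) :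
  0 < e -> nbhs z [set y | rnorm (y - z) < e].
Proof. by move=> e0; apply/nbhs_rnormP; exists e. Qed.

Lemma rnorm_lt n (z : 'Cn[R]_n) (e : R) :
  0 < e -> (rnorm z < e <-> forall j, rnorm (z 0 j) < e).
Proof.
move=> e0; have eC : 0 <= e%:C%C by rewrite (lecR 0) ltW.
rewrite -ltcR -normE (_ : `|z| = mx_norm z) // mx_normE -[ltRHS]/((NngNum eC)%:num).
rewrite num_lt; split=> [/bigmax_ltP[_ ze] j|ze].
  by rewrite -ltcR -normE; have := ze (0, j) isT; rewrite -num_lt.
apply/bigmax_ltP; split; first by rewrite -num_lt /= (ltcR 0).
by move=> [i j] _ /=; rewrite ord1 -num_lt /= normE ltcR.
Qed.

Lemma rnorm_coord n (z : 'Cn[R]_n) (j : 'I_n) : rnorm (z 0 j) <= rnorm z.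
Proof.
apply/ler_addgt0Pr => e e0; apply: ltW; move: j; apply/rnorm_lt.
  by rewrite ltr_wpDl // rnorm_ge0.
by rewrite ltrDl.
Qed.

Lemma normc_Re_le (c : C) : `|Re c| <= rnorm c.
Proof. by rewrite rnorm_complex -sqrtr_sqr ler_wsqrtr // lerDl sqr_ge0. Qed.

Lemma normc_Im_le (c : C) : `|Im c| <= rnorm c.
Proof. by rewrite rnorm_complex -sqrtr_sqr ler_wsqrtr // lerDr sqr_ge0. Qed.

Lemma rnorm_le_ReIm (c : C) : rnorm c <= `|Re c| + `|Im c|.
Proof.
rewrite rnorm_complex; apply: (@le_trans _ _ (Num.sqrt ((`|Re c| + `|Im c|) ^+ 2))).
  rewrite ler_wsqrtr // sqrrD !real_normK ?num_real //.
  by rewrite addrAC lerDl mulrn_wge0 // mulr_ge0.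
by rewrite sqrtr_sqr ger0_norm // addr_ge0.
Qed.

Lemma cvg_rnormP (T : Type) (F : set_system T) (FF : Filter F)
    (V : normedModType C) (f : T -> V) (l : V) :
  f @ F --> l <-> forall e : R, 0 < e -> \forall x \near F, rnorm (f x - l) < e.
Proof.
split=> [fl e e0|H].
  by have := fl _ (nbhs_rball l e0).
move=> P /nbhs_rnormP[e e0 eP]; apply: filterS (H _ e0) => x /=; exact: eP.
Qed.

Lemma Re_continuous : continuous (Re : C -> R).
Proof.
move=> c U /nbhs_normP[e /= e0 eU]; apply/(nbhs_rnormP (c : C)); exists e => // y yc.
apply: eU => /=; apply: le_lt_trans yc; rewrite distrC -ReB.
exact: normc_Re_le.
Qed.

Lemma Im_continuous : continuous (Im : C -> R).
Proof.
move=> c U /nbhs_normP[e /= e0 eU]; apply/(nbhs_rnormP (c : C)); exists e => // y yc.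
apply: eU => /=; apply: le_lt_trans yc; rewrite distrC -ImB.
exact: normc_Im_le.
Qed.

Lemma rnorm_continuous (V : normedModType C) : continuous (rnorm : V -> R).
Proof.
move=> z; apply: (@continuous_comp _ _ _ (fun z : V => `|z| : C) Re).
  exact: norm_continuous.
exact: Re_continuous.
Qed.

Lemma cvg_complex (T : Type) (F : set_system T) (FF : Filter F) (f g : T -> R) (a b : R) :
  f @ F --> a -> g @ F --> b -> (fun x => (f x +i* g x)%C : C) @ F --> ((a +i* b)%C : C).
Proof.
move=> fa gb; apply/cvg_rnormP => e e0; near=> x.
apply: le_lt_trans (rnorm_le_ReIm _) _ => /=.
rewrite [e](splitr e) ltrD //.
- near: x; have /cvgrPdist_lt/(_ (e / 2)) := fa.
  by rewrite divr_gt0 // => /(_ erefl); apply: filterS => x; rewrite distrC.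
- near: x; have /cvgrPdist_lt/(_ (e / 2)) := gb.
  by rewrite divr_gt0 // => /(_ erefl); apply: filterS => x; rewrite distrC.
Unshelve. all: by end_near. Qed.

Lemma complex_pair_continuous :
  continuous (fun p : R * R => (p.1 +i* p.2)%C : C).
Proof. by move=> p; apply: cvg_complex; [exact: cvg_fst|exact: cvg_snd]. Qed.

Lemma compact_square (M : R) :
  compact [set c : C | `|Re c| <= M /\ `|Im c| <= M].
Proof.
have -> : [set c : C | `|Re c| <= M /\ `|Im c| <= M] =
  (fun p : R * R => (p.1 +i* p.2)%C : C) @` (`[- M, M] `*` `[- M, M]).
  apply/seteqP; split=> [[x y] /= [xM yM]|_ [[x y] /= [xM yM] <-] /=].
    by exists (x, y) => //=; rewrite !in_itv /= -!ler_norml.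
  by move: xM yM; rewrite !in_itv /= -!ler_norml.
apply: continuous_compact; last by apply: compact_setX; exact: segment_compact.
by apply: continuous_subspaceT; exact: complex_pair_continuous.
Qed.

Lemma compact_disc : compact [set c : C | `|c| <= 1].
Proof.
apply: (@subclosed_compact _ _ [set c : C | `|Re c| <= 1 /\ `|Im c| <= 1]).
- have -> : [set c : C | `|c| <= 1] = rnorm @^-1` [set x | x <= 1].
    by apply/seteqP; split=> c /=; rewrite normE lecR.
  by apply: closed_comp => [c _|]; [exact: rnorm_continuous|exact: closed_le].
- exact: compact_square.
- move=> c /=; rewrite normE lecR => c1.
  by split; apply: le_trans c1; [exact: normc_Re_le|exact: normc_Im_le].
Qed.

(** A bounded set lies in a product of compact squares, one for each coordinate. *)
Lemma bounded_closed_compact_Cn n (K : set 'Cn[R]_n) :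
  bounded_set K -> closed K -> compact K.
Proof.
have [-> _ _|/set0P[a Ka] Kbd Kcl] := eqVneq K set0; first exact: compact0.
have [M KM] : exists M : C, forall z, K z -> `|z| <= M.
  by have /(ex_bound id (PF := globally_properfilter Ka))[M KM] := Kbd; exists M.
apply: (@subclosed_compact _ _
  [set z : 'Cn[R]_n | forall j, `|Re (z 0 j)| <= Re M /\ `|Im (z 0 j)| <= Re M]) => //.
  by apply: (@rV_compact _ n (fun=> [set c : C | `|Re c| <= Re M /\ `|Im c| <= Re M])) => j; exact: compact_square.
move=> z /KM /=; rewrite normE => zM j.
have zj : rnorm (z 0 j) <= Re M.
  apply: le_trans (rnorm_coord z j) _.
  by move: zM; rewrite lecE /= => /andP[].
by split; apply: le_trans zj; [exact: normc_Re_le|exact: normc_Im_le].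
Qed.

End RealNorm.
Arguments rnorm {R V} z.

(** * Semicontinuous regularizations, and extrema on compact sets *)

Section Semicontinuity.
Variable R : realType.
Implicit Types n : nat.

Lemma usc_reg_lt n (D : set 'Cn[R]_n) f z (a : \bar R) :
  (usc_reg D f z < a)%E -> \forall y \near z, D y -> (f y < a)%E.
Proof.
move=> /ereal_inf_lt[_ [A DA <-]] fa.
have : \forall y \near z, D y -> A y := DA.
apply: filterS => y + Dy => /(_ Dy) Ay; apply: le_lt_trans fa.
by apply: ereal_sup_ubound; exists y.
Qed.

Lemma usc_reg_le n (D : set 'Cn[R]_n) f z (a : \bar R) :
  (\forall y \near z, D y -> (f y <= a)%E) -> (usc_reg D f z <= a)%E.
Proof.
move=> fa; apply: (@le_trans _ _ (ereal_sup (f @` [set y | (f y <= a)%E]))).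
  by apply: ereal_inf_lbound; exists [set y | (f y <= a)%E].
by apply: ge_ereal_sup => _ [y ya <-].
Qed.

Lemma usc_reg_ge n (D : set 'Cn[R]_n) f z : D z -> (f z <= usc_reg D f z)%E.
Proof.
move=> Dz; apply: le_ereal_inf_tmp => _ [A DA <-].
apply: ereal_sup_ubound; exists z => //.
exact: (nbhs_singleton (DA : \forall y \near z, D y -> A y)).
Qed.

(** Regularization is idempotent: a set [V] on which the supremum of [g] is taken at [z] is, within
    [D], a neighbourhood of all points of [D] close to [z], so the same supremum bounds $g^*$
    there. *)
Lemma usc_reg_le_usc_reg n (D : set 'Cn[R]_n) f g z :
  (forall y, D y -> (f y <= usc_reg D g y)%E) ->
  (usc_reg D f z <= usc_reg D g z)%E.
Proof.
move=> fg; apply: le_ereal_inf_tmp => _ [V DV <-].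
have zV : \forall y \near z, D y -> V y := DV.
apply: usc_reg_le; apply: filterS (nbhs_interior zV) => y yV Dy.
apply: le_trans (fg y Dy) _; apply: usc_reg_le; apply: filterS yV => t + Dt.
by move=> /(_ Dt) Vt; apply: ereal_sup_ubound; exists t.
Qed.

Lemma lsc_reg_gt n (D : set 'Cn[R]_n) f z (a : \bar R) :
  (a < lsc_reg D f z)%E -> \forall y \near z, D y -> (a < f y)%E.
Proof.
rewrite /lsc_reg /limf_einf lteNr => /usc_reg_lt.
by apply: filterS => y + Dy => /(_ Dy); rewrite lteN2.
Qed.

Lemma lsc_onP n (D : set 'Cn[R]_n) (f : 'Cn[R]_n -> \bar R) :
  lsc_on D f <-> forall z, D z -> forall a : R, (a%:E < f z)%E ->
    \forall y \near z, D y -> (a%:E < f y)%E.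
Proof.
have nbhsE z : D z -> nbhs (z : subspace D) = within D (nbhs z).
  by move=> Dz; rewrite (nbhs_subspace_in Dz).
split=> [fl z Dz a az|fl z a az].
  have [V zV Vf] := fl z a az; rewrite nbhsE // in zV.
  have {}zV : \forall y \near z, D y -> V y := zV.
  by apply: filterS zV => y + Dy => /(_ Dy); exact: Vf.
have [Dz|nDz] := pselect (D z).
  exists [set y | (a%:E < f y)%E] => //; rewrite nbhsE //.
  exact: fl.
exists [set z]; last by move=> y ->.
by rewrite /nbhs /= -nbhs_subspace_out.
Qed.

Lemma usc_onP n (D : set 'Cn[R]_n) (f : 'Cn[R]_n -> \bar R) :
  usc_on D f <-> forall z, D z -> forall a : R, (f z < a%:E)%E ->
    \forall y \near z, D y -> (f y < a%:E)%E.
Proof.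
rewrite /usc_on; split=> [/lsc_onP fl z Dz a az|fl].
  have := fl z Dz (- a); rewrite EFinN lteN2 => /(_ az).
  by apply: filterS => y + Dy => /(_ Dy); rewrite lteN2.
apply/lsc_onP => z Dz a; rewrite lteNr -EFinN => az.
by apply: filterS (fl z Dz _ az) => y + Dy => /(_ Dy); rewrite lteNr.
Qed.

Lemma lte_real_between (x y : \bar R) :
  (x < y)%E -> exists2 r : R, (x < r%:E)%E & (r%:E < y)%E.
Proof.
case: x y => [x||] [y||] //= xy.
- exists ((x + y) / 2); first by rewrite lte_fin midf_lt.
  by rewrite lte_fin midf_lt.
- by exists (x + 1); [rewrite lte_fin ltrDl|rewrite ltry].
- by exists (y - 1); [rewrite ltNyr|rewrite lte_fin gtrBl].
- by exists 0; [rewrite ltNyr|rewrite ltry].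
Qed.

Lemma lee_real_approx (x y : \bar R) :
  (forall r : R, (r%:E < x)%E -> (r%:E <= y)%E) -> (x <= y)%E.
Proof.
move=> H; rewrite leNgt; apply/negP => /lte_real_between[r yr rx].
by have := lt_le_trans yr (H _ rx); rewrite ltxx.
Qed.

Lemma usc_reg_id n (D : set 'Cn[R]_n) f z : usc_on D f -> D z ->
  usc_reg D f z = f z.
Proof.
move=> /usc_onP fu Dz; apply/eqP; rewrite eq_le usc_reg_ge // andbT.
rewrite leNgt; apply/negP => /lte_real_between[r zr].
apply/negP; rewrite -leNgt; apply: usc_reg_le.
by apply: filterS (fu z Dz r zr) => y + Dy => /(_ Dy)/ltW.
Qed.

(** Compactness in near-covering form, the bound itself being the parameter that tends to
    $+\infty$. *)
Lemma compact_ubound (T : topologicalType) (K : set T) (g : T -> \bar R) :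
  compact K ->
  (forall x, K x -> exists c : R, \forall y \near x, K y -> (g y < c%:E)%E) ->
  exists c : R, forall x, K x -> (g x < c%:E)%E.
Proof.
move=> /compact_near_coveringP/near_covering_withinP Kc gK.
have := Kc R +oo%R (fun c x => (g x < c%:E)%E) _.
case.
  move=> x Kx; have [c cP] := gK x Kx.
  exists ([set y | K y -> (g y < c%:E)%E], [set i | c < i]) => /=.
    by split=> //; exists c; split; [exact: num_real|].
  by move=> [y i] /= [gy ci] Ky; apply: lt_trans (gy Ky) _; rewrite lte_fin.
move=> M [_ MP]; exists (M + 1) => x Kx; apply: (MP (M + 1) _ x Kx) => //.
by rewrite ltrDl.
Qed.

(** If the supremum [M] were not attained, every point would have a neighbourhood on which [g] stays
    below some real [r] with [r < M]. Near-covering along reals increasing to [M] would then give a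
    single bound below [M] on all of [K]. *)
Lemma compact_max (T : topologicalType) (K : set T) (g : T -> \bar R) :
  compact K -> K !=set0 ->
  (forall x (c : R), K x -> (g x < c%:E)%E ->
     \forall y \near x, K y -> (g y < c%:E)%E) ->
  exists2 x0, K x0 & forall x, K x -> (g x <= g x0)%E.
Proof.
move=> Kc [k Kk] gu; apply: contrapT => noM.
have lt_max x : K x -> exists2 y, K y & (g x < g y)%E.
  move=> Kx; apply: contrapT => H; apply: noM; exists x => // y Ky.
  by rewrite leNgt; apply/negP => xy; apply: H; exists y.
set M := ereal_sup (g @` K).
have gM x : K x -> (g x < M)%E.
  move=> Kx; have [y Ky xy] := lt_max x Kx; apply: lt_le_trans xy _.
  by apply: ereal_sup_ubound; exists y.
(* The left neighbourhoods of [M], as a filter on the reals, since [M] may be $+\infty$. *)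
pose F := filter_from [set r : R | (r%:E < M)%E]
  (fun r => [set s : R | r < s /\ (s%:E < M)%E]).
have [r0 _ r0M] := lte_real_between (gM k Kk).
have FF : Filter F.
  apply: filter_from_filter; first by exists r0.
  move=> r s rM sM; exists (Num.max r s); first by rewrite /= EFin_max gt_max rM.
  by move=> t /= [+ tM]; rewrite gt_max => /andP[].
have /compact_near_coveringP/near_covering_withinP := Kc.
case/(_ R F (fun c x => (g x < c%:E)%E) FF) => [x Kx|r rM rP].
  have [r xr rM] := lte_real_between (gM x Kx).
  exists ([set y | K y -> (g y < r%:E)%E], [set s | r < s /\ (s%:E < M)%E]) => /=.
    by split; [exact: gu|exists r].
  by move=> [y s] /= [gy [rs _]] Ky; apply: lt_trans (gy Ky) _; rewrite lte_fin.
have [s rs sM] := lte_real_between rM.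
have : (M <= s%:E)%E.
  apply: ge_ereal_sup => _ [x Kx <-]; apply: ltW.
  have rs' : r < s by rewrite -lte_fin.
  exact: (rP s (conj rs' sM) x Kx).
by rewrite leNgt sM.
Qed.

End Semicontinuity.

(** * Borel measurability on $\mathbb{C}^n$ in terms of real coordinates *)

Section BorelCn.
Variable R : realType.
Local Notation C := (R[i]%C : numClosedFieldType).
Local Notation Re := (@complex.Re R).
Local Notation Im := (@complex.Im R).

(* The matrix type has no canonical measurable structure; its Borel sets are those of this alias. *)
Definition borelCn n := g_sigma_algebraType (@open 'Cn[R]_n).

Lemma open_measurable_Cn n (U : set 'Cn[R]_n) :
  open U -> measurable (U : set (borelCn n)).
Proof. by move=> oU; apply: sub_sigma_algebra. Qed.

Lemma continuous_measurable_Cn n (f : 'Cn[R]_n -> R) :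
  continuous f -> measurable_fun setT (f : borelCn n -> R).
Proof.
move=> cf; apply: (measurability _ (RGenOInfty.measurableE R)).
move=> _ [_ [a ->] <-]; rewrite setTI; apply: open_measurable_Cn.
by apply: open_comp => [z _|]; [exact: cf|rewrite set_itvE; exact: open_gt].
Qed.

Lemma coord_continuous n (j : 'I_n) : continuous (fun z : 'Cn[R]_n => z 0 j : C).
Proof.
move=> z U /nbhs_rnormP[e e0 eU]; apply/nbhs_rnormP; exists e => // y yz.
apply: eU => /=; by apply: le_lt_trans yz; have := rnorm_coord (y - z) j; rewrite !mxE.
Qed.

Lemma measurable_Re n (j : 'I_n) :
  measurable_fun setT ((fun z => Re (z 0 j)) : borelCn n -> R).
Proof.
apply: continuous_measurable_Cn => z.
by apply: (@continuous_comp _ C _ _ Re); [exact: coord_continuous|exact: Re_continuous].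
Qed.

Lemma measurable_Im n (j : 'I_n) :
  measurable_fun setT ((fun z => Im (z 0 j)) : borelCn n -> R).
Proof.
apply: continuous_measurable_Cn => z.
by apply: (@continuous_comp _ C _ _ Im); [exact: coord_continuous|exact: Im_continuous].
Qed.

Definition rat_point n (q : 'rV[rat * rat]_n) : 'Cn[R]_n :=
  \row_j (ratr (q 0 j).1 +i* ratr (q 0 j).2)%C.

Lemma inv_nat_lt (e : R) : 0 < e -> exists k : nat, k.+1%:R^-1 < e.
Proof.
move=> e0; exists (Num.bound e^-1).
rewrite invf_plt ?posrE ?ltr0n //; apply: lt_le_trans (archi_boundP _) _.
  by rewrite invr_ge0 ltW.
by rewrite ler_nat.
Qed.

Lemma rat_approx (x e : R) : 0 < e -> exists q : rat, `|x - ratr q| < e.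
Proof.
move=> e0; have xe : x - e < x + e by rewrite ltrBlDr -addrA ltrDl addr_gt0.
have [q] := rat_in_itvoo xe; rewrite in_itv /= => qe; exists q.
by rewrite distrC ltr_distl.
Qed.

Lemma rat_point_dense n (z : 'Cn[R]_n) (e : R) : 0 < e ->
  exists q : 'rV[rat * rat]_n, rnorm (z - rat_point q) < e.
Proof.
move=> e0; have e20 : 0 < e / 2 by rewrite divr_gt0.
have /choice[f fP] (j : 'I_n) : exists p : rat * rat,
    `|Re (z 0 j) - ratr p.1| < e / 2 /\ `|Im (z 0 j) - ratr p.2| < e / 2.
  have [q1 q1P] := rat_approx (Re (z 0 j)) e20.
  by have [q2 q2P] := rat_approx (Im (z 0 j)) e20; exists (q1, q2).
exists (\row_j f j); apply/rnorm_lt => // j; rewrite !mxE.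
have [fRe fIm] := fP j; apply: le_lt_trans (rnorm_le_ReIm _) _.
by rewrite ReB ImB /= [ltRHS](splitr e) ltrD.
Qed.

(** Second countability in explicit form: centres and radii run over a countable type, so
    measurability of a map into $\mathbb{C}^n$ can be tested on balls. *)
Lemma open_rational_balls n (U : set 'Cn[R]_n) : open U ->
  U = \bigcup_(p : 'rV[rat * rat]_n * nat)
    [set z | rnorm (z - rat_point p.1) < p.2.+1%:R^-1 /\
      forall y, rnorm (y - rat_point p.1) < p.2.+1%:R^-1 -> U y].
Proof.
move=> oU; apply/seteqP; split=> [z Uz|z [p _ [zp]]]; last exact.
have /nbhs_rnormP[e e0 eU] : nbhs z U by exact: open_nbhs_nbhs.
have e20 : 0 < e / 2 by rewrite divr_gt0.
have [k ke] := inv_nat_lt e20.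
have k0 : 0 < k.+1%:R^-1 :> R by rewrite invr_gt0 ltr0n.
have [q qz] := rat_point_dense z k0; exists (q, k) => //=; split=> // y yq.
apply: eU; rewrite (_ : y - z = (y - rat_point q) - (z - rat_point q)); last first.
  by rewrite opprB addrA subrK.
apply: le_lt_trans (rnormD _ _) _; rewrite rnormN [e]splitr.
by rewrite ltrD // (lt_trans _ ke).
Qed.

(** A ball of the maximum norm is a finite intersection of conditions on one complex coordinate, and
    each of these is a polynomial inequality in its real and imaginary parts. *)
Lemma measurable_fun_Cn d (X : measurableType d) n (f : X -> borelCn n) :
  (forall j, measurable_fun setT (fun x => Re (f x 0 j))) ->
  (forall j, measurable_fun setT (fun x => Im (f x 0 j))) ->
  measurable_fun setT f.
Proof.
move=> fRe fIm; apply: (@measurability _ _ X (borelCn n) setT f (@open 'Cn[R]_n)) => //.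
move=> _ [U oU <-]; rewrite setTI (open_rational_balls oU) preimage_bigcup.
apply: countable_bigcupT_measurable => [|[q k]]; first exact: countableP.
have [kU|nkU] := pselect (forall y, rnorm (y - rat_point q) < k.+1%:R^-1 -> U y);
  last by rewrite (_ : _ @^-1` _ = set0) // -subset0 => x /= [].
have k0 : 0 < k.+1%:R^-1 :> R by rewrite invr_gt0 ltr0n.
rewrite (_ : _ @^-1` _ = \bigcap_(j in [set: 'I_n])
    [set x | (Re (f x 0 j) - ratr (q 0 j).1) ^+ 2 +
             (Im (f x 0 j) - ratr (q 0 j).2) ^+ 2 < (k.+1%:R^-1) ^+ 2]).
  apply: fin_bigcap_measurable => // j _.
  pose h x := (Re (f x 0 j) - ratr (q 0 j).1) ^+ 2 + (Im (f x 0 j) - ratr (q 0 j).2) ^+ 2.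
  have mh : measurable_fun setT h.
    by apply: measurable_funD; apply: measurable_funX; apply: measurable_funB.
  have -> : [set x | h x < (k.+1%:R^-1) ^+ 2] = h @^-1` `]-oo, (k.+1%:R^-1) ^+ 2[.
    by apply/seteqP; split=> x /=; rewrite in_itv.
  by rewrite -[_ @^-1` _]setTI; exact: mh.
have E x j : (rnorm ((f x - rat_point q) 0 j) < k.+1%:R^-1) =
   ((Re (f x 0 j) - ratr (q 0 j).1) ^+ 2 +
             (Im (f x 0 j) - ratr (q 0 j).2) ^+ 2 < (k.+1%:R^-1) ^+ 2).
  rewrite rnorm_complex !mxE ReB ImB /= -[k.+1%:R^-1 in LHS]ger0_norm ?ltW //.
  by rewrite -sqrtr_sqr ltr_sqrt // exprn_gt0.
apply/seteqP; split=> [x [/rnorm_lt xk _] j _|x H] /=; first by rewrite -E; exact: xk.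
by split=> //; apply/rnorm_lt => // j; rewrite E; exact: H.
Qed.

Lemma lsc_measurable_Cn n (D : set 'Cn[R]_n) (f : 'Cn[R]_n -> \bar R) :
  open D -> lsc_on D f -> measurable_fun (D : set (borelCn n)) (f : borelCn n -> \bar R).
Proof.
move=> oD /lsc_onP fl; apply: (measurability _ (ErealGenOInfty.measurableE R)).
move=> /= _ [_ [a ->]] <-; apply: open_measurable_Cn.
rewrite preimage_itvoy openE => z /= [Dz az].
have := fl z Dz a az; have := open_nbhs_nbhs (conj oD Dz).
by rewrite /interior /=; apply: filterS2 => y Dy /(_ Dy) ay; split.
Qed.

Lemma usc_measurable_Cn n (D : set 'Cn[R]_n) (f : 'Cn[R]_n -> \bar R) :
  open D -> usc_on D f -> measurable_fun (D : set (borelCn n)) (f : borelCn n -> \bar R).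
Proof.
move=> oD uf; rewrite (_ : f = fun z => - - f z)%E; last first.
  by apply/funext => z; rewrite oppeK.
by apply: measurableT_comp => //; exact: lsc_measurable_Cn.
Qed.

End BorelCn.

(** * Translations, shears and rotations of the plane; product measures *)

Section LebesgueInvariance.
Variable R : realType.
Local Notation mu := (@lebesgue_measure R).
Local Notation L := (measurableTypeR R).
Local Open Scope ereal_scope.

(** Lebesgue measure is determined by its values on half-open intervals, and translation preserves
    their length. *)
Lemma lebesgue_measureDr (a : R) (A : set L) : measurable A ->
  pushforward mu ((fun x => x + a)%R : L -> L) A = mu A.
Proof.
move=> mA; apply/esym/lebesgue_measure_unique => //=.
  exact: measurable_funD.
move=> _ _ [[x y]] _ <-.
rewrite /pushforward (_ : _ @^-1` _ = `]x - a, y - a]%classic)%R; last first.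
  by apply/seteqP; split=> z /=; rewrite !in_itv /= ltrBlDr lerBrDr.
by rewrite !lebesgue_measure_itv /= !lte_fin ltrD2r -!EFinB (_ : y - a - (x - a) = y - x)%R //; ring.
Qed.

Lemma ge0_integral_shift (f : L -> \bar R) (a : R) :
  measurable_fun setT f -> (forall x, 0 <= f x) ->
  \int[mu]_x f (x + a)%R = \int[mu]_x f x.
Proof.
move=> mf f0.
rewrite -[RHS](@eq_measure_integral _ _ _ _ _
   (pushforward mu ((fun x => x + a)%R : L -> L))); last first.
  by move=> ? A mA _; exact: lebesgue_measureDr.
  by move=> ?; rewrite ge0_integral_pushforward.
exact: measurable_funD.
Qed.

Lemma measurable_shear_x (k : R) :
  measurable_fun setT (fun p : L * L => (p.1 + k * p.2, p.2)%R : L * L).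
Proof.
apply: measurable_fun_pair => //=; apply: measurable_funD => //.
by apply: measurable_funM.
Qed.

Lemma measurable_shear_y (k : R) :
  measurable_fun setT (fun p : L * L => (p.1, p.2 + k * p.1)%R : L * L).
Proof.
apply: measurable_fun_pair => //=; apply: measurable_funD => //.
by apply: measurable_funM.
Qed.

Lemma shear_x (G : L * L -> \bar R) (k : R) :
  measurable_fun setT G -> (forall p, 0 <= G p) ->
  \int[mu]_x \int[mu]_y G (x + k * y, y)%R = \int[mu]_x \int[mu]_y G (x, y).
Proof.
move=> mG G0.
rewrite (fubini_tonelli (m1 := mu) (m2 := mu) (fun p : L * L => G (p.1 + k * p.2, p.2)%R)) //=; last first.
  exact: measurableT_comp mG (measurable_shear_x k).
rewrite (fubini_tonelli (m1 := mu) (m2 := mu) G) //; apply: eq_integral => y _.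
by rewrite (ge0_integral_shift (f := fun x => G (x, y))) //; exact: measurableT_comp.
Qed.

Lemma shear_y (G : L * L -> \bar R) (k : R) :
  measurable_fun setT G -> (forall p, 0 <= G p) ->
  \int[mu]_x \int[mu]_y G (x, y + k * x)%R = \int[mu]_x \int[mu]_y G (x, y).
Proof.
move=> mG G0; apply: eq_integral => x _.
by rewrite (ge0_integral_shift (f := fun y => G (x, y))) //; exact: measurableT_comp.
Qed.

(* A rotation with s != 0 is a product of three shears. *)
Lemma plane_rotation (G : L * L -> \bar R) (c s : R) :
  measurable_fun setT G -> (forall p, 0 <= G p) ->
  (c ^+ 2 + s ^+ 2 = 1)%R -> s != 0%R ->
  \int[mu]_x \int[mu]_y G (c * x - s * y, s * x + c * y)%R =
  \int[mu]_x \int[mu]_y G (x, y).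
Proof.
(* For an angle $\theta$ with cosine [c] and sine [s] this is $-\tan(\theta/2)$: the rotation is a
   shear by [k] along $x$, one by [s] along $y$, and one by [k] along $x$ again. *)
move=> mG G0 cs s0; set k := ((c - 1) / s)%R.
pose S1 (p : L * L) : (L * L)%type := (p.1 + k * p.2, p.2)%R.
pose S2 (p : L * L) : (L * L)%type := (p.1, p.2 + s * p.1)%R.
have mS1 : measurable_fun setT S1 by exact: measurable_shear_x.
have mS2 : measurable_fun setT S2 by exact: measurable_shear_y.
transitivity (\int[mu]_x \int[mu]_y (G \o S1 \o S2 \o S1) (x, y)).
  apply: eq_integral => x _; apply: eq_integral => y _ /=.
  have ks : (k * s = c - 1)%R by rewrite /k divfK.
  have kc : (k * (1 + c) = - s)%R.
    apply: (mulIf s0); rewrite mulrAC ks.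
    by rewrite mulNr -!expr2; move: cs; lra.
  congr (G (_, _)); rewrite /S1 /S2 /=.
    by have -> : (c * x - s * y = (1 + k * s) * x + (k * (1 + c)) * y)%R; [rewrite ks kc; ring|ring: ks].
  by have -> : c = (1 + k * s)%R; [rewrite ks; ring|ring].
have mG1 := measurableT_comp mG mS1.
rewrite (shear_x (G := G \o S1 \o S2) k (measurableT_comp mG1 mS2) (fun=> G0 _)).
rewrite (shear_y (G := G \o S1) s mG1 (fun=> G0 _)).
by rewrite shear_x.
Qed.

(** Products of exhausting sets of finite measure exhaust the product; taking both sequences
    nondecreasing lets one index serve for both factors. The result is again packaged as a
    sigma-finite measure, so that the construction can be iterated over the coordinates. *)
Lemma prod_sigma_finite d1 d2 (T1 : measurableType d1) (T2 : measurableType d2)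
    (m1 : {sigma_finite_measure set T1 -> \bar R})
    (m2 : {sigma_finite_measure set T2 -> \bar R}) :
  exists m : {sigma_finite_measure set (T1 * T2)%type -> \bar R},
    forall f : T1 * T2 -> \bar R, measurable_fun setT f -> (forall p, 0 <= f p) ->
    \int[m]_p f p = \int[m1]_x \int[m2]_y f (x, y).
Proof.
have sf : sigma_finite setT (m1 \x m2).
  have /sigma_finiteP[F [TF ndF Foo]] := sigma_finiteT m1.
  have /sigma_finiteP[G [TG ndG Goo]] := sigma_finiteT m2.
  exists (fun n => F n `*` G n).
    rewrite -setXTT TF TG predeqE => -[x y]; split.
      move=> [/= [n _ Fnx] [k _ Gky]]; exists (maxn n k) => //; split.
      - by move: x Fnx; exact/subsetPset/ndF/leq_maxl.
      - by move: y Gky; exact/subsetPset/ndG/leq_maxr.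
    by move=> [n _ []/= ? ?]; split; exists n.
  move=> k; have [? ?] := Foo k; have [? ?] := Goo k.
  split; first exact: measurableX.
  by rewrite product_measure1E// lte_mul_pinfty// ge0_fin_numE.
pose mix := Measure_isSigmaFinite.Build _ _ _ (m1 \x m2) sf.
pose M : {sigma_finite_measure set (T1 * T2)%type -> \bar R} := HB.pack (m1 \x m2) mix.
exists M => f mf f0; exact: fubini_tonelli1.
Qed.

End LebesgueInvariance.

(** * Monotonicity and Tonelli for the iterated integral over $\mathbb{C}^n$ *)

Section CnIntegral.
Variable R : realType.
Local Notation C := (R[i]%C : numClosedFieldType).
Local Notation Re := (@complex.Re R).
Local Notation Im := (@complex.Im R).
Local Notation mu := (@lebesgue_measure R).
Local Notation L := (measurableTypeR R).
Local Notation borel := (borelCn R).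
Local Open Scope ereal_scope.

(** Only [f] has to be integrable. If $\int g=+\infty$, the positive part of $f-g$ still has a
    finite integral, being at most $f$, while $g\le(f-g)^-+f$ makes the integral of the negative
    part infinite; both sides are then $-\infty$. *)
Lemma ge0_integralB d (T : measurableType d) (m : {measure set T -> \bar R})
    (D : set T) (f g : T -> \bar R) : measurable D ->
  measurable_fun D f -> measurable_fun D g ->
  (forall x, D x -> 0 <= f x < +oo) -> (forall x, D x -> 0 <= g x) ->
  \int[m]_(x in D) f x < +oo ->
  \int[m]_(x in D) (f x - g x) = \int[m]_(x in D) f x - \int[m]_(x in D) g x.
Proof.
move=> mD mf mg f0 g0 intf.
have If0 : 0 <= \int[m]_(x in D) f x by apply: integral_ge0 => x /f0/andP[].
have Ig0 : 0 <= \int[m]_(x in D) g x by exact: integral_ge0.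
have mfg : measurable_fun D (fun x => f x - g x) by exact: emeasurable_funB.
have [intg|] := ltP (\int[m]_(x in D) g x) +oo.
  apply: integralB => //; apply/integrableP; split=> //.
    rewrite (eq_integral f) // => x /set_mem/f0/andP[fx _].
    by rewrite gee0_abs.
  rewrite (eq_integral g) // => x /set_mem/g0 gx.
  by rewrite gee0_abs.
rewrite leye_eq => /eqP intg; rewrite intg integralE.
have pf : \int[m]_(x in D) (fun x => f x - g x)^\+ x <= \int[m]_(x in D) f x.
  apply: ge0_le_integral => //; first exact: measurable_funepos.
  move=> x Dx; rewrite funeposE ge_max; have /andP[fx0 fxoo] := f0 x Dx.
  rewrite fx0 andbT; have := g0 x Dx; move: fx0 fxoo.
  case: (f x) => [a||] //; case: (g x) => [b||] //=.
  by rewrite !lee_fin => *; rewrite gerBl.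
have nf : \int[m]_(x in D) g x <=
    \int[m]_(x in D) (fun x => f x - g x)^\- x + \int[m]_(x in D) f x.
  rewrite -ge0_integralD //; last 2 first.
  - exact: measurable_funeneg.
  - by move=> x /f0/andP[].
  apply: ge0_le_integral => //.
    by apply: emeasurable_funD => //; exact: measurable_funeneg.
  move=> x Dx; have /andP[fx0 fxoo] := f0 x Dx.
  rewrite funenegE; have := g0 x Dx; move: fx0 fxoo.
  case: (f x) => [a||] //; case: (g x) => [b||] //= _ _ _.
  by rewrite -EFin_max -EFinD lee_fin opprB -lerBlDr le_max lexx.
rewrite intg leye_eq in nf.
have -> : \int[m]_(x in D) (fun x => f x - g x)^\- x = +oo.
  apply/eqP; move: nf; case: (\int[m]_(x in D) _^\- x) => [r||] //.
  by move: intf If0; case: (\int[m]_(x in D) f x).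
have : \int[m]_(x in D) (fun x => f x - g x)^\+ x < +oo by exact: le_lt_trans pf intf.
move: intf; case: (\int[m]_(x in D) f x) => [r||] //;
  by case: (\int[m]_(x in D) _^\+ x).
Qed.

(** The vector at which one recursion step of [Cn_integral] evaluates the integrand. *)
Definition ccons n (x y : R) (w : 'Cn[R]_n) : 'Cn[R]_n.+1 :=
  row_mx ((x +i* y)%C%:M : 'Cn[R]_1) w.

Lemma ccons0 n x y (w : 'Cn[R]_n) : ccons x y w 0%R ord0 = (x +i* y)%C.
Proof.
rewrite (_ : ord0 = lshift n (ord0 : 'I_1)); last exact/val_inj.
by transitivity (((x +i* y)%C%:M : 'Cn[R]_1) 0%R ord0); [exact: row_mxEl|rewrite mxE eqxx mulr1n].
Qed.

Lemma cconsS n x y (w : 'Cn[R]_n) j : ccons x y w 0%R (lift ord0 j) = w 0%R j.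
Proof.
rewrite (_ : lift ord0 j = rshift 1 j); last exact/val_inj.
exact: row_mxEr.
Qed.

Lemma ccons_eq n (z : 'Cn[R]_n.+1) :
  z = ccons (Re (z 0%R ord0)) (Im (z 0%R ord0)) (\row_j z 0%R (lift ord0 j)).
Proof.
apply/rowP => j; case: (unliftP ord0 j) => [k ->|->].
  by rewrite cconsS mxE.
by rewrite ccons0; case: (z 0%R ord0).
Qed.

Lemma cconsD n x y (w : 'Cn[R]_n) x' y' w' :
  (ccons x y w + ccons x' y' w' = ccons (x + x') (y + y') (w + w'))%R.
Proof.
apply/rowP => j; rewrite mxE; case: (unliftP ord0 j) => [k ->|->].
  by rewrite !cconsS mxE.
by rewrite !ccons0.
Qed.

Lemma cconsZ n x y (w : 'Cn[R]_n) (a b : R) :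
  ((a +i* b)%C *: ccons x y w =
   ccons (a * x - b * y) (b * x + a * y) ((a +i* b)%C *: w))%R.
Proof.
apply/rowP => j; rewrite mxE; case: (unliftP ord0 j) => [k ->|->].
  by rewrite !cconsS mxE.
by rewrite !ccons0; apply/eqP; rewrite eq_complex /= addrC (addrC (b * x)%R) !eqxx.
Qed.

Lemma rnorm_ccons n x y (w : 'Cn[R]_n) :
  (Num.max (Num.max `|x| `|y|) (rnorm w) <= rnorm (ccons x y w))%R.
Proof.
have := rnorm_coord (ccons x y w) ord0; rewrite ccons0 => h.
rewrite !ge_max (le_trans (normc_Re_le _) h) (le_trans (normc_Im_le _) h) /=.
apply/ler_addgt0Pr => e e0; apply/ltW/rnorm_lt.
  by rewrite ltr_wpDl // rnorm_ge0.
move=> j; have := rnorm_coord (ccons x y w) (lift ord0 j); rewrite cconsS => /le_lt_trans.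
by apply; rewrite ltrDl.
Qed.

Lemma measurable_ccons d (X : measurableType d) n (a b : X -> L) (g : X -> borel n) :
  measurable_fun setT a -> measurable_fun setT b -> measurable_fun setT g ->
  measurable_fun setT (fun x => ccons (a x) (b x) (g x) : borel n.+1).
Proof.
move=> ma mb mg; apply: measurable_fun_Cn => j; case: (unliftP ord0 j) => [k ->|->].
- under eq_fun do rewrite cconsS.
  exact: (measurableT_comp (measurable_Re k) mg).
- by under eq_fun do rewrite ccons0.
- under eq_fun do rewrite cconsS.
  exact: (measurableT_comp (measurable_Im k) mg).
- by under eq_fun do rewrite ccons0.
Qed.

(* Writes the iterated integral as one integral against a sigma-finite measure, so that the
   library forms of monotonicity and Tonelli apply to it. *)
Lemma Cn_integral_repr n : exists d (T : measurableType d)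
    (m : {sigma_finite_measure set T -> \bar R}) (e : T -> borel n),
  measurable_fun setT e /\
  forall f : borel n -> \bar R, measurable_fun setT f -> (forall z, 0 <= f z) ->
    Cn_integral f = \int[m]_t f (e t).
Proof.
elim: n => [|n [d [T [m [e [me IH]]]]]].
  (* $\mathbb{C}^0$ is a point and the integral over it is evaluation there, which a Dirac mass
     represents. *)
  exists _, L, (\d_ (0%R : L)), (fun=> 0%R); split; first exact: measurable_cst.
  by move=> f mf f0 /=; rewrite integral_dirac ?diracT ?mul1e.
have [m1 m1E] := prod_sigma_finite (mu : {sigma_finite_measure set L -> \bar R}) m.
have [m2 m2E] := prod_sigma_finite (mu : {sigma_finite_measure set L -> \bar R}) m1.
have mc : measurable_fun setT
    (fun p : L * (L * T) => ccons p.1 p.2.1 (e p.2.2) : borel n.+1).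
  apply: measurable_ccons => //.
    exact: (measurableT_comp measurable_fst measurable_snd).
  exact: (measurableT_comp me (measurableT_comp measurable_snd measurable_snd)).
have mc1 x : measurable_fun setT (fun p : L * T => ccons x p.1 (e p.2) : borel n.+1).
  apply: measurable_ccons => //.
  exact: (measurableT_comp me measurable_snd).
have mc2 x y : measurable_fun setT (fun w : borel n => ccons x y w : borel n.+1).
  exact: measurable_ccons.
exists _, _, m2, (fun p => ccons p.1 p.2.1 (e p.2.2)); split => // f mf f0.
rewrite (m2E _ (measurableT_comp mf mc) (fun=> f0 _)).
apply: eq_integral => x _ /=; rewrite (m1E _ (measurableT_comp mf (mc1 x)) (fun=> f0 _)).
apply: eq_integral => y _ /=.
exact: (IH _ (measurableT_comp mf (mc2 x y)) (fun=> f0 _)).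
Qed.

Lemma Cn_integral_ge0 n (f : borel n -> \bar R) :
  measurable_fun setT f -> (forall z, 0 <= f z) -> 0 <= Cn_integral f.
Proof.
have [d [T [m [e [me IE]]]]] := Cn_integral_repr n.
by move=> mf f0; rewrite IE //; exact: integral_ge0.
Qed.

Lemma le_Cn_integral n (f g : borel n -> \bar R) :
  measurable_fun setT f -> measurable_fun setT g ->
  (forall z, 0 <= f z) -> (forall z, f z <= g z) ->
  Cn_integral f <= Cn_integral g.
Proof.
have [d [T [m [e [me IE]]]]] := Cn_integral_repr n.
move=> mf mg f0 fg; have g0 z : 0 <= g z by exact: le_trans (f0 z) (fg z).
rewrite !IE //; apply: ge0_le_integral => // ; exact: measurableT_comp.
Qed.

Lemma Cn_integralZl n (f : borel n -> \bar R) (k : \bar R) :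
  measurable_fun setT f -> (forall z, 0 <= f z) -> 0 <= k ->
  Cn_integral (fun z => k * f z) = k * Cn_integral f.
Proof.
have [d [T [m [e [me IE]]]]] := Cn_integral_repr n.
move=> mf f0 k0; rewrite !IE //; last 2 first.
- by apply: emeasurable_funM.
- by move=> z; rewrite mule_ge0.
by rewrite ge0_integralZl //; exact: measurableT_comp.
Qed.

Lemma Cn_integral_tonelli n d (X : measurableType d)
    (m : {sigma_finite_measure set X -> \bar R}) (f : X * borel n -> \bar R) :
  measurable_fun setT f -> (forall p, 0 <= f p) ->
  \int[m]_x Cn_integral (fun z => f (x, z)) = Cn_integral (fun z => \int[m]_x f (x, z)).
Proof.
have [d' [T [m' [e [me IE]]]]] := Cn_integral_repr n.
move=> mf f0; rewrite IE; last 2 first.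
- exact: (measurable_fun_fubini_tonelli_G (m1 := m) _ mf f0).
- by move=> z; exact: integral_ge0.
have mfe : measurable_fun setT (fun p : X * T => f (p.1, e p.2)).
  apply: measurableT_comp => //; apply: measurable_fun_pair => //=.
  exact: (measurableT_comp me measurable_snd).
rewrite -(fubini_tonelli (fun p : X * T => f (p.1, e p.2))) //.
by apply: eq_integral => x _; rewrite (IE (fun z => f (x, z))) //; exact: measurableT_comp.
Qed.

Lemma measurable_Cn_integral n d (X : measurableType d) (f : X * borel n -> \bar R) :
  measurable_fun setT f -> (forall p, 0 <= f p) ->
  measurable_fun setT (fun x => Cn_integral (fun z => f (x, z))).
Proof.
have [d' [T [m' [e [me IE]]]]] := Cn_integral_repr n.
move=> mf f0.
have mfe : measurable_fun setT (fun p : X * T => f (p.1, e p.2)).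
  apply: measurableT_comp => //; apply: measurable_fun_pair => //=.
  exact: (measurableT_comp me measurable_snd).
have := measurable_fun_fubini_tonelli_F (m2 := m') _ mfe (fun=> f0 _).
apply: eq_measurable_fun => x _; rewrite /fubini_F /=.
have mx : measurable_fun setT (fun z : borel n => (x, z)) by exact: measurable_fun_pair.
by rewrite (IE _ (measurableT_comp mf mx) (fun=> f0 _)).
Qed.

End CnIntegral.

(** * Invariance of the integral over $\mathbb{C}^n$, volumes of balls, integrals of differences *)

Section CnIntegralInvariance.
Variable R : realType.
Local Notation C := (R[i]%C : numClosedFieldType).
Local Notation Re := (@complex.Re R).
Local Notation Im := (@complex.Im R).
Local Notation mu := (@lebesgue_measure R).
Local Notation L := (measurableTypeR R).
Local Notation borel := (borelCn R).
Local Open Scope ereal_scope.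

Lemma measurable_ccons_pair n :
  measurable_fun setT (fun p : (L * L) * borel n => ccons p.1.1 p.1.2 p.2 : borel n.+1).
Proof.
apply: measurable_ccons => //.
- exact: (measurableT_comp measurable_fst measurable_fst).
- exact: (measurableT_comp measurable_snd measurable_fst).
Qed.

Lemma measurable_ccons_slice n (x y : R) :
  measurable_fun setT (fun w : borel n => ccons x y w : borel n.+1).
Proof. exact: measurable_ccons. Qed.

Lemma measurable_slice_integral n (f : borel n.+1 -> \bar R) :
  measurable_fun setT f -> (forall z, 0 <= f z) ->
  measurable_fun setT (fun p : L * L => Cn_integral (fun w => f (ccons p.1 p.2 w))).
Proof.
move=> mf f0.
exact: (measurable_Cn_integral (measurableT_comp mf (@measurable_ccons_pair n)) (fun=> f0 _)).
Qed.

Lemma slice_integral_ge0 n (f : borel n.+1 -> \bar R) (x y : R) :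
  measurable_fun setT f -> (forall z, 0 <= f z) ->
  0 <= Cn_integral (fun w => f (ccons x y w)).
Proof.
move=> mf f0.
exact: (Cn_integral_ge0 (measurableT_comp mf (measurable_ccons_slice x y)) (fun=> f0 _)).
Qed.

Lemma Cn_integral_shift n (f : borel n -> \bar R) (h : 'Cn[R]_n) :
  measurable_fun setT f -> (forall z, 0 <= f z) ->
  Cn_integral (fun z => f (z + h)%R) = Cn_integral f.
Proof.
elim: n f h => [|n IH] f h mf f0 /=.
  by congr f; apply/rowP => -[].
set a := Re (h 0%R ord0); set b := Im (h 0%R ord0); set h' := \row_j h 0%R (lift ord0 j).
pose F (p : L * L) := Cn_integral (fun w => f (ccons p.1 p.2 w)).
have mF : measurable_fun setT F by exact: measurable_slice_integral.
have F0 p : 0 <= F p by exact: slice_integral_ge0.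
transitivity (\int[mu]_x \int[mu]_y F (x + a, y + b)%R).
  apply: eq_integral => x _; apply: eq_integral => y _; rewrite /F /=.
  have := IH _ h' (measurableT_comp mf (measurable_ccons_slice (x + a)%R (y + b)%R)) (fun=> f0 _).
  move=> <-; congr Cn_integral; apply/funext => w /=.
  by rewrite -[row_mx _ _]/(ccons x y w) {1}(ccons_eq h) cconsD.
have mFx x : measurable_fun setT (fun y : L => F (x, y)) by exact: measurableT_comp.
under eq_integral => x _ do rewrite (ge0_integral_shift (f := fun y => F (x + a, y)%R)) //.
rewrite (ge0_integral_shift (f := fun x => \int[mu]_y F (x, y))) //.
  exact: (measurable_fun_fubini_tonelli_F (m2 := mu) _ mF F0).
by move=> x; exact: integral_ge0.
Qed.

(** A scalar of modulus 1 rotates every complex coordinate separately, so [plane_rotation] is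
    applied to one coordinate at a time; its shears need [b != 0]. *)
Lemma Cn_integral_rotation_aux n (f : borel n -> \bar R) (a b : R) :
  measurable_fun setT f -> (forall z, 0 <= f z) ->
  (a ^+ 2 + b ^+ 2 = 1)%R -> b != 0%R ->
  Cn_integral (fun z => f ((a +i* b)%C *: z)%R) = Cn_integral f.
Proof.
move=> mf f0 ab b0; elim: n f mf f0 => [|n IH] f mf f0 /=.
  by congr f; apply/rowP => -[].
pose F (p : L * L) := Cn_integral (fun w => f (ccons p.1 p.2 w)).
have mF : measurable_fun setT F by exact: measurable_slice_integral.
have F0 p : 0 <= F p by exact: slice_integral_ge0.
rewrite -[RHS](plane_rotation (G := F) mF F0 ab b0).
apply: eq_integral => x _; apply: eq_integral => y _; rewrite /F /=.
have := IH _ (measurableT_comp mf (measurable_ccons_slice (a * x - b * y)%R (b * x + a * y)%R)) (fun=> f0 _).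
move=> <-; congr Cn_integral; apply/funext => w /=.
by rewrite -[row_mx _ _]/(ccons x y w) cconsZ.
Qed.

Lemma measurable_scale n (a b : R) :
  measurable_fun setT (fun z : borel n => ((a +i* b)%C *: (z : 'Cn[R]_n))%R : borel n).
Proof.
apply: measurable_fun_Cn => j.
- under eq_fun do rewrite mxE.
  rewrite (_ : (fun _ => _) = (fun z : borel n => a * Re (z 0 j) - b * Im (z 0 j))%R).
    by apply: measurable_funB; apply: measurable_funM => //; [exact: measurable_Re|exact: measurable_Im].
  by apply/funext => z; case: (z 0%R j).
- under eq_fun do rewrite mxE.
  rewrite (_ : (fun _ => _) = (fun z : borel n => a * Im (z 0 j) + b * Re (z 0 j))%R).
    by apply: measurable_funD; apply: measurable_funM => //; [exact: measurable_Im|exact: measurable_Re].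
  by apply/funext => z; case: (z 0%R j).
Qed.

(** In the remaining case $b=0$ the scalar is $a=(ia)(-i)$, a product of two unit scalars with
    nonzero imaginary part. *)
Lemma Cn_integral_rotation n (f : borel n -> \bar R) (a b : R) :
  measurable_fun setT f -> (forall z, 0 <= f z) ->
  (a ^+ 2 + b ^+ 2 = 1)%R ->
  Cn_integral (fun z => f ((a +i* b)%C *: z)%R) = Cn_integral f.
Proof.
move=> mf f0 ab; have [b0|b0] := eqVneq b 0%R; last exact: Cn_integral_rotation_aux.
have i1 : (0 ^+ 2 + 1 ^+ 2 = 1 :> R)%R by rewrite expr0n add0r expr1n.
pose g (z : borel n) := f ((b +i* a)%C *: (z : 'Cn[R]_n))%R.
have mg : measurable_fun setT g by exact: (measurableT_comp mf (measurable_scale b a)).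
have ba : (b ^+ 2 + a ^+ 2 = 1)%R by rewrite addrC.
have a0 : a != 0%R.
  by apply/eqP => a0; move: ab; rewrite a0 b0 expr0n addr0 => /eqP; rewrite eq_sym oner_eq0.
have i0 : (-1 : R)%R != 0%R by rewrite oppr_eq0 oner_eq0.
have i1' : (0 ^+ 2 + (-1) ^+ 2 = 1 :> R)%R by rewrite expr0n add0r sqrrN expr1n.
rewrite -(Cn_integral_rotation_aux mf f0 ba a0).
rewrite -[RHS](Cn_integral_rotation_aux mg (fun=> f0 _) i1' i0).
congr Cn_integral; apply/funext => z; rewrite /g scalerA; congr (f (_ *: _)%R).
by apply/eqP; rewrite eq_complex /= b0; apply/andP; split; apply/eqP; ring.
Qed.

Lemma open_rball n (s : R) : open [set z : 'Cn[R]_n | (rnorm z < s)%R].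
Proof.
rewrite (_ : mkset _ = (@rnorm R 'Cn[R]_n) @^-1` [set x | (x < s)%R]) //.
by apply: open_comp => [z _|]; [exact: rnorm_continuous|exact: open_lt].
Qed.

Lemma measurable_indic_open n (U : set 'Cn[R]_n) : open U ->
  measurable_fun setT (fun z : borel n => (\1_U z : R)%:E).
Proof.
by move=> oU; apply/measurable_EFinP/measurable_indic; exact: open_measurable_Cn.
Qed.

Lemma integral_lower_bound (g : L -> \bar R) (c s : R) : (0 <= s)%R -> (0 <= c)%R ->
  measurable_fun setT g -> (forall x, 0 <= g x) ->
  (forall x, (`|x| < s)%R -> c%:E <= g x) -> (c * (s *+ 2))%:E <= \int[mu]_x g x.
Proof.
move=> s0 c0 mg g0 cg; apply: (@le_trans _ _ (\int[mu]_(x in `](- s)%R, s[) g x)).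
  apply: (@le_trans _ _ (\int[mu]_(x in `](- s)%R, s[) (cst c%:E x))).
    rewrite integral_cst //= lebesgue_measure_itv /= lte_fin.
    case: ltP => [_|ss]; first by rewrite -EFinD -EFinM lee_fin opprK mulr2n.
    by rewrite mule0 lee_fin (_ : s = 0%R) ?mul0rn ?mulr0 //; lra.
  apply: ge0_le_integral => //.
  - exact: measurable_funTS.
  - by move=> x /=; rewrite in_itv /= -ltr_norml; exact: cg.
by apply: ge0_subset_integral.
Qed.

Lemma integral_upper_bound (g : L -> \bar R) (c s : R) : (0 <= s)%R -> (0 <= c)%R ->
  measurable_fun setT g -> (forall x, 0 <= g x <= c%:E) ->
  (forall x, (s < `|x|)%R -> g x = 0) -> \int[mu]_x g x <= (c * (s *+ 2))%:E.
Proof.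
move=> s0 c0 mg gc gs.
have -> : \int[mu]_x g x = \int[mu]_(x in `[(- s)%R, s]) g x.
  rewrite [RHS]integral_mkcond; apply: eq_integral => x _; rewrite patchE.
  case: ifPn => // /negP xs; apply: gs; rewrite ltNge; apply/negP => xs'.
  by apply: xs; rewrite inE /= in_itv /= -ler_norml.
apply: (@le_trans _ _ (\int[mu]_(x in `[(- s)%R, s]) (cst c%:E x))).
  apply: ge0_le_integral => //.
  - by move=> x _; have /andP[] := gc x.
  - exact: measurable_funTS.
  - by move=> x _; have /andP[] := gc x.
rewrite integral_cst //= lebesgue_measure_itv /= lte_fin.
case: ltP => [_|ss]; first by rewrite -EFinD -EFinM lee_fin opprK mulr2n.
by rewrite mule0 lee_fin mulr_ge0 // mulrn_wge0.
Qed.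

(** The ball contains a cube of side [s]: a coordinate $x+iy$ with $|x|,|y|<s/2$ has modulus below
    [s]. Later estimates use only that the volume is bounded below by a positive constant. *)
Lemma Cn_integral_ball_gt0 n (s : R) : (0 < s)%R ->
  exists2 k : R, (0 < k)%R &
    k%:E <= Cn_integral (fun z : borel n => (\1_[set z : 'Cn[R]_n | (rnorm z < s)%R] z : R)%:E).
Proof.
move=> s0; elim: n => [|n [k k0 IH]].
  by exists 1%R => //=; rewrite indicE mem_set //= rnorm0.
have s20 : (0 <= s / 2)%R by rewrite divr_ge0 // ltW.
exists (k * (s / 2 *+ 2) * (s / 2 *+ 2))%R.
  by rewrite !mulr_gt0 // pmulrn_rgt0 // divr_gt0.
set f := fun z : borel n.+1 => (\1_[set z : 'Cn[R]_n.+1 | (rnorm z < s)%R] z : R)%:E.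
have mf : measurable_fun setT f by apply: measurable_indic_open; exact: open_rball.
have f0 z : 0 <= f z by rewrite /f lee_fin.
pose F (p : L * L) := Cn_integral (fun w => f (ccons p.1 p.2 w)).
have mF : measurable_fun setT F by exact: measurable_slice_integral.
have F0 p : 0 <= F p by exact: slice_integral_ge0.
have kF x y : (`|x| < s / 2)%R -> (`|y| < s / 2)%R -> k%:E <= F (x, y).
  move=> xs ys; apply: le_trans IH _.
  apply: (le_Cn_integral _ (measurableT_comp mf (measurable_ccons_slice x y))).
  - by apply: measurable_indic_open; exact: open_rball.
  - by move=> z; rewrite lee_fin.
  move=> w; rewrite /f /= lee_fin [in leLHS]indicE.
  case: (boolP (w \in _)) => [/set_mem /= w0|_] //; have ws := (rnorm_lt w s0).1 w0.
  rewrite indicE mem_set //=; apply/rnorm_lt => // j.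
  case: (unliftP ord0 j) => [i ->|->]; first by rewrite cconsS; exact: ws.
  rewrite ccons0; apply: le_lt_trans (rnorm_le_ReIm _) _ => /=.
  by rewrite [ltRHS]splitr ltrD.
have mFx x : measurable_fun setT (fun y : L => F (x, y)).
  exact: (measurableT_comp mF (measurable_fun_pair (measurable_cst x) (@measurable_id _ _ setT))).
have mFF : measurable_fun setT (fun x : L => \int[mu]_y F (x, y)).
  exact: (measurable_fun_fubini_tonelli_F (m2 := mu) _ mF F0).
have FF0 x : 0 <= \int[mu]_y F (x, y).
  by apply: integral_ge0 => y _; exact: F0.
have ks0 : (0 <= k * (s / 2 *+ 2))%R by rewrite mulr_ge0 ?mulrn_wge0 // ltW.
apply: (integral_lower_bound s20 ks0 mFF FF0) => x xs.
apply: (integral_lower_bound s20 (ltW k0) (mFx x) (fun y => F0 (x, y))) => y ys.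
exact: kF.
Qed.

Lemma Cn_integral0 n : Cn_integral (fun _ : 'Cn[R]_n => 0 : \bar R) = 0.
Proof.
elim: n => //= n IH.
by under eq_integral => x _ do (under eq_integral => y _ do rewrite IH; rewrite integral0); rewrite integral0.
Qed.

(** The function $f-g$ has no sign, so its iterated integral has to be split one real coordinate at
    a time. Each splitting needs a finite integral of [f], hence the two claims are proved by one
    induction: the bound is [M] times the volume of a box of side $2\rho$ in $2n$ real
    dimensions. *)
Lemma Cn_integralB n (f g : borel n -> \bar R) (M rho : R) :
  (0 <= M)%R -> (0 <= rho)%R ->
  measurable_fun setT f -> measurable_fun setT g ->
  (forall z, 0 <= f z <= M%:E) -> (forall z, 0 <= g z) ->
  (forall z : 'Cn[R]_n, (rho < rnorm z)%R -> f z = 0) ->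
  Cn_integral f <= (M * (rho *+ 2) ^+ n.*2)%:E /\
  Cn_integral (fun z => f z - g z) = Cn_integral f - Cn_integral g.
Proof.
move=> M0 rho0; elim: n f g => [|n IH] f g mf mg fM g0 frho.
  by rewrite /= mulr1; have /andP[] := fM 0%R.
have f0 z : 0 <= f z by have /andP[] := fM z.
pose F (p : L * L) := Cn_integral (fun w => f (ccons p.1 p.2 w)).
pose G (p : L * L) := Cn_integral (fun w => g (ccons p.1 p.2 w)).
have mF : measurable_fun setT F by exact: measurable_slice_integral.
have mG : measurable_fun setT G by exact: measurable_slice_integral.
have F0 p : 0 <= F p by exact: slice_integral_ge0.
have G0 p : 0 <= G p by exact: slice_integral_ge0.
set B := (M * (rho *+ 2) ^+ n.*2)%R.
have B0 : (0 <= B)%R by rewrite mulr_ge0 // exprn_ge0 // mulrn_wge0.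
have IHxy x y := IH (fun w => f (ccons x y w)) (fun w => g (ccons x y w))
  (measurableT_comp mf (measurable_ccons_slice x y))
  (measurableT_comp mg (measurable_ccons_slice x y)) (fun=> fM _) (fun=> g0 _).
have fxy x y w : (rho < rnorm w)%R -> f (ccons x y w) = 0.
  move=> w0; apply: frho; apply: lt_le_trans w0 _.
  by apply: le_trans (rnorm_ccons x y w); rewrite le_max lexx orbT.
have FB x y : 0 <= F (x, y) <= B%:E.
  by rewrite F0 /=; exact: (IHxy x y (fxy x y)).1.
have FGE x y : Cn_integral (fun w => f (ccons x y w) - g (ccons x y w)) = F (x, y) - G (x, y).
  exact: (IHxy x y (fxy x y)).2.
have F_0 x y : (rho < Num.max `|x| `|y|)%R -> F (x, y) = 0.
  move=> xy; rewrite /F /= -[RHS](Cn_integral0 n); congr Cn_integral; apply/funext => w.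
  apply: frho; apply: lt_le_trans xy _.
  by apply: le_trans (rnorm_ccons x y w); rewrite le_max lexx.
have mFx x : measurable_fun setT (fun y : L => F (x, y)).
  exact: (measurableT_comp mF (measurable_fun_pair (measurable_cst x) (@measurable_id _ _ setT))).
have mGx x : measurable_fun setT (fun y : L => G (x, y)).
  exact: (measurableT_comp mG (measurable_fun_pair (measurable_cst x) (@measurable_id _ _ setT))).
have B20 : (0 <= B * (rho *+ 2))%R by rewrite mulr_ge0 // mulrn_wge0.
have FFB x : 0 <= \int[mu]_y F (x, y) <= (B * (rho *+ 2))%:E.
  rewrite integral_ge0 //=; apply: integral_upper_bound => // y yrho.
  by apply: F_0; rewrite lt_max yrho orbT.
have FF0 x : (rho < `|x|)%R -> \int[mu]_y F (x, y) = 0.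
  move=> xrho; under eq_integral => y _ do rewrite F_0 ?lt_max ?xrho //.
  by rewrite integral0.
have mFF : measurable_fun setT (fun x : L => \int[mu]_y F (x, y)).
  exact: (measurable_fun_fubini_tonelli_F (m2 := mu) _ mF F0).
have mGG : measurable_fun setT (fun x : L => \int[mu]_y G (x, y)).
  exact: (measurable_fun_fubini_tonelli_F (m2 := mu) _ mG G0).
have IFB := integral_upper_bound rho0 B20 mFF FFB FF0.
have -> : (M * (rho *+ 2) ^+ n.+1.*2 = B * (rho *+ 2) * (rho *+ 2))%R.
  by rewrite doubleS !exprSr !mulrA.
split; first exact: IFB.
transitivity (\int[mu]_x (\int[mu]_y F (x, y) - \int[mu]_y G (x, y))).
  apply: eq_integral => x _; rewrite -ge0_integralB //; first last.
  - by apply: le_lt_trans (ltry (B * (rho *+ 2))); have /andP[] := FFB x.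
  - by move=> y _; have /andP[-> h] := FB x y; exact: le_lt_trans h (ltry _).
  by apply: eq_integral => y _; exact: FGE.
rewrite ge0_integralB //.
- by move=> x _; have /andP[-> h] := FFB x; exact: le_lt_trans h (ltry _).
- by move=> x _; exact: integral_ge0.
- exact: le_lt_trans IFB (ltry _).
Qed.

End CnIntegralInvariance.

(** * Circles in $\mathbb{C}^n$ and integrals of periodic functions *)

Section Circles.
Variable R : realType.
Local Notation C := (R[i]%C : numClosedFieldType).
Local Notation Re := (@complex.Re R).
Local Notation Im := (@complex.Im R).
Local Notation mu := (@lebesgue_measure R).
Local Notation L := (measurableTypeR R).
Local Notation borel := (borelCn R).
Local Notation I2pi := (`[0%R, (2 * pi)%R]%classic : set L).

Definition circ n (a b : 'Cn[R]_n) (t : R) : 'Cn[R]_n :=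
  a + (cos t +i* sin t)%C *: b.

Lemma measurable_affine d (X : measurableType d) n (al be : X -> R)
    (g h : X -> borel n) :
  measurable_fun setT al -> measurable_fun setT be ->
  measurable_fun setT g -> measurable_fun setT h ->
  measurable_fun setT
    (fun x => (g x : 'Cn[R]_n) + (al x +i* be x)%C *: (h x : 'Cn[R]_n) : borel n).
Proof.
move=> mal mbe mg mh; apply: measurable_fun_Cn => j.
- rewrite (_ : (fun _ => _) = (fun x => Re (g x 0 j) +
      (al x * Re (h x 0 j) - be x * Im (h x 0 j)))); last first.
    by apply/funext => x; rewrite !mxE; case: (g x 0 j) (h x 0 j) => [? ?] [? ?].
  apply: measurable_funD; first exact: (measurableT_comp (measurable_Re j) mg).
  apply: measurable_funB; apply: measurable_funM => //.
  - exact: (measurableT_comp (measurable_Re j) mh).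
  - exact: (measurableT_comp (measurable_Im j) mh).
- rewrite (_ : (fun _ => _) = (fun x => Im (g x 0 j) +
      (al x * Im (h x 0 j) + be x * Re (h x 0 j)))); last first.
    by apply/funext => x; rewrite !mxE; case: (g x 0 j) (h x 0 j) => [? ?] [? ?].
  apply: measurable_funD; first exact: (measurableT_comp (measurable_Im j) mg).
  apply: measurable_funD; apply: measurable_funM => //.
  - exact: (measurableT_comp (measurable_Im j) mh).
  - exact: (measurableT_comp (measurable_Re j) mh).
Qed.

Lemma measurable_cos : measurable_fun setT (cos : L -> R).
Proof. by apply: continuous_measurable_fun => x; exact: continuous_cos. Qed.

Lemma measurable_sin : measurable_fun setT (sin : L -> R).
Proof. by apply: continuous_measurable_fun => x; exact: continuous_sin. Qed.

Lemma measurable_circ n (a b : 'Cn[R]_n) :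
  measurable_fun setT (fun t : L => circ a b t : borel n).
Proof.
apply: measurable_affine; [exact: measurable_cos|exact: measurable_sin| |];
  exact: measurable_cst.
Qed.

Lemma measurable_usc_comp d (X : measurableType d) n (D : set 'Cn[R]_n)
    (u : 'Cn[R]_n -> \bar R) (g : X -> borel n) :
  open D -> usc_on D u -> measurable_fun setT g -> (forall x, D (g x)) ->
  measurable_fun setT (fun x => u (g x)).
Proof.
move=> oD uu mg Dg.
have mu_ : measurable_fun setT ((u \_ D) : borel n -> \bar R).
  apply/(measurable_restrictT (u : borel n -> \bar R) (open_measurable_Cn oD)).
  exact: usc_measurable_Cn.
apply: eq_measurable_fun (measurableT_comp mu_ mg) => x _ /=.
by rewrite patchE mem_set.
Qed.

Lemma integral_itv_shift (f : L -> \bar R) (x y a : R) :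
  measurable_fun setT f -> (forall t, (0 <= f t)%E) ->
  (\int[mu]_(t in `[x, y[) f (t + a)%R = \int[mu]_(t in `[(x + a)%R, (y + a)%R[) f t)%E.
Proof.
move=> mf f0; rewrite [LHS]integral_mkcond [RHS]integral_mkcond.
have mp : measurable_fun setT ((f : L -> \bar R) \_ (`[(x + a)%R, (y + a)%R[%classic : set L)).
  exact: ((measurable_restrictT f (measurable_itv _)).1 (measurable_funTS mf)).
have p0 t : (0 <= (f \_ `[(x + a)%R, (y + a)%R[) t)%E.
  by rewrite patchE; case: ifP.
rewrite -(ge0_integral_shift a mp p0).
apply: eq_integral => t _; rewrite !patchE.
have -> // : (t \in `[x, y[%classic) = (t + a \in `[(x + a)%R, (y + a)%R[%classic).
by apply/idP/idP; rewrite !inE /= !in_itv /= lerD2r ltrD2r.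
Qed.

Lemma circle_integralE (f : L -> \bar R) : measurable_fun setT f ->
  (\int[mu]_(t in I2pi) f t = \int[mu]_(t in `[0%R, (2 * pi)%R[) f t)%E.
Proof. by move=> mf; rewrite -integral_itv_bndo_bndc //; exact: measurable_funTS. Qed.

Lemma ge0_integral_itv_split (f : L -> \bar R) (x y z : R) :
  measurable_fun setT f -> (forall t, (0 <= f t)%E) -> x <= y -> y <= z ->
  (\int[mu]_(t in `[x, z[) f t =
   \int[mu]_(t in `[x, y[) f t + \int[mu]_(t in `[y, z[) f t)%E.
Proof.
move=> mf f0 xy yz.
have -> : `[x, z[%classic = `[x, y[ `|` `[y, z[.
  by apply: itv_bndbnd_setU; rewrite bnd_simp.
rewrite ge0_integral_setU //=; first exact: measurable_funTS.
apply/disj_setPS => t [] /=; rewrite !in_itv /= => /andP[_ ty] /andP[yt _].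
by move: (lt_le_trans ty yt); rewrite ltxx.
Qed.

(** Cut $[a,2\pi+a)$ at $2\pi$ and move the second piece back by one period. *)
Lemma circle_integral_shift (f : L -> \bar R) (a : R) :
  measurable_fun setT f -> (forall t, (0 <= f t)%E) ->
  (forall t, f (t + 2 * pi) = f t) -> 0 <= a <= 2 * pi ->
  (\int[mu]_(t in I2pi) f (t + a)%R = \int[mu]_(t in I2pi) f t)%E.
Proof.
move=> mf f0 fper /andP[a0 api].
have ms : measurable_fun setT (fun t : L => (t + a)%R : L) by exact: measurable_funD.
rewrite circle_integralE; last exact: (measurableT_comp mf ms).
rewrite circle_integralE // integral_itv_shift // add0r.
rewrite (ge0_integral_itv_split mf f0 api); last by rewrite lerDl.
rewrite (ge0_integral_itv_split mf f0 a0 api) addeC; congr (_ + _)%E.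
rewrite (addrC (2 * pi) a) -{1}(add0r (2 * pi)) -integral_itv_shift //.
by apply: eq_integral => t _; rewrite fper.
Qed.

Lemma two_pi_gt0 : 0 < 2 * pi :> R.
Proof. by rewrite mulr_gt0 // pi_gt0. Qed.

Lemma circle_measure : mu I2pi = (2 * pi)%:E.
Proof. by rewrite lebesgue_measure_itv /= lte_fin two_pi_gt0 -EFinB subr0. Qed.

Lemma circle_integral_cst (M : \bar R) : (\int[mu]_(t in I2pi) (fun=> M) t = M * (2 * pi)%:E)%E.
Proof. by rewrite -circle_measure -integral_cst. Qed.

(** Since $\int g=2\pi M-\int(M-g)$ holds even when the last integral is infinite, the mean value
    inequality can be traded for one about the nonnegative function $M-g$. All later arguments use
    this form. *)
Lemma submean_ge0 (g : L -> \bar R) (x : \bar R) (M : R) :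
  measurable_fun setT g -> (forall t, (g t <= M%:E)%E) -> 0 <= M -> (x < +oo)%E ->
  (x * (2 * pi)%:E <= \int[mu]_(t in I2pi) g t)%E <->
  (\int[mu]_(t in I2pi) (M%:E - g t) <= (2 * pi)%:E * (M%:E - x))%E.
Proof.
move=> mg gM M0 xoo; have pi0 := two_pi_gt0.
have mMg : measurable_fun setT (fun t : L => M%:E - g t)%E.
  by apply: emeasurable_funB => //; exact: measurable_cst.
have Mg0 t : (0 <= M%:E - g t)%E by rewrite sube_ge0 ?orbT ?gM.
have E : (\int[mu]_(t in I2pi) g t =
    M%:E * (2 * pi)%:E - \int[mu]_(t in I2pi) (M%:E - g t))%E.
  rewrite -circle_integral_cst -ge0_integralB //=.
  - apply: eq_integral => t _; have := gM t.
    by case: (g t) => [r||] //= _; rewrite -!EFinB subKr.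
  - exact: measurable_funTS.
  - by move=> t _; rewrite lee_fin M0 ltry.
  - by rewrite circle_integral_cst -EFinM ltry.
rewrite E; have : (0 <= \int[mu]_(t in I2pi) (M%:E - g t))%E by exact: integral_ge0.
case: (\int[mu]_(t in I2pi) (M%:E - g t))%E => [r||] // r0.
- case: x xoo => [x||] // _.
    rewrite -?EFinM -?EFinB -?EFinM !lee_fin mulrBr (mulrC _ M) (mulrC _ x).
    by split=> ?; lra.
  by rewrite gt0_mulNye ?lte_fin // (_ : (M%:E - -oo)%E = +oo%E) // gt0_muley ?lte_fin // leNye leey.
- case: x xoo => [x||] // _.
  by rewrite gt0_mulNye ?lte_fin // (_ : (M%:E - -oo)%E = +oo%E) // gt0_muley ?lte_fin.
Qed.

End Circles.

(** * Closure properties of plurisubharmonic functions, and Fatou's lemma on circles *)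

Section Psh.
Variable R : realType.
Local Notation C := (R[i]%C : numClosedFieldType).
Local Notation mu := (@lebesgue_measure R).
Local Notation L := (measurableTypeR R).
Local Notation I2pi := (`[0%R, (2 * pi)%R]%classic : set L).

Definition disc_in n (Omega : set 'Cn[R]_n) (a b : 'Cn[R]_n) :=
  forall c : C, `|c| <= 1 -> Omega (a + c *: b).

Lemma disc_in_circ n (Omega : set 'Cn[R]_n) a b t :
  disc_in Omega a b -> Omega (circ a b t).
Proof. by apply; rewrite normE rnorm_expi lecR. Qed.

Lemma disc_in_center n (Omega : set 'Cn[R]_n) a b : disc_in Omega a b -> Omega a.
Proof. by move=> /(_ 0); rewrite normr0 scale0r addr0 => /(_ ler01). Qed.

Lemma affine_continuous n (a b : 'Cn[R]_n) : continuous (fun c : C => a + c *: b).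
Proof.
move=> c U /nbhs_rnormP[e e0 eU]; apply/nbhs_rnormP.
have b0 : 0 < rnorm b + 1 by rewrite ltr_wpDl // rnorm_ge0.
exists (e / (rnorm b + 1)); first by rewrite divr_gt0.
move=> d dc; apply: eU; rewrite opprD addrACA subrr add0r -scalerBl rnormZ.
apply: (@le_lt_trans _ _ (rnorm (d - c) * (rnorm b + 1))).
  by rewrite ler_wpM2l ?rnorm_ge0 // lerDl.
by rewrite -ltr_pdivlMr.
Qed.

Lemma usc_disc_bounded n (Omega : set 'Cn[R]_n) u a b :
  open Omega -> usc_on Omega u -> (forall z, Omega z -> (u z < +oo)%E) ->
  disc_in Omega a b ->
  exists2 M : R, 0 <= M & forall c : C, `|c| <= 1 -> (u (a + c *: b)%R <= M%:E)%E.
Proof.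
move=> oO /usc_onP uu uoo dab.
have [M MP] : exists M : R, forall c : C, [set c : C | `|c| <= 1] c ->
    (u (a + c *: b)%R < M%:E)%E.
  apply: compact_ubound; first exact: compact_disc.
  move=> c /= c1; have Oc := dab c c1; have [r ur _] := lte_real_between (uoo _ Oc).
  exists r; have : \forall d \near c, Omega (a + d *: b) -> (u (a + d *: b)%R < r%:E)%E.
    exact: (affine_continuous (uu _ Oc r ur)).
  by apply: filterS => d + /dab Od; apply.
exists (Num.max 0 M); first by rewrite le_max lexx.
by move=> c c1; apply/ltW/(lt_le_trans (MP c c1)); rewrite lee_fin le_max lexx orbT.
Qed.

Lemma measurable_psh_circ n (Omega : set 'Cn[R]_n) u a b : open Omega ->
  usc_on Omega u -> disc_in Omega a b ->
  measurable_fun setT (fun t : L => u (circ a b t)).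
Proof.
move=> oO uu dab; apply: (measurable_usc_comp oO uu (measurable_circ a b)) => t.
exact: disc_in_circ.
Qed.

Lemma psh_circle n (Omega : set 'Cn[R]_n) u a b (M : R) : open Omega ->
  psh Omega u -> disc_in Omega a b -> 0 <= M ->
  (forall t, (u (circ a b t) <= M%:E)%E) ->
  (\int[mu]_(t in I2pi) (M%:E - u (circ a b t)) <= (2 * pi)%:E * (M%:E - u a))%E.
Proof.
move=> oO [uoo uu usub] dab M0 uM.
apply/(submean_ge0 (measurable_psh_circ oO uu dab) uM M0 (uoo _ (disc_in_center dab))).
exact: usub.
Qed.

Lemma psh_of_circle n (Omega : set 'Cn[R]_n) u : open Omega ->
  (forall z, Omega z -> (u z < +oo)%E) -> usc_on Omega u ->
  (forall a b, disc_in Omega a b -> exists M : R, [/\ 0 <= M,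
     forall t, (u (circ a b t) <= M%:E)%E &
     (\int[mu]_(t in I2pi) (M%:E - u (circ a b t)) <= (2 * pi)%:E * (M%:E - u a))%E]) ->
  psh Omega u.
Proof.
move=> oO uoo uu H; split=> // a b dab; have [M [M0 uM uI]] := H a b dab.
exact/(submean_ge0 (measurable_psh_circ oO uu dab) uM M0 (uoo _ (disc_in_center dab))).
Qed.

Lemma psh_disc_bounded n (Omega : set 'Cn[R]_n) u a b : open Omega ->
  psh Omega u -> disc_in Omega a b -> exists M : R, [/\ 0 <= M,
    (u a <= M%:E)%E & forall t, (u (circ a b t) <= M%:E)%E].
Proof.
move=> oO [uoo uu _] dab; have [M M0 MP] := usc_disc_bounded oO uu uoo dab.
exists M; split=> // [|t]; last by apply: MP; rewrite normE rnorm_expi lecR.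
by have := MP 0; rewrite normr0 scale0r addr0; apply; exact: ler01.
Qed.

Lemma usc_on_add n (D : set 'Cn[R]_n) (u w : 'Cn[R]_n -> \bar R) :
  (forall z, D z -> (u z < +oo)%E) -> (forall z, D z -> (w z < +oo)%E) ->
  usc_on D u -> usc_on D w -> usc_on D (fun z => u z + w z)%E.
Proof.
move=> uoo woo /usc_onP uu /usc_onP uw; apply/usc_onP => z Dz r zr.
have [p [q [up wq pq]]] : exists p q : R,
    [/\ (u z < p%:E)%E, (w z < q%:E)%E & p + q <= r].
  move: zr (uoo z Dz) (woo z Dz).
  case: (u z) => [x||] //; case: (w z) => [y||] //.
  - rewrite -EFinD lte_fin => xyr _ _; exists (x + (r - x - y) / 2), (y + (r - x - y) / 2).
    by split; rewrite ?lte_fin; lra.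
  - by move=> _ _ _; exists (x + 1), (r - x - 1); split; rewrite ?ltNyr ?lte_fin //; lra.
  - by move=> _ _ _; exists (r - y - 1), (y + 1); split; rewrite ?ltNyr ?lte_fin //; lra.
  - by move=> _ _ _; exists r, 0; split; rewrite ?ltNyr //; lra.
apply: filterS2 (uu z Dz p up) (uw z Dz q wq) => y + + Dy => /(_ Dy) uy /(_ Dy) wy.
by apply: lt_le_trans (lteD uy wy) _; rewrite -EFinD lee_fin.
Qed.

Lemma psh_add n (Omega : set 'Cn[R]_n) u w : open Omega ->
  psh Omega u -> psh Omega w -> psh Omega (fun z => u z + w z)%E.
Proof.
move=> oO pu pw; have [uoo uu _] := pu; have [woo uw _] := pw.
apply: psh_of_circle => //.
- by move=> z Oz; rewrite lte_add_pinfty ?uoo ?woo.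
- exact: usc_on_add.
move=> a b dab.
have [M [M0 uaM uM]] := psh_disc_bounded oO pu dab.
have [N [N0 waN wN]] := psh_disc_bounded oO pw dab.
exists (M + N); split; first exact: addr_ge0.
  by move=> t; rewrite EFinD leeD.
have E x y : (x <= M%:E -> y <= N%:E -> (M + N)%:E - (x + y) = (M%:E - x) + (N%:E - y))%E.
  by case: x => [x||] //; case: y => [y||] // _ _; rewrite -!EFinB; congr EFin; ring.
have ge0 (x : \bar R) (K : R) : (x <= K%:E -> 0 <= K%:E - x)%E.
  by move=> xK; rewrite sube_ge0 ?orbT.
rewrite E // ge0_muleDr ?ge0 //.
under eq_integral => t _ do rewrite E //.
have mM : measurable_fun setT (fun t : L => M%:E - u (circ a b t))%E.
  by apply: emeasurable_funB; [exact: measurable_cst|exact: measurable_psh_circ oO uu dab].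
have mN : measurable_fun setT (fun t : L => N%:E - w (circ a b t))%E.
  by apply: emeasurable_funB; [exact: measurable_cst|exact: measurable_psh_circ oO uw dab].
rewrite ge0_integralD //=.
- exact: leeD (psh_circle oO pu dab M0 uM) (psh_circle oO pw dab N0 wN).
- by move=> t _; exact: ge0.
- exact: measurable_funTS.
- by move=> t _; exact: ge0.
- exact: measurable_funTS.
Qed.

Lemma psh_scale n (Omega : set 'Cn[R]_n) u (k : R) : open Omega -> 0 < k ->
  psh Omega u -> psh Omega (fun z => k%:E * u z)%E.
Proof.
move=> oO k0 pu; have [uoo uu _] := pu.
have ku (x : \bar R) (r : R) : (k%:E * x < r%:E)%E = (x < (r / k)%:E)%E.
  by rewrite EFinM lte_pdivlMr // muleC.
apply: psh_of_circle => //.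
- move=> z /uoo; case: (u z) => [x||] // _; first exact: ltry.
  by rewrite gt0_muleNy.
- apply/usc_onP => z Oz r; rewrite ku => zr.
  have /usc_onP/(_ z Oz _ zr) := uu.
  by apply: filterS => y + Oy => /(_ Oy); rewrite ku.
move=> a b dab; have [M [M0 uaM uM]] := psh_disc_bounded oO pu dab.
exists (k * M); split; first by rewrite mulr_ge0 // ltW.
  by move=> t; rewrite EFinM lee_wpmul2l // lee_fin ltW.
have E x : (x <= M%:E -> (k * M)%:E - k%:E * x = k%:E * (M%:E - x))%E.
  case: x => [x||] // _; first by rewrite -EFinM -!EFinB -EFinM mulrBr.
  by rewrite gt0_muleNy ?lte_fin // (_ : (M%:E - -oo)%E = +oo%E) // gt0_muley ?lte_fin.
under eq_integral => t _ do rewrite E //.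
have k0' : (0 <= k%:E)%E by rewrite lee_fin ltW.
rewrite E // ge0_integralZl //=.
- by rewrite muleCA lee_wpmul2l //; exact: (psh_circle oO pu dab M0 uM).
- apply: measurable_funTS.
  by apply: emeasurable_funB; [exact: measurable_cst|exact: measurable_psh_circ oO uu dab].
- by move=> t _; rewrite sube_ge0 ?orbT.
Qed.

Lemma usc_on_max n (D : set 'Cn[R]_n) (u w : 'Cn[R]_n -> \bar R) :
  usc_on D u -> usc_on D w -> usc_on D (fun z => maxe (u z) (w z)).
Proof.
move=> /usc_onP uu /usc_onP uw; apply/usc_onP => z Dz r; rewrite gt_max => /andP[ur wr].
apply: filterS2 (uu z Dz r ur) (uw z Dz r wr) => y + + Dy => /(_ Dy) uy /(_ Dy) wy.
by rewrite gt_max uy.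
Qed.

Lemma psh_max n (Omega : set 'Cn[R]_n) u w :
  open Omega -> psh Omega u -> psh Omega w -> psh Omega (fun z => maxe (u z) (w z)).
Proof.
move=> oO pu pw; have [uoo uu _] := pu; have [woo uw _] := pw.
have umax : usc_on Omega (fun z => maxe (u z) (w z)) by exact: usc_on_max.
apply: psh_of_circle => //.
  by move=> z Oz; rewrite gt_max uoo ?woo.
move=> a b dab.
have [M [M0 uaM uM]] := psh_disc_bounded oO pu dab.
have [N [N0 waN wN]] := psh_disc_bounded oO pw dab.
have uK t : (u (circ a b t) <= (Num.max M N)%:E)%E.
  by apply: le_trans (uM t) _; rewrite lee_fin le_max lexx.
have wK t : (w (circ a b t) <= (Num.max M N)%:E)%E.
  by apply: le_trans (wN t) _; rewrite lee_fin le_max lexx orbT.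
have K0 : 0 <= Num.max M N by rewrite le_max M0.
exists (Num.max M N); split => //; first by move=> t; rewrite ge_max uK wK.
set K := Num.max M N in uK wK K0 *.
(* The maximum at the centre is the value there of [u] or of [w]; whichever it is, passing to the
   maximum on the circle only decreases the integrand. *)
have le_int v : psh Omega v -> (forall t, (v (circ a b t) <= K%:E)%E) ->
    (forall t, (v (circ a b t) <= maxe (u (circ a b t)) (w (circ a b t)))%E) ->
    (\int[mu]_(t in I2pi) (K%:E - maxe (u (circ a b t)) (w (circ a b t))) <=
     (2 * pi)%:E * (K%:E - v a))%E.
  move=> pv vK vmax; have [_ uv _] := pv.
  apply: le_trans (psh_circle oO pv dab K0 vK).
  apply: ge0_le_integral => //=.
  - by move=> t _; rewrite sube_ge0 ?orbT // ge_max uK wK.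
  - apply: measurable_funTS; apply: emeasurable_funB; first exact: measurable_cst.
    exact: (measurable_psh_circ oO umax dab).
  - apply: measurable_funTS; apply: emeasurable_funB; first exact: measurable_cst.
    exact: (measurable_psh_circ oO uv dab).
  - by move=> t _; rewrite leeB.
by rewrite {2}/maxe; case: ifP => _; apply: le_int => // t; rewrite le_max lexx ?orbT.
Qed.

Lemma psh_cst n (Omega : set 'Cn[R]_n) (c : R) : open Omega -> psh Omega (fun=> c%:E).
Proof.
move=> oO; apply: psh_of_circle => //.
- by move=> z _; exact: ltry.
- by apply/usc_onP => z Oz r cr; apply/nbhs_rnormP; exists 1.
move=> a b dab; exists (Num.max 0 c); split; first by rewrite le_max lexx.
  by move=> _; rewrite lee_fin le_max lexx orbT.
by rewrite (circle_integral_cst ((Num.max 0 c)%:E - c%:E)) muleC.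
Qed.

Lemma psh_translate n (Omega : set 'Cn[R]_n) u (h : 'Cn[R]_n) :
  psh Omega u -> psh [set z | Omega (z + h)] (fun z => u (z + h)).
Proof.
move=> [uoo uu usub]; split.
- by move=> z; exact: uoo.
- apply/usc_onP => z Oz r zr; have /usc_onP/(_ _ Oz r zr)/nbhs_rnormP[e e0 eP] := uu.
  apply/nbhs_rnormP; exists e => // y yz Oy; apply: eP => //.
  by rewrite opprD addrACA subrr addr0.
move=> a b dab; rewrite (_ : (fun t => _) = (fun t => u ((a + h) + (cos t +i* sin t)%C *: b))).
  by apply: usub => c c1; rewrite addrAC; exact: dab.
by apply/funext => t; rewrite addrAC.
Qed.

Lemma psh_subset n (Omega Omega' : set 'Cn[R]_n) u : Omega' `<=` Omega ->
  psh Omega u -> psh Omega' u.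
Proof.
move=> OO [uoo uu usub]; split.
- by move=> z /OO; exact: uoo.
- apply/usc_onP => z /OO Oz r zr; have /usc_onP/(_ _ Oz r zr) := uu.
  by apply: filterS => y + /OO.
by move=> a b dab; apply: usub => c /dab /OO.
Qed.

Lemma limn_einf_ge (s : nat -> \bar R) (l : \bar R) :
  (forall a : R, (a%:E < l)%E -> \forall j \near \oo, (a%:E <= s j)%E) ->
  (l <= limn_einf s)%E.
Proof.
move=> H; apply: lee_real_approx => a al.
rewrite /limn_einf leeNr; apply: (@le_trans _ _ (ereal_sup ((\- s)%E @` [set j | (a%:E <= s j)%E]))).
  by apply: ereal_inf_lbound; exists [set j | (a%:E <= s j)%E] => //; exact: H.
by apply: ge_ereal_sup => _ [j aj <-]; rewrite leeN2.
Qed.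

Lemma limn_einf_le (s : nat -> \bar R) (l : \bar R) :
  (forall j, (s j <= l)%E) -> (limn_einf s <= l)%E.
Proof.
move=> H; rewrite /limn_einf leeNl; apply: le_ereal_inf_tmp => _ [V [N _ NV] <-].
apply: (@le_trans _ _ (- s N)%E); first by rewrite leeN2.
by apply: ereal_sup_ubound; exists N => //; apply: NV => /=.
Qed.

(** Parameters violating the conclusion could be chosen along the countable base [B], and Fatou's
    lemma excludes such a sequence. The parameter space is kept abstract because both radii and
    centres are used. *)
Lemma circle_integral_lsc (X : topologicalType) (F : X -> L -> \bar R) (x : X)
    (B : nat -> set X) (A : R) :
  (forall V, nbhs x V -> exists k, forall j, (k <= j)%N -> B j `<=` V) ->
  (forall j, nbhs x (B j)) ->
  (\forall x' \near x, measurable_fun setT (F x') /\ forall t, (0 <= F x' t)%E) ->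
  (forall t (a : R), (a%:E < F x t)%E -> \forall x' \near x, (a%:E < F x' t)%E) ->
  (A%:E < \int[mu]_(t in I2pi) F x t)%E ->
  \forall x' \near x, (A%:E < \int[mu]_(t in I2pi) F x' t)%E.
Proof.
move=> Bsmall Bx good Flsc Ax; apply: contrapT => nA.
have /choice[xs xsP] : forall j, exists x', [/\ B j x',
    measurable_fun setT (F x') /\ (forall t, (0 <= F x' t)%E) &
    (\int[mu]_(t in I2pi) F x' t <= A%:E)%E].
  move=> j; apply: contrapT => H; apply: nA.
  apply: filterS2 (Bx j) good => x' Bx' gx'; rewrite ltNge; apply/negP => Ax'.
  by apply: H; exists x'.
have mFs j : measurable_fun I2pi (F (xs j)).
  by have [_ [mF _] _] := xsP j; exact: measurable_funTS.
have Fs0 j t : I2pi t -> (0 <= F (xs j) t)%E by have [_ [_ F0] _] := xsP j.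
have := fatou mu (measurable_itv _) mFs Fs0.
apply/negP; rewrite -ltNge; apply: (@le_lt_trans _ _ A%:E).
  by apply: limn_einf_le => j; have [] := xsP j.
apply: lt_le_trans Ax _; have [mFx Fx0] := nbhs_singleton good.
apply: ge0_le_integral => //.
- exact: measurable_funTS.
- apply: measurableT_comp => //; apply: measurable_fun_limn_esup => j.
  exact: measurableT_comp.
move=> t _; apply: limn_einf_ge => a ax.
have [k kP] := Bsmall _ (Flsc t a ax); exists k => // j /= kj.
by have [Bj _ _] := xsP j; apply/ltW/(kP j kj).
Qed.

End Psh.

(** * Polar form, and exchange of integrals involving circles *)

Section PolarCircles.
Variable R : realType.
Local Notation C := (R[i]%C : numClosedFieldType).
Local Notation mu := (@lebesgue_measure R).
Local Notation L := (measurableTypeR R).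
Local Notation borel := (borelCn R).
Local Notation I2pi := (`[0%R, (2 * pi)%R]%classic : set L).

Definition expi (t : R) : C := (cos t +i* sin t)%C.

Lemma expiD s t : expi (s + t) = expi s * expi t.
Proof.
by apply/eqP; rewrite eq_complex /= cosD sinD eqxx /= addrC (mulrC (sin s)) eqxx.
Qed.

Lemma expi_periodic t : expi (t + 2 * pi) = expi t.
Proof. by rewrite /expi mulr_natl cosD2pi sinD2pi. Qed.

Lemma rnormM (c d : C) : rnorm (c * d) = rnorm c * rnorm d.
Proof. exact: rnormZ. Qed.

Lemma expi_norm t : rnorm (expi t) = 1.
Proof. exact: rnorm_expi. Qed.

Lemma polar (c : C) : exists2 al : R, 0 <= al <= 2 * pi & c = (rnorm c)%:C%C * expi al.
Proof.
have [c0|c0] := eqVneq (rnorm c) 0.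
  exists 0; first by rewrite lexx ltW // two_pi_gt0.
  by rewrite (rnorm0_eq0 c0) rnorm0 mul0r.
have c1 : 0 < rnorm c by rewrite lt_neqAle eq_sym c0 rnorm_ge0.
case: c c0 c1 => x y; set r := rnorm _ => r0 r1.
have r2 : r ^+ 2 = x ^+ 2 + y ^+ 2.
  by rewrite /r rnorm_complex /= sqr_sqrtr // addr_ge0 // sqr_ge0.
have xr : -1 <= x / r <= 1.
  rewrite -ler_norml normrM normfV (gtr0_norm r1) ler_pdivrMr // mul1r.
  by have := normc_Re_le (x +i* y)%C.
have [[/andP[a0 api] ca]] := (acos_def xr, tt); move=> _.
have sa : sin (acos (x / r)) = `|y| / r.
  rewrite sin_acos // (_ : 1 - (x / r) ^+ 2 = (y / r) ^+ 2).
    by rewrite sqrtr_sqr normrM normfV (gtr0_norm r1).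
  rewrite !expr_div_n; apply: (mulIf (expf_neq0 2 r0)).
  by rewrite mulrBl !divfK ?expf_neq0 // mul1r r2; ring.
have pi0 := pi_gt0 R.
have [y0|y0] := leP 0 y.
  exists (acos (x / r)); first by rewrite a0 /=; lra.
  apply/eqP; rewrite eq_complex /= ca sa (ger0_norm y0) !mul0r subr0 addr0.
  by rewrite !(mulrC r) !divfK // !eqxx.
exists (2 * pi - acos (x / r)); first by apply/andP; split; lra.
have -> : expi (2 * pi - acos (x / r)) = (x / r +i* (y / r))%C.
  rewrite addrC expi_periodic /expi cosN sinN ca sa (ltr0_norm y0).
  by rewrite mulNr opprK.
by apply/eqP; rewrite eq_complex /= !mul0r subr0 addr0 !(mulrC r) !divfK // !eqxx.
Qed.

Lemma measurable_circle_integral d (X : measurableType d) (f : L * X -> \bar R) :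
  measurable_fun setT f -> (forall p, (0 <= f p)%E) ->
  measurable_fun setT (fun x => \int[mu]_(t in I2pi) f (t, x))%E.
Proof.
move=> mf f0.
have mD : measurable (I2pi `*` [set: X]) by apply: measurableX.
have mh : measurable_fun setT (f \_ (I2pi `*` [set: X])).
  by apply/(measurable_restrictT f mD); exact: measurable_funTS.
have h0 p : (0 <= (f \_ (I2pi `*` [set: X])) p)%E by rewrite patchE; case: ifP.
have := measurable_fun_fubini_tonelli_G (m1 := mu) _ mh h0.
apply: eq_measurable_fun => x _; rewrite /fubini_G [RHS]integral_mkcond.
apply: eq_integral => t _; rewrite !patchE.
by have -> : ((t, x) \in I2pi `*` [set: X]) = (t \in I2pi) by apply/idP/idP; rewrite !inE //= => -[].
Qed.

Lemma circle_Cn_tonelli n (f : L * borel n -> \bar R) :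
  measurable_fun setT f -> (forall p, (0 <= f p)%E) ->
  (\int[mu]_(t in I2pi) Cn_integral (fun z => f (t, z)) =
   Cn_integral (fun z => \int[mu]_(t in I2pi) f (t, z)))%E.
Proof.
move=> mf f0; pose D := I2pi `*` [set: borel n].
have mD : measurable D by apply: measurableX.
have mh : measurable_fun setT (f \_ D).
  by apply/(measurable_restrictT f mD); exact: measurable_funTS.
have h0 p : (0 <= (f \_ D) p)%E by rewrite patchE; case: ifP.
have inD t z : ((t, z) \in D) = (t \in I2pi) by apply/idP/idP; rewrite !inE //= => -[].
transitivity (\int[mu]_t Cn_integral (fun z => (f \_ D) (t, z)))%E.
  rewrite integral_mkcond; apply: eq_integral => t _; rewrite patchE.
  case: ifPn => tI; first by congr Cn_integral; apply/funext => z; rewrite patchE inD tI.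
  rewrite -[LHS](Cn_integral0 R n); congr Cn_integral; apply/funext => z.
  by rewrite patchE inD (negbTE tI).
rewrite (Cn_integral_tonelli mu mh h0); congr Cn_integral; apply/funext => z.
by rewrite [RHS]integral_mkcond; apply: eq_integral => t _; rewrite !patchE inD.
Qed.

Lemma circle_fubini (f : L * L -> \bar R) :
  measurable_fun setT f -> (forall p, (0 <= f p)%E) ->
  (\int[mu]_(t in I2pi) \int[mu]_(s in I2pi) f (t, s) =
   \int[mu]_(s in I2pi) \int[mu]_(t in I2pi) f (t, s))%E.
Proof.
move=> mf f0; pose D := I2pi `*` I2pi.
have mD : measurable D by apply: measurableX.
have mh : measurable_fun setT (f \_ D).
  by apply/(measurable_restrictT f mD); exact: measurable_funTS.
have h0 p : (0 <= (f \_ D) p)%E by rewrite patchE; case: ifP.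
have inD t s : ((t, s) \in D) = (t \in I2pi) && (s \in I2pi).
  by apply/idP/andP; rewrite !inE.
transitivity (\int[mu]_t \int[mu]_s (f \_ D) (t, s))%E.
  rewrite integral_mkcond; apply: eq_integral => t _; rewrite patchE.
  case: ifPn => tI.
    by rewrite integral_mkcond; apply: eq_integral => s _; rewrite !patchE inD tI.
  rewrite -[LHS](integral0 mu setT); apply: eq_integral => s _.
  by rewrite patchE inD (negbTE tI).
rewrite (fubini_tonelli (m1 := mu) (m2 := mu) _ mh h0).
rewrite [RHS]integral_mkcond; apply: eq_integral => s _; rewrite patchE.
case: ifPn => sI.
  by rewrite [RHS]integral_mkcond; apply: eq_integral => t _; rewrite !patchE inD sI andbT.
rewrite -[RHS](integral0 mu setT); apply: eq_integral => t _.
by rewrite patchE inD (negbTE sI) andbF.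
Qed.

End PolarCircles.

(** * Radial superharmonic functions on the unit disc *)

Section RadialMinimum.
Variable R : realType.
Local Notation C := (R[i]%C : numClosedFieldType).
Local Notation mu := (@lebesgue_measure R).
Local Notation L := (measurableTypeR R).
Local Notation I2pi := (`[0%R, (2 * pi)%R]%classic : set L).
Local Notation cnorm c := (rnorm (c%R : C)).

(* [m] is only controlled on [0, 1]; composing with [clamp] makes semicontinuity a statement at
   every real point, including the end points. *)
Definition clamp (r : R) : R := Num.min `|r| 1.

Lemma clamp_ge0 r : 0 <= clamp r.
Proof. by rewrite /clamp le_min normr_ge0 ler01. Qed.

Lemma clamp_le1 r : clamp r <= 1.
Proof. by rewrite /clamp ge_min lexx orbT. Qed.

Lemma clamp_id r : 0 <= r <= 1 -> clamp r = r.
Proof. by move=> /andP[r0 r1]; rewrite /clamp ger0_norm // min_l. Qed.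

Lemma clamp_lipschitz r s : `|clamp r - clamp s| <= `|r - s|.
Proof.
apply: le_trans (ler_dist_dist r s); rewrite /clamp.
set p := `|r|; set q := `|s|.
have h1 := ler_norm (p - q); have h2 := ler_norm (q - p); rewrite distrC in h2.
have h0 := normr_ge0 (p - q).
by case: (leP p 1) => hp; case: (leP q 1) => hq; rewrite ler_norml; apply/andP; split; lra.
Qed.

Lemma measurable_circle_sqr (x eps r sg : R) : measurable_fun setT
  (fun s : L => (x + eps * (cnorm (r%:C%C + sg%:C%C * expi s)) ^+ 2)%:E).
Proof.
apply/measurable_EFinP; rewrite (_ : (fun s => _) =
    fun s => x + eps * ((r + sg * cos s) ^+ 2 + (sg * sin s) ^+ 2)); last first.
  apply/funext => s; rewrite rnorm_complex sqr_sqrtr ?addr_ge0 ?sqr_ge0 //=.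
  by rewrite !mul0r subr0 add0r addr0.
apply: measurable_funD; first exact: measurable_cst.
apply: measurable_funM; first exact: measurable_cst.
apply: measurable_funD; apply: measurable_funX.
  apply: measurable_funD; first exact: measurable_cst.
  by apply: measurable_funM; [exact: measurable_cst|exact: measurable_cos].
by apply: measurable_funM; [exact: measurable_cst|exact: measurable_sin].
Qed.

(** Adding the integrands at $s$ and $s+\pi$ cancels the cross term $2r\sigma\cos s$, so twice the
    integral is the integral of a constant. *)
Lemma circle_sqr_integral (x eps r sg : R) : 0 <= x -> 0 <= eps ->
  (\int[mu]_(s in I2pi) (x + eps * (cnorm (r%:C%C + sg%:C%C * expi s)) ^+ 2)%:E =
   ((x + eps * (r ^+ 2 + sg ^+ 2)) * (2 * pi))%:E)%E.
Proof.
move=> x0 eps0; pose h (s : L) := (x + eps * (cnorm (r%:C%C + sg%:C%C * expi s)) ^+ 2).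
have hE s : h s = x + eps * ((r + sg * cos s) ^+ 2 + (sg * sin s) ^+ 2).
  rewrite /h rnorm_complex sqr_sqrtr ?addr_ge0 ?sqr_ge0 //=.
  by rewrite !mul0r subr0 add0r addr0.
have h0 s : (0 <= (h s)%:E)%E by rewrite lee_fin addr_ge0 // mulr_ge0 // sqr_ge0.
have mh : measurable_fun setT (EFin \o h) by exact: measurable_circle_sqr.
have pi0 := pi_gt0 R.
have mhpi : measurable_fun setT (fun s : L => (h (s + pi))%:E).
  have ms : measurable_fun setT (fun s : L => (s + pi)%R : L) by exact: measurable_funD.
  exact: (measurableT_comp mh ms).
have shift : (\int[mu]_(s in I2pi) (h (s + pi))%:E = \int[mu]_(s in I2pi) (h s)%:E)%E.
  apply: (circle_integral_shift (f := EFin \o h) mh h0).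
    by move=> s; rewrite /= /h expi_periodic.
  by apply/andP; split; lra.
have I0 : (0 <= \int[mu]_(s in I2pi) (h s)%:E)%E by exact: integral_ge0.
have sum2 : (\int[mu]_(s in I2pi) (h s)%:E + \int[mu]_(s in I2pi) (h s)%:E =
    ((x + eps * (r ^+ 2 + sg ^+ 2)) * (2 * pi) * 2)%:E)%E.
  rewrite -[X in (X + _)%E]shift -ge0_integralD //; first last.
  - exact: measurable_funTS.
  - exact: measurable_funTS.
  transitivity (\int[mu]_(s in I2pi) (fun=> ((x + eps * (r ^+ 2 + sg ^+ 2)) * 2)%:E) s)%E.
    apply: eq_integral => s _; rewrite -EFinD; congr EFin; rewrite !hE cosDpi sinDpi.
    have pq : cos s ^+ 2 = 1 - sin s ^+ 2 :> R by rewrite cos2sin2.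
    by ring: pq.
  by rewrite circle_integral_cst -EFinM; congr EFin; ring.
move: sum2 I0; rewrite -/h; case: (\int[mu]_(s in I2pi) (h s)%:E)%E => [y||] //=.
by move=> [yE] _; congr EFin; lra.
Qed.

(* Otherwise [eps * r ^+ 2 - m r] with a suitable [eps > 0] is maximal on [0, 1] at some
   [r0 < 1]; averaging it over a small circle around [r0] contradicts [small_circle], since
   the mean of [|.|^2] over that circle exceeds [r0 ^+ 2] by [sg ^+ 2]. *)
Lemma radial_minimum (m : R -> \bar R) (s1 : R) : 0 < s1 ->
  (forall r, 0 <= r <= 1 -> (0 <= m r)%E) ->
  (forall r (A : R), (A%:E < m (clamp r))%E ->
     \forall r' \near r, (A%:E < m (clamp r'))%E) ->
  (forall r sg, 0 <= r -> 0 <= sg -> r + sg <= 1 ->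
     measurable_fun setT (fun s : L => m (cnorm (r%:C%C + sg%:C%C * expi s)))) ->
  (forall r sg, 0 <= r -> 0 <= sg -> r + sg <= 1 -> sg < s1 ->
     (\int[mu]_(s in I2pi) m (cnorm (r%:C%C + sg%:C%C * expi s)) <=
      (2 * pi)%:E * m r)%E) ->
  (m 1%R <= m 0%R)%E.
Proof.
move=> s10 m_ge0 m_lsc measurable_m_circle small_circle.
rewrite leNgt; apply/negP => m01.
have [p m0p pm1] := lte_real_between m01; have [q pq qm1] := lte_real_between pm1.
(* With $m(0)<p<q<m(1)$ this choice yields $g(1)<-p<g(0)$, so [g] has no maximum at 1 and there is
   room for a circle around the maximal point. *)
rewrite lte_fin in pq; pose eps := q - p; have eps0 : 0 < eps by rewrite subr_gt0.
pose g r := ((eps * r ^+ 2)%:E - m (clamp r))%E.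
have c0 : clamp 0 = 0 by rewrite clamp_id // lexx ler01.
have cl1 : clamp 1 = 1 by rewrite clamp_id // lexx ler01.
have m0fin : m 0 \is a fin_num.
  rewrite ge0_fin_numE; first exact: lt_trans m0p (ltry _).
  by apply: m_ge0; rewrite lexx ler01.
have [r0 r0K r0max] : exists2 r0, `[0%R, 1%R]%classic r0 &
    forall r, `[0%R, 1%R]%classic r -> (g r <= g r0)%E.
  apply: compact_max; first exact: segment_compact.
    by exists 0; rewrite /= in_itv /= lexx ler01.
  move=> r A _ gA.
  have ltE (y : \bar R) (z : R) : (0 <= y)%E -> (z%:E - y < A%:E)%E = ((z - A)%:E < y)%E.
    by case: y => [y||] //= _; rewrite ?ltNyr ?ltry // !lte_fin ltrBlDr ltrBlDl addrC.
  have mc0 r' : (0 <= m (clamp r'))%E by apply: m_ge0; rewrite clamp_ge0 clamp_le1.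
  move: gA; rewrite /g ltE // => /lte_real_between[B rB Bm].
  rewrite lte_fin in rB.
  have sq : \forall r' \near r, eps * r' ^+ 2 - A < B.
    have cts : (fun r' : R => eps * r' ^+ 2 - A) @ r --> eps * r ^+ 2 - A.
      apply: cvgB; last exact: cvg_cst.
      by apply: cvgM; [exact: cvg_cst|exact: exprn_continuous].
    exact: (cts _ (lt_nbhsl rB)).
  apply: filterS2 sq (m_lsc _ _ Bm) => r' r'B Bm' _; rewrite ltE //.
  by apply: lt_trans Bm'; rewrite lte_fin.
move: r0K; rewrite /= in_itv /= => r01; have /andP[r0ge0 r0le1] := r01.
have g0 : g 0 = (- m 0%R)%E by rewrite /g c0 expr0n mulr0 add0e.
have g01 : (g 1%R < g 0%R)%E.
  rewrite g0 /g cl1 expr1n mulr1 lteNr; apply: lt_le_trans m0p _.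
  move: qm1; case: (m 1) => [y||] //=; last by rewrite leey.
  by rewrite lte_fin lee_fin /eps => qy; lra.
have g0r0 : (g 0%R <= g r0)%E by apply: r0max; rewrite /= in_itv /= lexx ler01.
have r0lt1 : r0 < 1.
  rewrite lt_neqAle r0le1 andbT; apply/eqP => r0E.
  by move: (lt_le_trans g01 g0r0); rewrite r0E ltxx.
have mr0 := m_ge0 _ r01.
have mr0fin : m r0 \is a fin_num.
  move: g0r0 mr0; rewrite g0 /g clamp_id //; case: (m r0) => [y||] //=.
  by rewrite leeNy_eq; move: m0fin; case: (m 0).
set x := fine (m r0); have xE : m r0 = x%:E by rewrite fineK.
have x0 : 0 <= x by rewrite -lee_fin -xE.
pose sg := Num.min (1 - r0) (s1 / 2).
have sg0 : 0 < sg by rewrite lt_min subr_gt0 r0lt1 divr_gt0.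
have rsg : r0 + sg <= 1 by rewrite -lerBrDl ge_min lexx.
have sgs1 : sg < s1.
  by apply: (@le_lt_trans _ _ (s1 / 2)); [rewrite ge_min lexx orbT|lra].
have sc := small_circle _ _ r0ge0 (ltW sg0) rsg sgs1.
pose rho (s : L) := cnorm (r0%:C%C + sg%:C%C * expi s).
have rho01 s : 0 <= rho s <= 1.
  rewrite rnorm_ge0 /=; apply: le_trans rsg; apply: le_trans (rnormD _ _) _.
  by rewrite rnorm_real rnormM rnorm_real expi_norm mulr1 !ger0_norm // ltW.
(* Maximality of [g] at [r0], arranged without subtraction because [m (rho s)] may be $+\infty$. *)
have rho_le s : ((x + eps * rho s ^+ 2)%:E <= m (rho s) + (eps * r0 ^+ 2)%:E)%E.
  have := r0max (rho s); rewrite /= in_itv /= => /(_ (rho01 s)).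
  rewrite /g !clamp_id // xE; case: (m (rho s)) (m_ge0 _ (rho01 s)) => [y||] //= _.
    by rewrite !lee_fin => ?; lra.
  by rewrite leey.
have eps0' := ltW eps0.
have er0 : 0 <= eps * r0 ^+ 2 by rewrite mulr_ge0 // sqr_ge0.
have mrho : measurable_fun setT (fun s : L => m (rho s)).
  exact: (measurable_m_circle _ _ r0ge0 (ltW sg0) rsg).
have mrho0 s : (0 <= m (rho s))%E by exact: m_ge0.
have sumE : (\int[mu]_(s in I2pi) (m (rho s) + (eps * r0 ^+ 2)%:E) =
    \int[mu]_(s in I2pi) m (rho s) + (eps * r0 ^+ 2 * (2 * pi))%:E)%E.
  rewrite ge0_integralD //=; last exact: measurable_funTS.
  by rewrite (circle_integral_cst (eps * r0 ^+ 2)%:E) -EFinM.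
have : (((x + eps * (r0 ^+ 2 + sg ^+ 2)) * (2 * pi))%:E <=
    \int[mu]_(s in I2pi) (m (rho s) + (eps * r0 ^+ 2)%:E))%E.
  rewrite -circle_sqr_integral //; apply: ge0_le_integral => //.
  - by move=> s _; rewrite lee_fin addr_ge0 // mulr_ge0 // sqr_ge0.
  - exact: (measurable_funTS (measurable_circle_sqr x eps r0 sg)).
  - by apply: measurable_funTS; apply: emeasurable_funD => //; exact: measurable_cst.
  - by move=> s _; exact: rho_le.
apply/negP; rewrite -ltNge sumE; apply: (@le_lt_trans _ _ ((2 * pi)%:E * m r0 + (eps * r0 ^+ 2 * (2 * pi))%:E)%E).
  exact: leeD.
rewrite xE -EFinM -EFinD lte_fin.
have sg2 : 0 < eps * sg ^+ 2 * (2 * pi) by rewrite !mulr_gt0 // ?exprn_gt0 ?pi_gt0.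
by move: sg2; rewrite !mulrDr !mulrDl; lra.
Qed.

End RadialMinimum.

(** * From short circles to all circles *)

Section SmallCircles.
Variable R : realType.
Local Notation C := (R[i]%C : numClosedFieldType).
Local Notation mu := (@lebesgue_measure R).
Local Notation L := (measurableTypeR R).
Local Notation borel := (borelCn R).
Local Notation I2pi := (`[0%R, (2 * pi)%R]%classic : set L).

Local Notation cnorm c := (rnorm (c%R : C)).

Variables (n : nat) (Omega : set 'Cn[R]_n) (u : 'Cn[R]_n -> \bar R) (a b : 'Cn[R]_n).
Hypotheses (oO : open Omega) (uoo : forall z, Omega z -> (u z < +oo)%E)
  (uu : usc_on Omega u) (dab : disc_in Omega a b).
Variable M : R.
Hypotheses (M0 : 0 <= M) (uM : forall c : C, `|c| <= 1 -> (u (a + c *: b)%R <= M%:E)%E).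

Let G (c : C) : \bar R := (M%:E - u (a + c *: b)%R)%E.

Let G_ge0 c : rnorm c <= 1 -> (0 <= G c)%E.
Proof.
by move=> c1; rewrite /G sube_ge0 ?orbT // uM // normE lecR.
Qed.

Let measurable_G d (X : measurableType d) (al be : X -> R) :
  measurable_fun setT al -> measurable_fun setT be ->
  (forall x, cnorm ((al x +i* be x)%C : C) <= 1) ->
  measurable_fun setT (fun x => G (al x +i* be x)%C).
Proof.
move=> mal mbe ab1; apply: emeasurable_funB; first exact: measurable_cst.
apply: (measurable_usc_comp oO uu (g := fun x => (a + (al x +i* be x)%C *: b : borel n))).
  by apply: measurable_affine => //; exact: measurable_cst.
by move=> x; apply: dab; rewrite normE lecR.
Qed.

(** The integral of $M-u$ over the circle of radius $r$ in the disc. As $m(0)=2\pi(M-u(a))$, the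
    mean value inequality on the disc reads $m(1)\le m(0)$. *)
Let m (r : R) : \bar R := (\int[mu]_(t in I2pi) G (r%:C%C * expi t)%R)%E.

Let rnorm_r_expi r t : cnorm (r%:C%C * expi t) = `|r|.
Proof. by rewrite rnormM expi_norm mulr1 rnorm_real. Qed.

(** In polar form the argument of [c] is only a shift of the variable [t] within the period. *)
Let m_rotation (c : C) : rnorm c <= 1 ->
  (\int[mu]_(t in I2pi) G (expi t * c)%R = m (rnorm c))%E.
Proof.
move=> c1; have [al al2 cE] := polar c; rewrite /m.
pose f (t : L) := G ((rnorm c)%:C%C * expi t).
have f0 t : (0 <= f t)%E.
  by apply: G_ge0; rewrite rnorm_r_expi ger0_norm // rnorm_ge0.
have mf : measurable_fun setT f.
  rewrite /f (_ : (fun t => _) =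
      (fun t => G (rnorm c * cos t +i* (rnorm c * sin t))%C)); last first.
    by apply/funext => t; congr G; apply/eqP; rewrite eq_complex /= !mul0r subr0 addr0 !eqxx.
  apply: measurable_G.
  - by apply: measurable_funM; [exact: measurable_cst|exact: measurable_cos].
  - by apply: measurable_funM; [exact: measurable_cst|exact: measurable_sin].
  - move=> t; rewrite (_ : (_ +i* _)%C = (rnorm c)%:C%C * expi t :> C).
      by rewrite rnorm_r_expi ger0_norm // rnorm_ge0.
    by apply/eqP; rewrite eq_complex /= !mul0r subr0 addr0 !eqxx.
rewrite -(circle_integral_shift mf f0 _ al2); last first.
  by move=> t; rewrite /f expi_periodic.
apply: eq_integral => t _; rewrite /f expiD [in LHS]cE; congr G.
by rewrite mulrCA.
Qed.

Variable s0 : R.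
Hypotheses (s00 : 0 < s0) (usmall : forall a' b', rnorm b' < s0 -> disc_in Omega a' b' ->
  (u a' * (2 * pi)%:E <= \int[mu]_(t in I2pi) u (circ a' b' t))%E).

(** Integrating over the first angle gives $m(|r+\sigma e^{is}|)$ by rotation; integrating over the
    second gives an integral over the circle of radius $\sigma$ about $re^{it}$, to which the
    hypothesis on short circles applies. Exchanging the two integrals yields [small_circle]. *)
Let F r sg (p : L * L) := G (expi p.1 * (r%:C%C + sg%:C%C * expi p.2)).

Let c1 r sg t s : 0 <= r -> 0 <= sg -> r + sg <= 1 ->
  cnorm (expi t * (r%:C%C + sg%:C%C * expi s)) <= 1.
Proof.
move=> r0 sg0 rsg; rewrite rnormM expi_norm mul1r; apply: le_trans (rnormD _ _) _.
by rewrite rnorm_real rnorm_r_expi !ger0_norm.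
Qed.

Let measurable_F r sg : 0 <= r -> 0 <= sg -> r + sg <= 1 -> measurable_fun setT (F r sg).
Proof.
move=> r0 sg0 rsg.
pose al (p : L * L) := cos p.1 * (r + sg * cos p.2) - sin p.1 * (sg * sin p.2).
pose be (p : L * L) := cos p.1 * (sg * sin p.2) + sin p.1 * (r + sg * cos p.2).
have E p : expi p.1 * (r%:C%C + sg%:C%C * expi p.2) = (al p +i* be p)%C.
  by apply/eqP; rewrite eq_complex /= !mul0r !subr0 !add0r !addr0 !eqxx.
rewrite /F (_ : (fun p => _) = (fun p => G (al p +i* be p)%C)); last first.
  by apply/funext => p; rewrite E.
have mc1 : measurable_fun setT (fun p : L * L => cos p.1 : R).
  exact: (measurableT_comp (@measurable_cos R) measurable_fst).
have ms1 : measurable_fun setT (fun p : L * L => sin p.1 : R).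
  exact: (measurableT_comp (@measurable_sin R) measurable_fst).
have mc2 : measurable_fun setT (fun p : L * L => sg * cos p.2 : R).
  apply: measurable_funM; first exact: measurable_cst.
  exact: (measurableT_comp (@measurable_cos R) measurable_snd).
have ms2 : measurable_fun setT (fun p : L * L => sg * sin p.2 : R).
  apply: measurable_funM; first exact: measurable_cst.
  exact: (measurableT_comp (@measurable_sin R) measurable_snd).
have mrc : measurable_fun setT (fun p : L * L => r + sg * cos p.2 : R).
  by apply: measurable_funD => //; exact: measurable_cst.
apply: measurable_G.
- by apply: measurable_funB; apply: measurable_funM.
- by apply: measurable_funD; apply: measurable_funM.
- by move=> p; rewrite -E c1.
Qed.

Let measurable_m_circle r sg : 0 <= r -> 0 <= sg -> r + sg <= 1 ->
  measurable_fun setT (fun s : L => m (cnorm (r%:C%C + sg%:C%C * expi s))).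
Proof.
move=> r0 sg0 rsg; have mF := measurable_F r0 sg0 rsg.
have := measurable_circle_integral mF (fun=> G_ge0 (c1 _ _ r0 sg0 rsg)).
have cs s : cnorm (r%:C%C + sg%:C%C * expi s) <= 1.
  by have := c1 0 s r0 sg0 rsg; rewrite rnormM expi_norm mul1r.
by apply: eq_measurable_fun => s _; rewrite -(m_rotation (cs s)).
Qed.

Let small_circle (r sg : R) : 0 <= r -> 0 <= sg -> r + sg <= 1 -> sg * rnorm b < s0 ->
  (\int[mu]_(s in I2pi) m (cnorm (r%:C%C + sg%:C%C * expi s)) <= (2 * pi)%:E * m r)%E.
Proof.
move=> r0 sg0 rsg sgb.
have r1 : r <= 1 by apply: le_trans rsg; rewrite lerDl.
have c1' t s := c1 t s r0 sg0 rsg.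
have F0 p : (0 <= F r sg p)%E by exact/G_ge0/c1'.
have mF := measurable_F r0 sg0 rsg.
have inner t : I2pi t ->
    (\int[mu]_(s in I2pi) F r sg (t, s) <= (2 * pi)%:E * G (r%:C%C * expi t)%R)%E.
  rewrite /= in_itv /= => tI.
  pose f (s : L) := G (r%:C%C * expi t + sg%:C%C * expi s).
  have fc s : cnorm (r%:C%C * expi t + sg%:C%C * expi s) <= 1.
    by apply: le_trans (rnormD _ _) _; rewrite !rnorm_r_expi !ger0_norm.
  have f0 s : (0 <= f s)%E by exact/G_ge0/fc.
  have mf : measurable_fun setT f.
    rewrite /f (_ : (fun s => _) = (fun s => G
       ((r * cos t + sg * cos s)%R +i* (r * sin t + sg * sin s)%R)%C)); last first.
      apply/funext => s; congr G.
      by apply/eqP; rewrite eq_complex /= !mul0r !subr0 !addr0 !eqxx.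
    apply: measurable_G.
    - apply: measurable_funD; first exact: measurable_cst.
      by apply: measurable_funM; [exact: measurable_cst|exact: measurable_cos].
    - apply: measurable_funD; first exact: measurable_cst.
      by apply: measurable_funM; [exact: measurable_cst|exact: measurable_sin].
    - move=> s; rewrite (_ : (_ +i* _)%C = r%:C%C * expi t + sg%:C%C * expi s :> C) //.
      by apply/eqP; rewrite eq_complex /= !mul0r !subr0 !addr0 !eqxx.
  (* [F r sg (t, s)] equals [f (s + t)], so the two integrals differ by a shift of the period. *)
  have -> : (\int[mu]_(s in I2pi) F r sg (t, s) = \int[mu]_(s in I2pi) f s)%E.
    have fper s : f (s + 2 * pi) = f s by rewrite /f expi_periodic.
    rewrite -[RHS](circle_integral_shift mf f0 fper tI).
    apply: eq_integral => s _; rewrite /F /f /= expiD; congr G.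
    by rewrite mulrDr (mulrC (expi t)) (mulrCA (expi t)) (mulrC (expi t)).
  pose a' := a + (r%:C%C * expi t) *: b; pose b' := (sg%:C%C : C) *: b.
  have fE s : u (circ a' b' s) = u (a + (r%:C%C * expi t + sg%:C%C * expi s) *: b).
    by congr u; rewrite /circ /a' /b' scalerA scalerDl addrA -[(cos s +i* sin s)%C]/(expi s) (mulrC (expi s)).
  have dab' : disc_in Omega a' b'.
    move=> c cle1; rewrite /a' /b' scalerA -addrA -scalerDl; apply: dab.
    rewrite normE lecR; apply: le_trans (rnormD _ _) _.
    rewrite rnorm_r_expi rnormM rnorm_real !ger0_norm //; apply: le_trans rsg.
    rewrite lerD2l ler_piMl //; by move: cle1; rewrite normE lecR.
  have b's : rnorm b' < s0 by rewrite /b' rnormZ rnorm_real ger0_norm.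
  have uM' s : (u (circ a' b' s) <= M%:E)%E.
    by rewrite fE; apply: uM; rewrite normE lecR.
  have := usmall b's dab'.
  have mu' := measurable_psh_circ oO uu dab'.
  move/(submean_ge0 mu' uM' M0 (uoo (disc_in_center dab'))).
  by under eq_integral => s _ do rewrite fE.
have -> : (\int[mu]_(s in I2pi) m (cnorm (r%:C%C + sg%:C%C * expi s)) =
    \int[mu]_(s in I2pi) \int[mu]_(t in I2pi) F r sg (t, s))%E.
  apply: eq_integral => s _; rewrite -m_rotation //.
  by have := c1' 0 s; rewrite rnormM expi_norm mul1r.
rewrite -circle_fubini //.
have mGr : measurable_fun setT (fun t : L => G (r%:C%C * expi t)).
  rewrite (_ : (fun t => _) = (fun t => G (r * cos t +i* (r * sin t))%C)); last first.
    by apply/funext => t; congr G; apply/eqP; rewrite eq_complex /= !mul0r subr0 addr0 !eqxx.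
  apply: measurable_G.
  - by apply: measurable_funM; [exact: measurable_cst|exact: measurable_cos].
  - by apply: measurable_funM; [exact: measurable_cst|exact: measurable_sin].
  - move=> t; rewrite (_ : (_ +i* _)%C = r%:C%C * expi t :> C).
      by rewrite rnorm_r_expi ger0_norm.
    by apply/eqP; rewrite eq_complex /= !mul0r subr0 addr0 !eqxx.
have G0 t : (0 <= G (r%:C%C * expi t)%R)%E.
  by apply: G_ge0; rewrite rnorm_r_expi ger0_norm.
have pi0 := @two_pi_gt0 R.
have pi0' : (0 <= (2 * pi : R)%:E)%E by rewrite lee_fin ltW.
have Z : (\int[mu]_(t in I2pi) ((2 * pi)%:E * G (r%:C%C * expi t)%R) = (2 * pi)%:E * m r)%E.
  exact: (ge0_integralZl mu (measurable_itv _) (measurable_funTS mGr) (fun t _ => G0 t) pi0').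
rewrite -Z.
apply: ge0_le_integral => //=.
- by move=> t _; apply: integral_ge0.
- apply: measurable_funTS.
  have msw : measurable_fun setT (fun p : L * L => (p.2, p.1) : L * L).
    exact: measurable_fun_pair.
  exact: (measurable_circle_integral (measurableT_comp mF msw) (fun=> F0 _)).
- by apply: measurable_funTS; apply: emeasurable_funM => //; exact: measurable_cst.
Qed.

Let m_lsc r (A : R) : (A%:E < m (clamp r))%E ->
  \forall r' \near r, (A%:E < m (clamp r'))%E.
Proof.
apply: (circle_integral_lsc (F := fun r t => G ((clamp r)%:C%C * expi t))
  (B := fun j => [set y | `|y - r| < j.+1%:R^-1])).
- move=> V /nbhs_normP[e /= e0 eV]; have [k ke] := inv_nat_lt e0.
  exists k => j kj y /= yr; apply: eV => /=; rewrite distrC; apply: lt_le_trans yr _.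
  by apply: le_trans (ltW ke); rewrite lef_pV2 ?posrE ?ltr0n // ler_nat.
- move=> j; apply/nbhs_normP; exists j.+1%:R^-1; first by rewrite /= invr_gt0 ltr0n.
  by move=> y /=; rewrite distrC.
- apply/nbhs_normP; exists 1 => //= r' _; split; last first.
    by move=> t; apply: G_ge0; rewrite rnorm_r_expi ger0_norm ?clamp_ge0 // clamp_le1.
  rewrite (_ : (fun t => _) = (fun t => G (clamp r' * cos t +i* (clamp r' * sin t))%C)); last first.
    by apply/funext => t; congr G; apply/eqP; rewrite eq_complex /= !mul0r subr0 addr0 !eqxx.
  apply: measurable_G.
  - by apply: measurable_funM; [exact: measurable_cst|exact: measurable_cos].
  - by apply: measurable_funM; [exact: measurable_cst|exact: measurable_sin].
  - move=> t; rewrite (_ : (_ +i* _)%C = (clamp r')%:C%C * expi t :> C).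
      by rewrite rnorm_r_expi ger0_norm ?clamp_ge0 // clamp_le1.
    by apply/eqP; rewrite eq_complex /= !mul0r subr0 addr0 !eqxx.
move=> t A' A'G; pose c r' : C := (clamp r')%:C%C * expi t.
have Oc r' : Omega (a + c r' *: b).
  by apply: dab; rewrite normE lecR rnorm_r_expi ger0_norm ?clamp_ge0 // clamp_le1.
have GE r' : (A'%:E < G (c r'))%E = (u (a + c r' *: b)%R < (M - A')%:E)%E.
  rewrite /G EFinB; case: (u _) (uoo (Oc r')) => [x||] // _.
    by rewrite !lte_fin ltrBrDl ltrBrDl addrC.
  by rewrite (_ : (M%:E - -oo)%E = +oo%E) // ltry -EFinB ltNyr.
have near_u : \forall d \near c r, Omega (a + d *: b) -> (u (a + d *: b)%R < (M - A')%:E)%E.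
  have /usc_onP/(_ _ (Oc r) (M - A')) := uu; rewrite -GE => /(_ A'G).
  exact: affine_continuous.
have /nbhs_rnormP[e e0 eP] := near_u.
apply/nbhs_normP; exists e; [exact: e0|move=> r' /= rr'].
rewrite -/(c r') GE; apply: eP; last exact: Oc.
rewrite /c -mulrBl rnormM expi_norm mulr1 -rmorphB /= rnorm_real.
by apply: le_lt_trans (clamp_lipschitz _ _) _; rewrite distrC.
Qed.

Let m_ge0 r : 0 <= r <= 1 -> (0 <= m r)%E.
Proof.
move=> /andP[r0 r1]; apply: integral_ge0 => t _; apply: G_ge0.
by rewrite rnorm_r_expi ger0_norm.
Qed.

Lemma disc_submean :
  (\int[mu]_(t in I2pi) (M%:E - u (circ a b t)) <= (2 * pi)%:E * (M%:E - u a))%E.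
Proof.
have -> : (\int[mu]_(t in I2pi) (M%:E - u (circ a b t)) = m 1)%E.
  by apply: eq_integral => t _; rewrite /G mul1r.
have b1 : 0 < rnorm b + 1 by rewrite ltr_wpDl // rnorm_ge0.
have m10 : (m 1%R <= m 0%R)%E.
  (* A circle of radius $\sigma$ in the parameter has radius $\sigma|b|$ in $\mathbb{C}^n$; adding 1
     avoids a division by zero when $b=0$. *)
  apply: (@radial_minimum R m (s0 / (rnorm b + 1))).
  - by rewrite divr_gt0.
  - exact: m_ge0.
  - exact: m_lsc.
  - exact: measurable_m_circle.
  move=> r sg r0 sg0 rsg sgs; apply: small_circle => //.
  apply: (@le_lt_trans _ _ (sg * (rnorm b + 1))); last by rewrite -ltr_pdivlMr.
  by rewrite ler_wpM2l // lerDl.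
apply: le_trans m10 _.
rewrite /m (_ : (fun t => _) = fun=> (M%:E - u a)%E); last first.
  by apply/funext => t; rewrite /G mul0r scale0r addr0.
by rewrite (circle_integral_cst (M%:E - u a)%E) muleC.
Qed.

End SmallCircles.

Lemma psh_of_small_circles (R : realType) n (Omega : set 'Cn[R]_n) u (s0 : R) :
  open Omega -> (forall z, Omega z -> (u z < +oo)%E) -> usc_on Omega u -> 0 < s0 ->
  (forall a b, rnorm b < s0 -> disc_in Omega a b ->
    (u a * (2 * pi)%:E <=
     \int[@lebesgue_measure R]_(t in `[0%R, (2 * pi)%R]) u (circ a b t))%E) ->
  psh Omega u.
Proof.
move=> oO uoo uu s00 usmall; apply: psh_of_circle => // a b dab.
have [M M0 uM] := usc_disc_bounded oO uu uoo dab.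
exists M; split => //.
  by move=> t; apply: uM; rewrite normE rnorm_expi lecR.
exact: (disc_submean oO uoo uu dab M0 uM s00 usmall).
Qed.

(** * Upper envelopes of families of plurisubharmonic functions *)

Section SupPsh.
Variable R : realType.
Local Notation C := (R[i]%C : numClosedFieldType).
Local Notation mu := (@lebesgue_measure R).
Local Notation L := (measurableTypeR R).
Local Notation I2pi := (`[0%R, (2 * pi)%R]%classic : set L).

Lemma usc_reg_usc n (D : set 'Cn[R]_n) f z (r : R) : (usc_reg D f z < r%:E)%E ->
  \forall y \near z, (usc_reg D f y < r%:E)%E.
Proof.
move=> /lte_real_between[q zq qr].
apply: filterS (nbhs_interior (usc_reg_lt zq)) => y yq.
apply: le_lt_trans qr; apply: usc_reg_le.
by apply: filterS yq => x + Dx => /(_ Dx)/ltW.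
Qed.

Lemma usc_on_usc_reg n (D : set 'Cn[R]_n) f : usc_on D (usc_reg D f).
Proof.
by apply/usc_onP => z _ r zr; apply: filterS (usc_reg_usc zr) => y yr _.
Qed.

(** The near-covering parameter is a pair, the centre and the bound, so one compactness argument
    over the disc gives the inclusion and a common upper bound together. *)
Lemma disc_nbhs_bounded n (Omega : set 'Cn[R]_n) u a b : open Omega ->
  usc_on Omega u -> (forall z, Omega z -> (u z < +oo)%E) -> disc_in Omega a b ->
  exists2 M : R, 0 <= M & \forall z \near a,
    forall c : C, `|c| <= 1 -> Omega (z + c *: b) /\ (u (z + c *: b)%R <= M%:E)%E.
Proof.
move=> oO /usc_onP uu uoo dab.
have /compact_near_coveringP cov := @compact_disc R.
have [] := cov ('Cn[R]_n * R)%type (filter_prod (nbhs a) +oo%R)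
  (fun i c => Omega (i.1 + c *: b) /\ (u (i.1 + c *: b)%R < i.2%:E)%E) _.
  move=> c /= c1; have Oc := dab c c1; have [r ur _] := lte_real_between (uoo _ Oc).
  have : \forall y \near a + c *: b, Omega y /\ (u y < r%:E)%E.
    apply: filterS2 (open_nbhs_nbhs (conj oO Oc)) (uu _ Oc r ur) => y Oy /(_ Oy).
    by split.
  move=> /nbhs_rnormP[e e0 eP].
  have b1 : 0 < rnorm b + 1 by rewrite ltr_wpDl // rnorm_ge0.
  have e20 : 0 < e / 2 by rewrite divr_gt0.
  exists ([set d | rnorm (d - c) < e / 2 / (rnorm b + 1)],
          [set i : 'Cn[R]_n * R | rnorm (i.1 - a) < e / 2 /\ r < i.2]).
    split=> /=; first by apply: (nbhs_rball (c : C)); rewrite divr_gt0.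
    exists ([set z | rnorm (z - a) < e / 2], [set K | r < K]) => /=.
      by split; [exact: nbhs_rball|exists r; split; [exact: num_real|]].
    by move=> [z K] /= [].
  move=> [d [z K]] /= [dc [za rK]].
  have [Oy uy] : Omega (z + d *: b) /\ (u (z + d *: b)%R < r%:E)%E.
    apply: eP; rewrite (_ : _ - _ = (z - a) + (d - c) *: b); last first.
      by rewrite opprD addrACA -scalerBl.
    apply: le_lt_trans (rnormD _ _) _; rewrite [e]splitr ltrD // rnormZ.
    apply: (@le_lt_trans _ _ (rnorm (d - c : C) * (rnorm b + 1))).
      by rewrite ler_wpM2l ?rnorm_ge0 // lerDl.
    by rewrite -ltr_pdivlMr.
  by split=> //; apply: lt_trans uy _; rewrite lte_fin.
move=> [A B] /= [aA [N [_ NB]]] AB.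
exists (Num.max 0 (N + 1)); first by rewrite le_max lexx.
apply: filterS aA => z Az c c1.
have BN : B (N + 1) by apply: NB; rewrite ltrDl.
have [Oz uz] := AB (z, N + 1) (conj Az BN) c c1.
by split=> //; apply/ltW/(lt_le_trans uz); rewrite lee_fin le_max lexx orbT.
Qed.

(** If the inequality failed at [a], some [A] would lie strictly between $2\pi(M-PS(a))$ and the
    circle integral of $M-PS$. By Fatou, [A] stays below the circle integrals at all centres [z]
    near [a]. Each [w] in [F] satisfies $w\le PS$ on these circles, hence $w(z)\le M-A/(2\pi)$, and
    the leastness of [PS] forces the same bound at [a]. *)
Lemma psh_least_usc_majorant n (Omega : set 'Cn[R]_n) (F : set ('Cn[R]_n -> \bar R))
    (PS : 'Cn[R]_n -> \bar R) :
  open Omega -> (forall w, F w -> psh Omega w) -> usc_on Omega PS ->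
  (forall z, Omega z -> (PS z < +oo)%E) ->
  (forall w z, F w -> Omega z -> (w z <= PS z)%E) ->
  (forall a (K : R), Omega a ->
     (\forall z \near a, Omega z -> forall w, F w -> (w z <= K%:E)%E) -> (PS a <= K%:E)%E) ->
  psh Omega PS.
Proof.
move=> oO Fpsh uPS PSoo wPS PSle.
apply: psh_of_circle => // a b dab.
have [M M0 Mnear] := disc_nbhs_bounded oO uPS PSoo dab.
have circ1 t : `|(cos t +i* sin t)%C : C| <= 1 by rewrite normE rnorm_expi lecR.
have Oa : Omega a by exact: disc_in_center dab.
exists M; split => //.
  by move=> t; have /(_ _ (circ1 t))[] := nbhs_singleton Mnear.
rewrite leNgt; apply/negP => /lte_real_between[A Aa AJ].
have pi0 := two_pi_gt0 R.
have : \forall z \near a, (A%:E < \int[mu]_(t in I2pi) (M%:E - PS (circ z b t)))%E.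
  apply: (circle_integral_lsc (F := fun z t => (M%:E - PS (circ z b t))%E)
     (B := fun j => [set z | rnorm (z - a) < j.+1%:R^-1])) => //.
  - move=> V /nbhs_rnormP[e e0 eV]; have [k ke] := inv_nat_lt e0.
    exists k => j kj y /= ya; apply: eV; apply: lt_le_trans ya _.
    by apply: le_trans (ltW ke); rewrite lef_pV2 ?posrE ?ltr0n // ler_nat.
  - by move=> j; apply: nbhs_rball; rewrite invr_gt0 ltr0n.
  - apply: filterS Mnear => z zM; split.
      apply: emeasurable_funB; first exact: measurable_cst.
      apply: (measurable_psh_circ oO uPS) => c c1.
      by have [] := zM c c1.
    by move=> t; have [_ h] := zM _ (circ1 t); rewrite sube_ge0 ?orbT.
  move=> t r; have Oc := disc_in_circ t dab.
  have EE y : Omega y -> (r%:E < M%:E - PS y)%E = (PS y < (M - r)%:E)%E.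
    move=> /PSoo; rewrite EFinB; case: (PS y) => [x||] // _.
      by rewrite !lte_fin ltrBrDl ltrBrDl addrC.
    by rewrite (_ : (M%:E - -oo)%E = +oo%E) // ltry -EFinB ltNyr.
  move=> h; rewrite (EE _ Oc) in h; have /nbhs_rnormP[e e0 eP] := (usc_onP Omega PS).1 uPS _ Oc _ h.
  apply: filterS2 Mnear (nbhs_rball a e0) => z zM za; have [Oz _] := zM _ (circ1 t).
  rewrite (EE _ Oz); apply: eP => //.
  by rewrite /circ opprD addrACA subrr addr0.
move=> lscA; move: Aa; apply/negP; rewrite -leNgt.
suff PSa : (PS a <= (M - A / (2 * pi))%:E)%E.
  apply: (@le_trans _ _ ((2 * pi)%:E * (M%:E - (M - A / (2 * pi))%:E))%E).
    by rewrite -EFinB -EFinM lee_fin opprB addrCA subrr addr0 mulrC divfK // gt_eqF.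
  by apply: lee_wpmul2l; [rewrite lee_fin ltW|apply: leeB].
apply: PSle => //; apply: filterS2 Mnear lscA => z zM Az Oz w Fw.
have dzb : disc_in Omega z b by move=> c /zM[].
have PSM t : (PS (circ z b t) <= M%:E)%E by have [] := zM _ (circ1 t).
have wM t : (w (circ z b t) <= M%:E)%E.
  by apply: le_trans (wPS _ _ Fw _) (PSM t); exact: disc_in_circ.
have [woo uw _] := Fpsh w Fw.
have : (A%:E < (2 * pi)%:E * (M%:E - w z))%E.
  apply: lt_le_trans Az _; apply: le_trans (psh_circle oO (Fpsh w Fw) dzb M0 wM).
  apply: ge0_le_integral => //=.
  - by move=> t _; rewrite sube_ge0 ?orbT.
  - apply: measurable_funTS; apply: emeasurable_funB; first exact: measurable_cst.
    exact: (measurable_psh_circ oO uPS dzb).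
  - apply: measurable_funTS; apply: emeasurable_funB; first exact: measurable_cst.
    exact: (measurable_psh_circ oO uw dzb).
  - by move=> t _; rewrite leeB //; apply: wPS => //; exact: disc_in_circ.
case: (w z) (woo z Oz) => [x||] // _; last by rewrite leNye.
rewrite -EFinB -EFinM lte_fin lee_fin -ltr_pdivrMl // => h.
by rewrite lerBrDl -lerBrDr; move: h; rewrite mulrC => /ltW.
Qed.

Lemma psh_usc_reg_sup n (Omega : set 'Cn[R]_n) (F : set ('Cn[R]_n -> \bar R)) :
  open Omega -> (forall w, F w -> psh Omega w) ->
  (forall a, Omega a -> exists K : R, \forall z \near a, Omega z ->
     forall w, F w -> (w z <= K%:E)%E) ->
  psh Omega (usc_reg Omega (fun z => ereal_sup [set w z | w in F])).
Proof.
move=> oO Fpsh Floc; set P := fun z => ereal_sup _.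
have Ple a (K : R) : Omega a ->
    (\forall z \near a, Omega z -> forall w, F w -> (w z <= K%:E)%E) ->
    (usc_reg Omega P a <= K%:E)%E.
  move=> Oa KP; apply: usc_reg_le; apply: filterS KP => y + Oy => /(_ Oy) yK.
  by apply: ge_ereal_sup => _ [w Fw <-]; exact: yK.
apply: (psh_least_usc_majorant oO Fpsh) => //.
- exact: usc_on_usc_reg.
- by move=> z Oz; have [K KP] := Floc z Oz; apply: le_lt_trans (Ple _ _ Oz KP) (ltry _).
- move=> w z Fw Oz; apply: (@le_trans _ _ (P z)); last exact: usc_reg_ge.
  by apply: ereal_sup_ubound; exists w.
Qed.

End SupPsh.

(** * Local upper bounds from a superharmonic majorant *)

Section SuperharmonicBound.
Variable R : realType.
Local Notation C := (R[i]%C : numClosedFieldType).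
Local Notation Re := (@complex.Re R).
Local Notation Im := (@complex.Im R).
Local Notation mu := (@lebesgue_measure R).
Local Notation L := (measurableTypeR R).
Local Notation borel := (borelCn R).
Local Notation I2pi := (`[0%R, (2 * pi)%R]%classic : set L).

Lemma eball_rnorm n (p : 'Cn[R]_n) r z : 0 <= r -> eball p r z -> rnorm (z - p) <= r.
Proof.
move=> r0 zr; apply/ler_addgt0Pr => e e0; apply/ltW/rnorm_lt; first by lra.
move=> j; apply: (@le_lt_trans _ _ r); last by lra.
rewrite rnorm_complex -[leRHS]ger0_norm // -sqrtr_sqr ler_wsqrtr //.
apply: le_trans zr; rewrite (bigD1 j) //= !mxE lerDl.
by apply: sumr_ge0 => i _; rewrite addr_ge0 // sqr_ge0.
Qed.

(** The crude factor $n+1$ dominates the constant $\sqrt n$ between the maximum norm and the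
    Euclidean norm. *)
Lemma rnorm_eball n (p : 'Cn[R]_n) r z : 0 <= r -> n.+1%:R * rnorm (z - p) <= r ->
  eball p r z.
Proof.
move=> r0 zr; rewrite /eball /=; apply: (@le_trans _ _ (\sum_(j < n) rnorm (z - p) ^+ 2)).
  apply: ler_sum => j _; have := rnorm_coord (z - p) j; rewrite !mxE => zj.
  have -> : Re (z 0 j - p 0 j) ^+ 2 + Im (z 0 j - p 0 j) ^+ 2 = rnorm (z 0 j - p 0 j : C) ^+ 2.
    by rewrite rnorm_complex sqr_sqrtr // addr_ge0 // sqr_ge0.
  by rewrite lerXn2r // nnegrE rnorm_ge0.
rewrite sumr_const card_ord -mulr_natl.
apply: (@le_trans _ _ ((n.+1%:R * rnorm (z - p)) ^+ 2)).
  rewrite exprMn ler_wpM2r ?sqr_ge0 // -natrX ler_nat.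
  by rewrite (leq_trans (leqnSn n)) // expnS expn1 leq_pmulr.
by rewrite lerXn2r // nnegrE ?mulr_ge0 ?rnorm_ge0.
Qed.

Lemma measurable_eball n (p : 'Cn[R]_n) r : measurable (eball p r : set (borel n)).
Proof.
pose h (z : borel n) := \sum_(j < n) (Re (z 0 j - p 0 j) ^+ 2 + Im (z 0 j - p 0 j) ^+ 2).
have mh : measurable_fun setT h.
  apply: measurable_sum => j; apply: measurable_funD; apply: measurable_funX.
  - rewrite (_ : (fun z => _) = fun z : borel n => Re (z 0 j) - Re (p 0 j)).
      by apply: measurable_funB; [exact: measurable_Re|exact: measurable_cst].
    by apply/funext => z; rewrite ReB.
  - rewrite (_ : (fun z => _) = fun z : borel n => Im (z 0 j) - Im (p 0 j)).
      by apply: measurable_funB; [exact: measurable_Im|exact: measurable_cst].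
    by apply/funext => z; rewrite ImB.
have -> : eball p r = h @^-1` `]-oo, r ^+ 2].
  by apply/seteqP; split=> z; rewrite /= in_itv.
by rewrite -[_ @^-1` _]setTI; exact: mh.
Qed.

Lemma measurable_translate n (h : 'Cn[R]_n) :
  measurable_fun setT (fun y : borel n => h + (y : 'Cn[R]_n) : borel n).
Proof.
have := measurable_affine (measurable_cst (1 : R)) (measurable_cst (0 : R))
  (measurable_cst (h : borel n)) (@measurable_id _ (borel n) setT).
by apply: eq_measurable_fun => y _; rewrite (_ : (1 +i* 0)%C = 1) // scale1r.
Qed.

(** Two triangle inequalities with three steps shorter than [t]; this is the origin of the 3 in the
    radius $t=r/(3(n+1))$ chosen below. *)
Lemma three_steps (A B A' B' A'' t : R) :
  A <= B + A' -> A' <= B' + A'' -> B < t -> B' < t -> A'' < t -> A <= 3 * t.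
Proof. by lra. Qed.

Variables (n : nat) (Omega : set 'Cn[R]_n) (v : 'Cn[R]_n -> \bar R) (K : R).
Hypotheses (oO : open Omega) (K0 : 0 <= K)
  (vK : forall z, Omega z -> ((- K)%:E <= v z)%E)
  (shv : sh Omega (fun z => - v z)%E).

(** The shift by [K] makes the integrand nonnegative on balls inside $\Omega$, so extension by 0 is
    harmless in comparisons. *)
Let f p r : borel n -> \bar R := ((fun z => v z + K%:E)%E \_ (eball p r)).

Let f_ge0 p r z : eball p r `<=` Omega -> (0 <= f p r z)%E.
Proof.
move=> prO; rewrite /f patchE; case: ifPn => // /set_mem /prO /vK.
case: (v z) => [x||] //; first by rewrite -EFinD !lee_fin; lra.
by move=> _; rewrite addye // leey.
Qed.

Let measurable_f p r : eball p r `<=` Omega -> measurable_fun setT (f p r).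
Proof.
move=> prO; apply/(measurable_restrictT _ (measurable_eball p r)).
apply: (@measurable_funS _ _ _ _ (Omega : set (borel n))) => //.
  exact: open_measurable_Cn.
apply: emeasurable_funD; last exact: measurable_cst.
have [_ uv _] := shv; have muv := usc_measurable_Cn oO uv.
rewrite (_ : v = fun z => - - v z)%E; last by apply/funext => z; rewrite oppeK.
exact: measurableT_comp.
Qed.

(** On the ball $-v$ is $K-(v+K)$. Were the integral of $v+K$ infinite, the mean value inequality
    for $-v$ at [p] would bound a finite number above by $-\infty$. *)
Let integral_f_lty p r : Omega p -> 0 < r -> eball p r `<=` Omega -> (v p < +oo)%E ->
  (Cn_integral (f p r) < +oo)%E.
Proof.
move=> Op r0 prO vp; pose D := eball p r; have mD := measurable_eball p r.
have mind : measurable_fun setT (fun z : borel n => (\1_D z : R)%:E).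
  by apply/measurable_EFinP/measurable_indic.
have ind01 (z : borel n) : (0 <= (\1_D z : R)%:E <= 1%:E)%E.
  by rewrite !lee_fin indicE; case: (_ \in _); rewrite ?ler01 ?lexx.
have rho0 : 0 <= rnorm p + r by rewrite addr_ge0 ?rnorm_ge0 // ltW.
have indout (z : 'Cn[R]_n) : rnorm p + r < rnorm z -> (\1_D z : R)%:E = 0%E.
  move=> zr; rewrite indicE memNset // => Dz.
  have := eball_rnorm (ltW r0) Dz; have := rnormD (z - p) p; rewrite subrK.
  by move=> h1 h2; lra.
have vol := Cn_integralB ler01 rho0 mind (measurable_cst (0%E : \bar R)) ind01
  (fun=> lexx _) indout.
have [volB _] := vol; set V := Cn_integral _ in volB.
have V0 : (0 <= V)%E.
  by apply: Cn_integral_ge0 => // z; have /andP[] := ind01 z.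
have mK : measurable_fun setT (fun z : borel n => K%:E * (\1_D z : R)%:E)%E.
  by apply: emeasurable_funM => //; exact: measurable_cst.
have K01 (z : borel n) : (0 <= K%:E * (\1_D z : R)%:E <= K%:E)%E.
  have /andP[i0 i1] := ind01 z; rewrite mule_ge0 ?lee_fin //=.
  by rewrite ler_piMr //; move: i1; rewrite lee_fin.
have Kout (z : 'Cn[R]_n) : rnorm p + r < rnorm z -> (K%:E * (\1_D z : R)%:E = 0)%E.
  by move=> zr; rewrite indout // mule0.
have [KB KE] := Cn_integralB K0 rho0 mK (measurable_f prO) K01 (fun z => f_ge0 z prO) Kout.
rewrite ltNge leye_eq; apply/negP => /eqP fy.
have [_ _ /(_ p r r0 prO)] := shv.
have -> : (fun z => - v z)%E \_ (eball p r) =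
    (fun z => K%:E * (\1_D z : R)%:E - f p r z)%E.
  apply/funext => z; rewrite /f !patchE indicE; case: ifPn => [/set_mem Dz|_].
    rewrite mule1; have := vK (prO _ Dz); case: (v z) => [x||] //= _.
    by rewrite -EFinD; congr EFin; ring.
  by rewrite /= mule0 sube0.
rewrite KE fy; apply/negP; rewrite -ltNge.
have Kfin : (Cn_integral (fun z => K%:E * (\1_D z : R)%:E)%E - +oo = -oo)%E.
  by move: KB; case: (Cn_integral _).
rewrite Kfin ltNye -ltNye; have := vK Op; move: vp; case: (v p) => [x||] // _ _.
move: V0 volB; rewrite -/V; case: V => [y||] // _ _.
by rewrite /= -EFinM ltNyr.
Qed.

(* Averaging the circle inequality at [z] over all directions [y] in a ball of radius [s] turns
   it, by rotation invariance, into a bound by a volume integral. *)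
Let psh_bound p r s : Omega p -> 0 < r -> eball p r `<=` Omega -> (v p < +oo)%E ->
  0 < s -> exists B : R, forall z, (forall y, rnorm (y - z) < s -> eball p r y) ->
    forall u, psh Omega u -> (forall y, Omega y -> (u y <= v y)%E) -> (u z <= B%:E)%E.
Proof.
move=> Op r0 prO vp s0.
have [k k0 kball] := Cn_integral_ball_gt0 n s0.
have If : Cn_integral (f p r) \is a fin_num.
  rewrite ge0_fin_numE; first exact: integral_f_lty.
  by apply: Cn_integral_ge0; [exact: measurable_f|move=> y; exact: f_ge0].
set I := fine (Cn_integral (f p r)).
have IE : Cn_integral (f p r) = I%:E by rewrite fineK.
exists (I / k) => z zsp u pu uv.
(* Truncation at 0 gives $0\le w\le v+K$ on the ball, so the extension [W] of [w] by 0 is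
   nonnegative and below [f p r]. *)
pose w y := maxe (u y + K%:E)%E 0%E.
have pw : psh Omega w.
  by apply: psh_max => //; [apply: psh_add => //; exact: psh_cst|exact: (psh_cst 0)].
have [woo uw _] := pw.
have w0 y : (0 <= w y)%E by rewrite le_max lexx orbT.
pose U := [set y : 'Cn[R]_n | rnorm (y - z) < s].
have oU : open U.
  rewrite openE => y /= ys; apply/nbhs_rnormP; exists (s - rnorm (y - z)); first by rewrite subr_gt0.
  move=> x xy; rewrite /U /=; have := rnormD (x - y) (y - z); rewrite addrA subrK => h.
  by apply: le_lt_trans h _; rewrite -ltrBrDr.
have UO : U `<=` Omega by move=> y /zsp; exact: prO.
pose W : borel n -> \bar R := w \_ U.
have mW : measurable_fun setT W.
  apply/(measurable_restrictT _ (open_measurable_Cn oU)).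
  apply: (@measurable_funS _ _ _ _ (Omega : set (borel n))) => //.
    exact: open_measurable_Cn.
  exact: usc_measurable_Cn.
have W0 y : (0 <= W y)%E by rewrite /W patchE; case: ifP.
have Wf y : (W y <= f p r y)%E.
  rewrite /W patchE; case: ifPn => [/set_mem Uy|_]; last exact: f_ge0.
  have py := zsp y Uy; rewrite /f patchE mem_set // /w ge_max; apply/andP; split.
    by rewrite leeD2r // uv //; exact: prO.
  by have := f_ge0 y prO; rewrite /f patchE mem_set.
have pi0 := two_pi_gt0 R.
pose h (q : L * borel n) := W (z + (cos q.1 +i* sin q.1)%C *: (q.2 : 'Cn[R]_n)).
have mh : measurable_fun setT h.
  apply: (measurableT_comp mW); apply: measurable_affine.
  - exact: (measurableT_comp (@measurable_cos R) measurable_fst).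
  - exact: (measurableT_comp (@measurable_sin R) measurable_fst).
  - exact: measurable_cst.
  - exact: measurable_snd.
have h0 q : (0 <= h q)%E by exact: W0.
pose ball1 (y : borel n) := (\1_[set y : 'Cn[R]_n | rnorm y < s] y : R)%:E.
have mball1 : measurable_fun setT ball1 by apply: measurable_indic_open; exact: open_rball.
have ball10 y : (0 <= ball1 y)%E by rewrite /ball1 lee_fin.
have wpi0 : (0 <= w z * (2 * pi)%:E)%E by rewrite mule_ge0 // lee_fin ltW.
have mint : measurable_fun setT (fun y : borel n => \int[mu]_(t in I2pi) h (t, y))%E.
  exact: measurable_circle_integral mh h0.
have sub (y : borel n) : (w z * (2 * pi)%:E * ball1 y <= \int[mu]_(t in I2pi) h (t, y))%E.
  rewrite /ball1 indicE; case: (boolP (y \in _)) => [/set_mem /= ys|_]; last first.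
    by rewrite mule0; exact: integral_ge0.
  have inU c : (`|c| <= 1 -> U (z + c *: (y : 'Cn[R]_n))).
    rewrite normE lecR => c1; rewrite /U /= addrAC subrr add0r rnormZ.
    by apply: le_lt_trans ys; rewrite ler_piMl ?rnorm_ge0.
  have dzy : disc_in Omega z y by move=> c /inU /UO.
  have [_ _ /(_ _ _ dzy)] := pw; rewrite mule1 => /le_trans; apply.
  rewrite le_eqVlt; apply/orP; left; apply/eqP; apply: eq_integral => t _.
  rewrite /h /W /= patchE mem_set //; apply: inU.
  by rewrite normE rnorm_expi lecR.
have main : (w z * (2 * pi)%:E * k%:E <= (2 * pi)%:E * I%:E)%E.
  apply: (@le_trans _ _ (Cn_integral (fun y => w z * (2 * pi)%:E * ball1 y)%E)).
    by rewrite Cn_integralZl // lee_wpmul2l.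
  apply: (@le_trans _ _ (Cn_integral (fun y => \int[mu]_(t in I2pi) h (t, y))%E)).
    apply: le_Cn_integral => //.
    - by apply: emeasurable_funM => //; exact: measurable_cst.
    - by move=> y; rewrite mule_ge0.
  rewrite -circle_Cn_tonelli //.
  have mWz : measurable_fun setT (fun y : borel n => W (z + (y : 'Cn[R]_n))).
    exact: (measurableT_comp mW (measurable_translate z)).
  have ct t : (Cn_integral (fun y => h (t, y)) = Cn_integral W)%E.
    rewrite /h /= (Cn_integral_rotation (f := fun y => W (z + (y : 'Cn[R]_n))) mWz) //; last exact: cos2Dsin2.
    rewrite -(Cn_integral_shift z mW W0); congr Cn_integral.
    by apply/funext => y; rewrite addrC.
  under eq_integral => t _ do rewrite ct.
  rewrite (circle_integral_cst (Cn_integral W)) muleC lee_wpmul2l ?lee_fin ?(ltW pi0) //.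
  by rewrite -IE; apply: le_Cn_integral => //; exact: measurable_f.
have wzI : (w z <= (I / k)%:E)%E.
  have := woo z (prO _ (zsp z _)); rewrite subrr rnorm0 => /(_ s0).
  move: main (w0 z); case: (w z) => [x||] // + _ _.
  rewrite -!EFinM !lee_fin ler_pdivlMr // => hx.
  by rewrite -(ler_pM2l pi0) mulrA (mulrC _ x).
apply: le_trans wzI; rewrite /w le_max; apply/orP; left.
by rewrite leeDl // lee_fin.
Qed.

(** The integrand dominates $+\infty$ times the indicator of a small ball, whose volume is
    positive. *)
Let integral_f_pole p r y d' : eball p r `<=` Omega -> 0 < d' ->
  (forall x, rnorm (x - y) < d' -> eball p r x /\ v x = +oo%E) ->
  (+oo <= Cn_integral (f p r))%E.
Proof.
move=> pO d'0 inp.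
  have [k k0 kball] := Cn_integral_ball_gt0 n d'0.
  pose g (x : borel n) := (\1_[set x : 'Cn[R]_n | rnorm x < d'] x : R)%:E.
  have mg : measurable_fun setT g by apply: measurable_indic_open; exact: open_rball.
  have g0 x : (0 <= g x)%E by rewrite /g lee_fin.
  have mog : measurable_fun setT (fun x => +oo * g x)%E.
    by apply: emeasurable_funM => //; exact: measurable_cst.
  have og0 x : (0 <= +oo * g x)%E by rewrite mule_ge0.
  pose gy (x : borel n) := (+oo * g (- y + (x : 'Cn[R]_n))%R)%E.
  have mgy : measurable_fun setT gy by exact: (measurableT_comp mog (measurable_translate (- y))).
  have Egy : Cn_integral gy = +oo%E.
    have Z := Cn_integral_shift (- y) mog og0.
    have <- : Cn_integral (fun x => +oo * g (x - y)%R)%E = Cn_integral gy.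
      by congr Cn_integral; apply/funext => x; rewrite /gy addrC.
    rewrite Z (Cn_integralZl mg g0 (leey 0%E)) gt0_mulye //.
    by apply: lt_le_trans kball; rewrite lte_fin.
  rewrite -Egy; apply: (le_Cn_integral mgy) => [||x]; [exact: measurable_f|by move=> x; exact: og0|].
  rewrite /gy /g indicE addrC; case: (boolP (_ \in _)) => [/set_mem /= xd|_].
    have [xp vx] := inp x xd; rewrite mule1 /f patchE mem_set //.
    by rewrite vx.
  by rewrite mule0; exact: f_ge0.
Qed.

Let fball z (d : R) : Omega z -> 0 < d -> exists r : R, [/\ 0 < r, r <= d &
    forall p, rnorm (p - z) < r -> eball p r `<=` Omega].
Proof.
move=> Oz d0; have /nbhs_rnormP[r r0 rO] := open_nbhs_nbhs (conj oO Oz).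
exists (Num.min (r / 2) d); split; first by rewrite lt_min d0 divr_gt0.
  by rewrite ge_min lexx orbT.
have m0 : 0 < Num.min (r / 2) d by rewrite lt_min d0 divr_gt0.
have mr : Num.min (r / 2) d <= r / 2 by rewrite ge_min lexx.
move=> p pz y /(eball_rnorm (ltW m0)) yp; apply: rO.
have := rnormD (y - p) (p - z); rewrite addrA subrK => h.
by move: h pz yp mr; lra.
Qed.

(* The interior of [{v = +oo}] is relatively closed in [Omega], for [v] would have infinite
   integral over a ball centred at a nearby point where it is finite. *)
Lemma superharmonic_finite_dense a e : connected Omega -> Omega a -> 0 < e ->
  (exists2 z, Omega z & v z != +oo%E) ->
  exists2 p, rnorm (p - a) < e /\ Omega p & (v p < +oo)%E.
Proof.
move=> cO Oa e0 [z0 Oz0 vz0]; apply: contrapT => nf.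
pose W := [set z | Omega z /\ \forall y \near z, Omega y -> v y = +oo%E].
have Wclosed z : Omega z -> closure W z -> W z.
  move=> Oz cW; split=> //; apply: contrapT => nn.
  have [r [r0 _ rP]] := fball Oz ltr01.
  (* With this radius, a point reached from [p] in three steps shorter than [t] for the maximum norm
     lies in the Euclidean ball of radius [r]. *)
  pose t := r / (3 * n.+1%:R); have n1 : 0 < n.+1%:R :> R by rewrite ltr0n.
  have t0 : 0 < t by rewrite divr_gt0 // mulr_gt0.
  have tr : n.+1%:R * (3 * t) = r by rewrite /t mulrCA mulrA mulrC divfK // mulf_neq0 ?gt_eqF.
  have tler : t <= r.
    by rewrite /t ler_pdivrMr ?mulr_gt0 // ler_peMr ?(ltW r0) // -natrM ler1n.
  clearbody t.
  have [p [pz Op vp]] : exists p, [/\ rnorm (p - z) < t, Omega p & v p <> +oo%E].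
    apply: contrapT => H; apply: nn; apply: filterS (nbhs_rball z t0) => y yz Oy.
    by apply: contrapT => vy; apply: H; exists y.
  have [y [[Oy Wy] yz]] := cW _ (nbhs_rball z t0).
  have pO : eball p r `<=` Omega by apply: rP; apply: lt_le_trans pz tler.
  have vpy : (v p < +oo)%E by rewrite lt_neqAle leey andbT; apply/eqP.
  have flty := integral_f_lty Op r0 pO vpy.
  have /nbhs_rnormP[d d0 dW] := Wy.
  have [d' [d'0 d'd d't]] : exists d' : R, [/\ 0 < d', d' <= d & d' <= t].
    by exists (Num.min d t); split; [rewrite lt_min d0|rewrite ge_min lexx|rewrite ge_min lexx orbT].
  have inp x : rnorm (x - y) < d' -> eball p r x.
    move=> xy; apply: rnorm_eball; first exact: ltW.
    have h1 := rnormD (x - y) (y - p); rewrite addrA subrK in h1.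
    have h2 := rnormD (y - z) (z - p); rewrite addrA subrK (rnormB z) in h2.
    by rewrite -tr; apply: (ler_wpM2l (ltW n1)); exact: (three_steps h1 h2 (lt_le_trans xy d't) yz pz).
  suff foo : (+oo <= Cn_integral (f p r))%E by move: (le_lt_trans foo flty); rewrite ltxx.
  apply: (integral_f_pole (y := y) pO d'0) => x xd; have xp := inp x xd.
  by split; [exact: xp|exact: (dW x (lt_le_trans xd d'd) (pO _ xp))].
have Wa : W a.
  split; [exact: Oa|]; apply: filterS (nbhs_rball a e0) => y ya Oy.
  apply: contrapT => vy; apply: nf; exists y; first by split.
  by rewrite lt_neqAle leey andbT; apply/eqP.
have Wopen : open W.
  rewrite openE => z [Oz Wz].
  apply: filterS2 (open_nbhs_nbhs (conj oO Oz)) (nbhs_interior Wz) => y Oy Wy.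
  by split.
have WE : W = Omega.
  apply: cO; first by exists a.
    by exists W => //; rewrite setIidr // => z [].
  exists (closure W); first exact: closed_closure.
  apply/seteqP; split=> [z Wz|z [Oz cW]]; last exact: Wclosed.
  by split; [case: Wz|exact: subset_closure].
have [_ /nbhs_singleton/(_ Oz0) vE] : W z0 by rewrite WE.
by rewrite vE eqxx in vz0.
Qed.

(** Some [p] with [v p] finite lies within [t] of [a], and the ball of radius [r] about [p] contains
    the [t]-balls about all points [z] within [t] of [a], so one constant from [psh_bound] serves
    them all. *)
Lemma superharmonic_majorant_bound a : connected Omega -> Omega a ->
  (exists2 z, Omega z & v z != +oo%E) ->
  exists B : R, \forall z \near a, Omega z ->
    forall u, psh Omega u -> (forall y, Omega y -> (u y <= v y)%E) -> (u z <= B%:E)%E.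
Proof.
move=> cO Oa fin; have [r [r0 _ rP]] := fball Oa ltr01.
pose t := r / (3 * n.+1%:R); have n1 : 0 < n.+1%:R :> R by rewrite ltr0n.
have t0 : 0 < t by rewrite divr_gt0 // mulr_gt0.
have tr : n.+1%:R * (3 * t) = r by rewrite /t mulrCA mulrA mulrC divfK // mulf_neq0 ?gt_eqF.
have tler : t <= r.
  by rewrite /t ler_pdivrMr ?mulr_gt0 // ler_peMr ?(ltW r0) // -natrM ler1n.
clearbody t; have [p [pa Op] vp] := superharmonic_finite_dense cO Oa t0 fin.
have pO : eball p r `<=` Omega by apply: rP; apply: lt_le_trans pa tler.
have [B HB] := psh_bound Op r0 pO vp t0.
exists B; apply: filterS (nbhs_rball a t0) => z za _ u pu uv.
apply: HB pu uv => y yz; apply: (rnorm_eball (ltW r0)).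
have h1 := rnormD (y - z) (z - p); rewrite addrA subrK in h1.
have h2 := rnormD (z - a) (a - p); rewrite addrA subrK (rnormB a) in h2.
by rewrite -tr; apply: (ler_wpM2l (ltW n1)); exact: (three_steps h1 h2 yz za pa).
Qed.

End SuperharmonicBound.

(** * Plurisubharmonicity and quasi upper boundedness of the envelope *)

Section Envelope.
Variable R : realType.
Local Notation C := (R[i]%C : numClosedFieldType).

Lemma psh_eq_on n (Omega : set 'Cn[R]_n) u w :
  (forall z, Omega z -> u z = w z) -> psh Omega u -> psh Omega w.
Proof.
move=> uw [uoo /usc_onP uu um]; split.
- by move=> z Oz; rewrite -uw // uoo.
- apply/usc_onP => z Oz a; rewrite -(uw _ Oz) => /(uu _ Oz a).
  by apply: filterS => y h Oy; rewrite -(uw _ Oy); exact: h.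
- move=> a b dab; rewrite -(uw _ (disc_in_center dab)).
  apply: le_trans (um a b dab) _; rewrite le_eqVlt; apply/orP; left; apply/eqP.
  by apply: eq_integral => t _; apply: uw; exact: (disc_in_circ t dab).
Qed.

Lemma compact_closure_Cn n (A : set 'Cn[R]_n) : bounded_set A -> compact (closure A).
Proof.
move=> Abd; apply: bounded_closed_compact_Cn; last exact: closed_closure.
have [M [Mr MA]] : exists M : C, M \is Num.real /\ forall x, M < x -> forall z, A z -> `|z| <= x.
  by case: Abd => M [Mr MA]; exists M; split=> // x /MA.
exists (M + 1); split; first by rewrite realD ?real1.
move=> x Mx z cz; have [y [Ay /= yz]] := cz _ (nbhs_rball z ltr01).
have h1 : `|y| <= x - 1 by apply: MA => //; rewrite ltrBrDr.
have h2 : `|y - z| <= 1 by rewrite normE lecR ltW.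
rewrite -(subrK y z) -[x](subrK 1) addrC; apply: le_trans (ler_normD _ _) _.
by rewrite lerD // -normrN opprB.
Qed.

Lemma lsc_lbound n (D : set 'Cn[R]_n) v : compact D -> lsc_on D v ->
  (forall z, D z -> v z != -oo%E) ->
  exists2 K : R, 0 <= K & forall z, D z -> ((- K)%:E <= v z)%E.
Proof.
move=> cD /lsc_onP lv vN.
have [x Dx|c Hc] := compact_ubound (g := fun z => - v z)%E cD.
  have : (-oo < v x)%E by rewrite ltNye vN.
  move=> /lte_real_between[r _ rv]; exists (- r).
  by apply: filterS (lv _ Dx _ rv) => y + Dy => /(_ Dy); rewrite EFinN lteN2.
exists (Num.max 0 c); first by rewrite le_max lexx.
move=> z /Hc; rewrite EFinN leeNl => /ltW /le_trans; apply.
by rewrite lee_fin le_max lexx orbT.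
Qed.

(** [closure D z] excludes a limit superior over the empty set, which would be $-\infty$. *)
Lemma usc_reg_ge_near n (D : set 'Cn[R]_n) f z (a : R) : closure D z ->
  (\forall y \near z, D y -> (a%:E <= f y)%E) -> (a%:E <= usc_reg D f z)%E.
Proof.
move=> cz af; rewrite leNgt; apply/negP => /usc_reg_lt fa.
have [y [Dy []]] := cz _ (filterI af fa).
by move=> /(_ Dy) h1 /(_ Dy) h2; move: (le_lt_trans h1 h2); rewrite ltxx.
Qed.

Lemma cvg_ereal_of_bounds (T : Type) (F : set_system T) (FF : Filter F)
    (f : T -> \bar R) (l : \bar R) :
  (forall r : R, (r%:E < l)%E -> \forall x \near F, (r%:E < f x)%E) ->
  (forall r : R, (l < r%:E)%E -> \forall x \near F, (f x < r%:E)%E) ->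
  f @ F --> l.
Proof.
case: l => [l||] lo up A /=.
- move=> lA; have /nbhs_ballP[e /= e0 eA] : nbhs l (fun r => A r%:E) := lA.
  have := lo (l - e); have := up (l + e); rewrite !lte_fin ltrDl ltrBlDr ltrDl.
  move=> /(_ e0) h1 /(_ e0) h2; apply: filterS2 h1 h2 => x /=.
  case: (f x) => [y||] //; rewrite !lte_fin => h1 h2; apply: eA.
  by rewrite /ball /= ltr_distlC h1 h2.
- move=> [M [_ MA]]; apply: filterS (lo M (ltry _)) => x; exact: MA.
- move=> [M [_ MA]]; apply: filterS (up M (ltNyr _)) => x; exact: MA.
Qed.

Lemma envelope_le n (Omega : set 'Cn[R]_n) f z : Omega z -> (envelope Omega f z <= f z)%E.
Proof.
move=> Oz; apply: ge_ereal_sup => _ [u [_ uf] <-].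
by apply: le_trans (usc_reg_ge _ Oz) (uf _ (subset_closure Oz)).
Qed.

Lemma le_envelope n (Omega : set 'Cn[R]_n) phi u z : psh Omega u ->
  (forall y, Omega y -> (u y <= usc_reg Omega phi y)%E) ->
  (u z <= envelope Omega (usc_reg Omega phi) z)%E.
Proof.
move=> pu uf; apply: ereal_sup_ubound; exists u => //; split=> // x _.
exact: usc_reg_le_usc_reg.
Qed.

Lemma envelope_psh n (Omega : set 'Cn[R]_n) phi v : open Omega -> connected Omega ->
  bounded_set Omega -> superharmonic_majorant Omega (usc_reg Omega phi) v ->
  (exists2 z, Omega z & v z != +oo%E) ->
  psh Omega (envelope Omega (usc_reg Omega phi)).
Proof.
move=> oO cO bO [vN lv shv phiv] vfin.
have [K K0 vK] := lsc_lbound (compact_closure_Cn bO) lv vN.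
have vKO z : Omega z -> ((- K)%:E <= v z)%E by move=> /subset_closure /vK.
set P := envelope _ _; set PS := usc_reg Omega P.
have pPS : psh Omega PS.
  apply: psh_usc_reg_sup => // [w [] //|a Oa].
  have [B HB] := superharmonic_majorant_bound oO K0 vKO shv cO Oa vfin.
  exists B; apply: filterS HB => z zB Oz w [pw wphi]; apply: zB => // y Oy.
  apply: le_trans (usc_reg_ge _ Oy) _; have cy := subset_closure Oy.
  exact: le_trans (wphi _ cy) (phiv _ cy).
apply: (psh_eq_on _ pPS) => z Oz; apply/eqP; rewrite eq_le usc_reg_ge // andbT.
apply: le_envelope => // y Oy; apply: usc_reg_le_usc_reg => x Ox.
exact: envelope_le.
Qed.

Lemma psh_regularized n (Omega : set 'Cn[R]_n) P v (K c : R) : open Omega ->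
  psh Omega P -> psh Omega (fun z => - v z)%E -> 0 < c ->
  psh Omega (fun z => P z + c%:E * (- v z + (- K)%:E))%E.
Proof.
move=> oO pP pv c0; apply: (psh_add oO pP).
apply: (psh_scale oO c0); apply: (psh_add oO pv); exact: psh_cst.
Qed.

(** Take [N] from the growth condition with constant $1/c$. Where $\phi^*>N$ the term $cv$ is at
    least $\phi^*$ and absorbs it; elsewhere $v+K\ge0$ leaves at most [N]. *)
Lemma regularized_le n (Omega : set 'Cn[R]_n) phi v (K c : R) : 0 < c ->
  superharmonic_majorant Omega (usc_reg Omega phi) v ->
  strong_psh_majorant Omega (usc_reg Omega phi) v -> 0 <= K ->
  (forall z, Omega z -> ((- K)%:E <= v z)%E) ->
  exists N : R, forall z, Omega z ->
    (envelope Omega (usc_reg Omega phi) z + c%:E * (- v z + (- K)%:E) <= N%:E)%E.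
Proof.
move=> c0 [_ _ _ phiv] [_ _ _ _ strong] K0 vK.
have ci0 : 0 < c^-1 by rewrite invr_gt0.
have [N N0 HN] := strong _ ci0.
exists N => z Oz; have cz := subset_closure Oz.
have := envelope_le (usc_reg Omega phi) Oz; move: (envelope _ _ z) => P Pg.
have := phiv _ cz; have := HN _ cz; have := vK _ Oz.
move: Pg; case: (v z) => [x||] //; last first.
  move=> _ _ _ _; rewrite (_ : (c%:E * _)%E = -oo%E); last by rewrite /= gt0_muleNy.
  by rewrite addeNy leNye.
rewrite lee_fin -EFinN -EFinD -EFinM => Pg xK + gx.
case: (usc_reg _ _ z) Pg gx => [y||] //; last first.
  by rewrite leeNy_eq => /eqP -> _ _; rewrite addNye leNye.
rewrite !lee_fin lte_fin => Py _ Ny.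
apply: (@le_trans _ _ (y + c * (- x - K))%:E); first by rewrite EFinD leeD2r.
have xK0 : 0 <= c * (x + K) by rewrite mulr_ge0 ?(ltW c0) //; move: xK; clear; lra.
have E : c * (- x - K) = - (c * (x + K)) by ring.
rewrite lee_fin E; have [Ny'|yN] := ltP N y; last by move: yN xK0; clear; lra.
have := Ny Ny'; rewrite ler_pdivrMl // => h.
have cK : 0 <= c * K by rewrite mulr_ge0 // ltW.
by rewrite mulrDr; move: h cK N0; clear; lra.
Qed.

Lemma envelope_quasi_upper_bounded n (Omega : set 'Cn[R]_n) phi v :
  is_domain Omega -> bounded_set Omega ->
  superharmonic_majorant Omega (usc_reg Omega phi) v ->
  strong_psh_majorant Omega (usc_reg Omega phi) v ->
  psh Omega (envelope Omega (usc_reg Omega phi)) ->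
  quasi_upper_bounded Omega (envelope Omega (usc_reg Omega phi)).
Proof.
move=> dO bO maj strong pP; have [oO _ _] := dO.
have [vN lv _ _] := maj; have [_ _ pv _ _] := strong.
have [K K0 vK] := lsc_lbound (compact_closure_Cn bO) lv vN.
have vKO z : Omega z -> ((- K)%:E <= v z)%E by move=> /subset_closure /vK.
split=> //; set P := envelope _ _ in pP *.
have j0 j : 0 < j.+1%:R^-1 :> R by rewrite invr_gt0 ltr0n.
exists (fun j z => P z + (j.+1%:R^-1)%:E * (- v z + (- K)%:E))%E.
exists [set z | Omega z /\ v z = +oo%E]; split.
- by move=> z [].
- move=> a [Oa va]; exists Omega, (fun z => - v z)%E; split => //.
  by move=> z [_ ->].
- by move=> j; apply: (psh_regularized _ oO pP pv.1 (j0 j)).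
- by move=> j; exact: (regularized_le (j0 j) maj strong K0 vKO).
move=> z Oz nE.
have [x vx] : exists x, v z = x%:E.
  have := vN _ (subset_closure Oz); case E : (v z) => [x||] // _; first by exists x.
  by case: nE.
have xK : 0 <= x + K by have := vKO _ Oz; rewrite vx lee_fin; lra.
rewrite vx; have [Poo _ _] := pP; move: (Poo _ Oz); case: (P z) => [p||] // _; last first.
  split; first by move=> i j ij; rewrite !addNye.
  rewrite (_ : (fun j => _) = fun=> -oo%E); first exact: cvg_cst.
  by apply/funext => j; rewrite addNye.
have uE j : (p%:E + (j.+1%:R^-1)%:E * (- x%:E + (- K)%:E) =
    (p - harmonic j * (x + K))%:E)%E.
  by rewrite -EFinN -EFinD /harmonic /=; congr EFin; ring.
split.
  move=> i j ij; rewrite !uE lee_fin lerD2l lerN2 ler_wpM2r //.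
  by rewrite /harmonic /= lef_pV2 ?posrE ?ltr0n // ler_nat.
rewrite (_ : (fun j => _) = fun j => (p - harmonic j * (x + K))%:E); last first.
  by apply/funext.
apply: cvg_EFin; first exact: nearW.
rewrite -[X in _ --> X]subr0 -[X in _ - X](mul0r (x + K)).
by apply: cvgB; [exact: cvg_cst|apply: cvgMl; exact: cvg_harmonic].
Qed.

End Envelope.

(** * Boundary limits, gluing of translates, and local comparison *)

Section Continuity.
Variable R : realType.
Local Notation C := (R[i]%C : numClosedFieldType).

Lemma cone_continuous (V : normedModType C) (a b k : R) (z0 : V) :
  continuous (fun z : V => Num.max a (b - k * rnorm (z - z0)) : R).
Proof.
have sc : continuous (fun z : V => z - z0).
  by move=> z; apply: cvgB; [exact: cvg_id|exact: cvg_cst].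
have lc : continuous (fun z : V => b - k * rnorm (z - z0) : R^o).
  move=> z; have nc := continuous_comp (sc z) (@rnorm_continuous R V (z - z0)).
  by apply: cvgB; [exact: cvg_cst|apply: cvgM; [exact: cvg_cst|exact: nc]].
by move=> z; exact: (@continuous_max R V (fun=> a) (fun z => b - k * rnorm (z - z0)) z
  (@cst_continuous _ _ a z) (lc z)).
Qed.

(** The upper half is $P\le\phi^*$ with $\phi^*$ upper semicontinuous. For the lower half, a
    continuous $g\le\phi^*$ on $\overline\Omega$ gives $P_g\le P$, and $P_g$ tends to $g(z_0)$
    because $z_0\notin B_\Omega$. *)
Lemma envelope_cvg_bdry n (Omega : set 'Cn[R]_n) phi (c : R) z0 :
  (forall z, Omega z -> (c%:E <= phi z)%E) -> bdry Omega z0 ->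
  ~ B_singular Omega z0 -> ~ discontinuity_set Omega phi z0 ->
  envelope Omega (usc_reg Omega phi) z @[z --> within Omega (nbhs z0)]
    --> usc_reg Omega phi z0.
Proof.
move=> phic bz0 nB nE; have [cz0 _] := bz0.
have El : usc_reg Omega phi z0 = lsc_reg Omega phi z0.
  by apply: contrapT => /eqP h; apply: nE; split.
have phicc x : closure Omega x -> (c%:E <= usc_reg Omega phi x)%E.
  move=> cx; apply: (usc_reg_ge_near cx).
  by apply/nbhs_rnormP; exists 1 => // y _; exact: phic.
apply: cvg_ereal_of_bounds => r; last first.
  move=> /usc_reg_usc rP.
  have : \forall y \near z0, Omega y -> (envelope Omega (usc_reg Omega phi) y < r%:E)%E.
    by apply: filterS rP => y yr Oy; apply: le_lt_trans yr; exact: envelope_le.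
  by [].
rewrite El => /lte_real_between[L rL /lsc_reg_gt/nbhs_rnormP[d d0 dL]].
(* $c'\le c$ keeps the flat part of [g] below $\phi$, and $c'\le L$ makes the slope of the cone
   nonnegative. *)
have [c' [c'c c'L]] : exists c', c' <= c /\ c' <= L.
  by exists (Num.min c L); rewrite !ge_min !lexx orbT.
(* The cone falls from [L] at its apex to [c'] at distance [d], the radius within which [L] is a
   lower bound of $\phi$. *)
pose g (z : 'Cn[R]_n) : R := Num.max c' (L - (L - c') / d * rnorm (z - z0)).
have gc : continuous g by exact: cone_continuous.
have g0 : g z0 = L by rewrite /g subrr rnorm0 mulr0 subr0; apply/max_idPr.
have gphi x : closure Omega x -> ((g x)%:E <= usc_reg Omega phi x)%E.
  move=> cx; have [xd|dx] := ltP (rnorm (x - z0)) d.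
    apply: (@le_trans _ _ L%:E).
      rewrite lee_fin ge_max c'L /= lerBlDr lerDl mulr_ge0 ?rnorm_ge0 //.
      by rewrite divr_ge0 ?subr_ge0 // ltW.
    apply: (usc_reg_ge_near cx); apply/nbhs_rnormP.
    exists (d - rnorm (x - z0)); first by rewrite subr_gt0.
    move=> y yx Oy; apply/ltW/dL => //.
    have := rnormD (y - x) (x - z0); rewrite addrA subrK => h.
    by apply: le_lt_trans h _; rewrite -ltrBrDr.
  apply: le_trans (phicc _ cx); rewrite lee_fin ge_max c'c /=.
  apply: le_trans c'c; rewrite lerBlDl -lerBlDr -mulrA -[leLHS]mulr1.
  by rewrite ler_wpM2l ?subr_ge0 // mulrC ler_pdivlMr // mul1r.
(* To lie outside the intersection $B_\Omega$ is to miss one admissible set [A], and the boundary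
   limits hold off that set. *)
have [A [AB Apl HA nA]] : exists A, [/\ A `<=` bdry Omega, Omega_pluripolar Omega A,
    forall g : 'Cn[R]_n -> R, {within closure Omega, continuous g} ->
      forall y, bdry Omega y -> ~ A y ->
        (bdry_envelope Omega (EFin \o g) z @[z --> within Omega (nbhs y)] --> (g y)%:E) /\
        (envelope Omega (EFin \o g) z @[z --> within Omega (nbhs y)] --> (g y)%:E) & ~ A z0].
  apply: contrapT => nA; apply: nB; split=> // A AB Apl HA.
  by apply: contrapT => nAz; apply: nA; exists A; split.
have [_] := HA g (continuous_subspaceT gc) z0 bz0 nA; rewrite g0 => lim.
have near_r : nbhs L%:E [set x | (r%:E < x)%E].
  by apply: open_nbhs_nbhs; split=> //; exact: open_ereal_gt_ereal.
have ev : \forall y \near z0, Omega y -> (r%:E < envelope Omega (EFin \o g) y)%E :=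
  lim _ near_r.
suff : \forall y \near z0, Omega y -> (r%:E < envelope Omega (usc_reg Omega phi) y)%E by [].
apply: filterS ev => y /= ry Oy; apply: lt_le_trans (ry Oy) _.
apply: ge_ereal_sup => _ [u [pu ug] <-]; apply: ereal_sup_ubound; exists u => //.
by split=> // x cx; exact: le_trans (ug x cx) (gphi x cx).
Qed.

(** Glue $\max(P,Q(\cdot+h))$ on [U] to $P$ outside. A point satisfying the first alternative is
    interior to [U], so the seam consists of points satisfying the second, and there the maximum is
    $P$. *)
Lemma envelope_ge_translate n (Omega : set 'Cn[R]_n) phi Q (d : R) (h : 'Cn[R]_n) :
  open Omega -> psh Omega (envelope Omega (usc_reg Omega phi)) -> psh Omega Q ->
  rnorm h < d / 2 ->
  (forall z, Omega z ->
    (forall k, rnorm k < d -> Omega (z + k) /\ (Q (z + k)%R <= usc_reg Omega phi z)%E) \/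
    (forall k, rnorm k < d -> Omega (z + k) ->
       (Q (z + k)%R <= envelope Omega (usc_reg Omega phi) z)%E)) ->
  forall z, (forall k, rnorm k < d / 2 -> Omega (z + k)) ->
    (Q (z + h)%R <= envelope Omega (usc_reg Omega phi) z)%E.
Proof.
move=> oO; set P := envelope _ _ => pP pQ hd alt.
have Pphi z : Omega z -> (P z <= usc_reg Omega phi z)%E by exact: envelope_le.
have leE u z : psh Omega u -> (forall y, Omega y -> (u y <= usc_reg Omega phi y)%E) ->
  (u z <= P z)%E by exact: le_envelope.
clearbody P.
have d2 : 0 < d / 2 by apply: le_lt_trans hd; exact: rnorm_ge0.
have hd' : rnorm h < d by move: hd d2; clear; lra.
(* The radius is [d / 2] and not [d], so that circles of radius below [d / 2] about a centre
   satisfying the first alternative stay in [U]. *)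
pose U := [set z | forall k, rnorm k < d / 2 -> Omega (z + k)].
pose V := [set z | Omega (z + h)].
have UO z : U z -> Omega z by move=> /(_ 0); rewrite rnorm0 addr0; exact.
have UV z : U z -> V z by move=> /(_ h hd).
have oV : open V.
  rewrite openE => z Vz; have /nbhs_rnormP[e e0 eO] := open_nbhs_nbhs (conj oO Vz).
  apply/nbhs_rnormP; exists e => // y yz; apply: eO.
  by rewrite (_ : y + h - (z + h) = y - z) // opprD addrACA subrr addr0.
pose m z := maxe (P z) (Q (z + h)).
have oOV : open (Omega `&` V) by exact: openI.
have pm : psh (Omega `&` V) m.
  apply: (psh_max oOV); first by apply: psh_subset pP => z [].
  by apply: (psh_subset _ (psh_translate h pQ)) => z [].
pose u z := if `[< U z >] then m z else P z.
have uU z : U z -> u z = m z by move=> Uz; rewrite /u asboolT.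
have uP z : ~ U z -> u z = P z by move=> Uz; rewrite /u asboolF.
have Pu z : (P z <= u z)%E by rewrite /u; case: ifP => // _; rewrite /m le_max lexx.
have um z : (u z <= m z)%E by rewrite /u; case: ifP => // _; rewrite /m le_max lexx.
have [Poo /usc_onP uscP _] := pP; have [moo /usc_onP uscm meanm] := pm.
have uoo z : Omega z -> (u z < +oo)%E.
  move=> Oz; have [Uz|nU] := pselect (U z); last by rewrite uP // Poo.
  by rewrite uU // moo //; split=> //; exact: UV.
have uscu : usc_on Omega u.
  apply/usc_onP => z Oz a; have [Uz|nU] := pselect (U z).
    rewrite uU // => ma; have OVz : (Omega `&` V) z by split=> //; exact: UV.
    apply: filterS2 (open_nbhs_nbhs (conj oOV OVz)) (uscm _ OVz _ ma) => y OVy /(_ OVy) ya _.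
    exact: le_lt_trans (um y) ya.
  rewrite uP // => Pa.
  (* As $|k|<d/2$ is strict, the same exterior point $z+k$ keeps every point near [z] out of [U];
     hence [u] is [P] around [z]. *)
  have [k [kd nk]] : exists k, rnorm k < d / 2 /\ ~ Omega (z + k).
    apply: contrapT => nk; apply: nU => k kd; apply: contrapT => nO.
    by apply: nk; exists k.
  have dk : 0 < d / 2 - rnorm k by rewrite subr_gt0.
  apply: filterS2 (nbhs_rball z dk) (uscP _ Oz _ Pa) => y yz yP Oy.
  rewrite uP; first exact: yP.
  move=> Uy; apply: nk; have Ey : y + (z + k - y) = z + k by rewrite addrC subrK.
  rewrite -Ey; apply: Uy.
  have -> : z + k - y = (z - y) + k by rewrite addrAC.
  by apply: le_lt_trans (rnormD _ _) _; rewrite (rnormB z) -ltrBrDr.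
have alt2 z : Omega z -> (forall k, rnorm k < d -> Omega (z + k) -> (Q (z + k)%R <= P z)%E) ->
    u z = P z.
  move=> Oz H; have [Uz|nU] := pselect (U z); last exact: uP.
  by rewrite uU // /m; apply/max_idPl/H => //; exact: UV.
have pu : psh Omega u.
  apply: (psh_of_small_circles oO uoo uscu d2) => a b bd dab.
  have Oa := disc_in_center dab; have [H|H] := alt a Oa.
    have inU c : `|c| <= 1 -> U (a + c *: b).
      rewrite normE lecR => c1 k kd; rewrite -addrA; apply: (H _ _).1.
      apply: le_lt_trans (rnormD _ _) _; rewrite [d]splitr ltrD //.
      by apply: le_lt_trans bd; rewrite rnormZ ler_piMl ?rnorm_ge0.
    have dOV : disc_in (Omega `&` V) a b.
      by move=> c /inU Uc; split; [exact: UO|exact: UV].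
    have Ua : U a by have := inU 0; rewrite normr0 scale0r addr0; apply.
    rewrite uU //; apply: le_trans (meanm a b dOV) _.
    rewrite le_eqVlt; apply/orP; left; apply/eqP; apply: eq_integral => t _.
    by rewrite uU //; apply: inU; rewrite normE rnorm_expi lecR.
  (* Second alternative: [u] equals [P] at the centre and dominates it on the circle, so the
     inequality for [P] suffices. *)
  have [M M0 uM] := usc_disc_bounded oO uscu uoo dab.
  have uMc t : (u (circ a b t) <= M%:E)%E by apply: uM; rewrite normE rnorm_expi lecR.
  have PMc t : (P (circ a b t) <= M%:E)%E by apply: le_trans (Pu _) (uMc t).
  have uscP' : usc_on Omega P by apply/usc_onP.
  have mcu := measurable_psh_circ oO uscu dab; have mcP := measurable_psh_circ oO uscP' dab.
  apply: (submean_ge0 mcu uMc M0 (uoo a Oa)).2; rewrite (alt2 a Oa H).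
  apply: le_trans (psh_circle oO pP dab M0 PMc).
  apply: ge0_le_integral => //=.
  - by move=> t _; rewrite sube_ge0 ?orbT.
  - by apply: measurable_funTS; apply: emeasurable_funB; [exact: measurable_cst|exact: mcu].
  - by apply: measurable_funTS; apply: emeasurable_funB; [exact: measurable_cst|exact: mcP].
  - by move=> t _; rewrite leeB.
have uphi z : Omega z -> (u z <= usc_reg Omega phi z)%E.
  move=> Oz; have [H|H] := alt z Oz; last by rewrite alt2 // Pphi.
  apply: le_trans (um z) _; rewrite /m ge_max Pphi //=.
  exact: (H h hd').2.
move=> z Uz; apply: le_trans (leE u z pu uphi).
by rewrite (uU z Uz) /m le_max lexx orbT.
Qed.

(** Near-covering compactness with [d] tending to $0^+$; for this the local hypothesis must hold for
    all [d <= e] at once. *)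
Lemma compact_uniform_radius n (K : set 'Cn[R]_n) (S : R -> 'Cn[R]_n -> Prop) : compact K ->
  (forall x, K x -> exists2 e : R, 0 < e &
     forall z d, rnorm (z - x) < e -> d <= e -> S d z) ->
  exists2 d : R, 0 < d & forall z, K z -> S d z.
Proof.
move=> /compact_near_coveringP cov loc.
have := cov R (0 : R)^'+ (fun d z => S d z) _.
case=> [x Kx|].
  have [e e0 eS] := loc x Kx.
  exists ([set z | rnorm (z - x) < e], [set d | d < e]) => /=.
    by split; [exact: nbhs_rball|exact: nbhs_right_lt].
  by move=> [z d] /= [ze de]; apply: eS => //; exact: ltW.
move=> d0 d00 H.
have [d [d0' dS]] := filter_ex (filterI (nbhs_right_gt (0 : R)) (ex_intro2 _ _ d0 d00 H)).
by exists d.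
Qed.

(** One constant separates [Q] from [T] near [x]. It is [c] when $W^*(x)=-\infty$, since
    $W<(c-N)/\varepsilon$ nearby; it is $\phi^*(x)-\varepsilon/2$ when $\phi^*(x)$ is finite, half
    of $\varepsilon$ being spent on each side; it is [N] when $\phi^*(x)=+\infty$. *)
Lemma local_domination n (Omega : set 'Cn[R]_n) phi Q T W (c N eps : R) x : 0 < eps ->
  (forall y, Omega y -> (Q y <= usc_reg Omega phi y + (- eps)%:E)%E) ->
  (forall y, Omega y -> (Q y <= N%:E + eps%:E * W y)%E) ->
  (forall y, Omega y -> (W y < 0)%E) ->
  (forall z, Omega z -> (c%:E <= T z)%E) ->
  usc_reg Omega W x = -oo%E \/
    ((c%:E <= usc_reg Omega phi x)%E /\
     forall r : R, (r%:E < usc_reg Omega phi x)%E ->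
       \forall y \near x, Omega y -> (r%:E < T y)%E) ->
  exists2 e : R, 0 < e & forall y z, Omega y -> Omega z ->
    rnorm (y - x) < e -> rnorm (z - x) < e -> (Q y <= T z)%E.
Proof.
move=> e0 Qphi QN W0 cT.
have sep (r : R) : (\forall y \near x, Omega y -> (Q y <= r%:E)%E) ->
    (\forall y \near x, Omega y -> (r%:E <= T y)%E) ->
  exists2 e : R, 0 < e & forall y z, Omega y -> Omega z ->
    rnorm (y - x) < e -> rnorm (z - x) < e -> (Q y <= T z)%E.
  move=> h1 h2; have h12 : \forall y \near x, (Omega y -> (Q y <= r%:E)%E) /\ (Omega y -> (r%:E <= T y)%E).
    by apply: filterS2 h1 h2 => y.
  have /nbhs_rnormP[e e0' H] := h12.
  exists e => // y z Oy Oz /H[/(_ Oy) Qr _] /H[_ /(_ Oz) rT]; exact: le_trans Qr rT.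
case=> [Wx|[cl lo]].
  have : (usc_reg Omega W x < ((c - N) / eps)%:E)%E by rewrite Wx ltNyr.
  move=> /usc_reg_lt Wlt; apply: (sep c); last first.
    by apply: filterS Wlt => z _; exact: cT.
  apply: filterS Wlt => y + Oy => /(_ Oy) Wy; apply: le_trans (QN _ Oy) _.
  move: Wy; case: (W y) => [w||] //; last by rewrite gt0_muleNy // leNye.
  rewrite lte_fin ltr_pdivlMr // -EFinM -EFinD lee_fin => Wy.
  by move: Wy; clear; lra.
move: cl lo; case El : (usc_reg Omega phi x) => [l||] // cl lo.
  have up : (usc_reg Omega phi x < (l + eps / 2)%:E)%E.
    by rewrite El lte_fin ltrDl divr_gt0.
  have lo' : (((l - eps / 2)%:E) < l%:E)%E by rewrite lte_fin ltrBlDr ltrDl divr_gt0.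
  apply: (sep (l - eps / 2)); last first.
    by apply: filterS (lo _ lo') => y H Oy; apply/ltW/H.
  apply: filterS (usc_reg_usc up) => y yl Oy; apply: le_trans (Qphi _ Oy) _.
  move: yl; case: (usc_reg _ _ y) => [a||] //; last by rewrite addNye leNye.
  by rewrite lte_fin -EFinD lee_fin; clear; lra.
apply: (sep N); last by apply: filterS (lo N (ltry _)) => y H Oy; apply/ltW/H.
apply/nbhs_rnormP; exists 1 => // y _ Oy; apply: le_trans (QN _ Oy) _.
have := W0 y Oy; case: (W y) => [w||] //; last by rewrite gt0_muleNy // leNye.
rewrite lte_fin -EFinM -EFinD lee_fin => w0; rewrite gerDl.
by rewrite mulr_ge0_le0 // ltW.
Qed.

End Continuity.

(** * Lower semicontinuity of the envelope inside $\Omega$ *)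

Section LowerSemicontinuity.
Variable R : realType.
Local Notation C := (R[i]%C : numClosedFieldType).

Lemma usc_reg_mono n (D : set 'Cn[R]_n) f g z : (forall y, D y -> (f y <= g y)%E) ->
  (usc_reg D f z <= usc_reg D g z)%E.
Proof.
move=> fg; apply: usc_reg_le_usc_reg => y Dy.
exact: le_trans (fg y Dy) (usc_reg_ge _ Dy).
Qed.

(** [local_domination] is applied around every point [x] of the closure: with [T] equal to $\phi^*$
    if $x\in\Omega$, where a whole ball stays in $\Omega$, and with [T] equal to [P] if [x] is a
    boundary point, where [P] tends to $\phi^*(x)$ off the singular sets. Radius [e / 2] keeps both
    [z] and [z + k] within [e] of [x]. *)
Lemma translate_radius n (Omega : set 'Cn[R]_n) phi Q W (c N eps : R) :
  open Omega -> bounded_set Omega -> 0 < eps ->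
  (forall z, Omega z -> (c%:E <= phi z)%E) ->
  (forall y, Omega y -> (Q y <= usc_reg Omega phi y + (- eps)%:E)%E) ->
  (forall y, Omega y -> (Q y <= N%:E + eps%:E * W y)%E) ->
  (forall y, Omega y -> (W y < 0)%E) ->
  (forall x, B_singular Omega x \/ discontinuity_set Omega phi x ->
     usc_reg Omega W x = -oo%E) ->
  exists2 d : R, 0 < d & forall z, Omega z ->
    (forall k, rnorm k < d -> Omega (z + k) /\ (Q (z + k)%R <= usc_reg Omega phi z)%E) \/
    (forall k, rnorm k < d -> Omega (z + k) ->
       (Q (z + k)%R <= envelope Omega (usc_reg Omega phi) z)%E).
Proof.
move=> oO bO eps0 cphi Qphi QN W0 Wsing; set P := envelope _ _.
have cg z : Omega z -> (c%:E <= usc_reg Omega phi z)%E.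
  by move=> Oz; apply: le_trans (cphi _ Oz) (usc_reg_ge _ Oz).
have cP z : Omega z -> (c%:E <= P z)%E.
  by move=> Oz; apply: (le_envelope (u := fun=> c%:E)) => //; exact: psh_cst.
have ccl x : closure Omega x -> (c%:E <= usc_reg Omega phi x)%E.
  move=> cx; apply: (usc_reg_ge_near cx).
  by apply/nbhs_rnormP; exists 1 => // y _; exact: cphi.
have [x cx|d d0 H] := compact_uniform_radius (S := fun d z => Omega z ->
    (forall k, rnorm k < d -> Omega (z + k) /\ (Q (z + k)%R <= usc_reg Omega phi z)%E) \/
    (forall k, rnorm k < d -> Omega (z + k) -> (Q (z + k)%R <= P z)%E))
    (compact_closure_Cn bO); last first.
  by exists d => // z Oz; apply: H => //; exact: subset_closure.
have shift (z k : 'Cn[R]_n) (e d : R) : rnorm (z - x) < e / 2 -> d <= e / 2 ->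
    rnorm k < d -> rnorm (z + k - x) < e.
  move=> zx de kd; rewrite addrAC; apply: le_lt_trans (rnormD _ _) _.
  by rewrite [e]splitr ltrD // (lt_le_trans kd).
have small (z : 'Cn[R]_n) (e : R) : 0 < e -> rnorm (z - x) < e / 2 -> rnorm (z - x) < e.
  by move=> e0 h; apply: lt_trans h _; rewrite ltr_pdivrMr // ltr_pMr // ltr1n.
have [Ox|nOx] := pselect (Omega x).
  have loT : usc_reg Omega W x = -oo%E \/ ((c%:E <= usc_reg Omega phi x)%E /\
      forall r : R, (r%:E < usc_reg Omega phi x)%E ->
        \forall y \near x, Omega y -> (r%:E < usc_reg Omega phi y)%E).
    have [Ex|nE] := pselect (discontinuity_set Omega phi x).
      by left; apply: Wsing; right.
    right; split; first exact: ccl.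
    have -> : usc_reg Omega phi x = lsc_reg Omega phi x.
      by apply: contrapT => /eqP h; apply: nE; split.
    move=> r /lsc_reg_gt; apply: filterS => y + Oy => /(_ Oy) /lt_le_trans; apply.
    exact: usc_reg_ge.
  have [e1 e10 dom] := local_domination eps0 Qphi QN W0 cg loT.
  have /nbhs_rnormP[e2 e20 eO] := open_nbhs_nbhs (conj oO Ox).
  have [e [e0 ee1 ee2]] : exists e, [/\ 0 < e, e <= e1 & e <= e2].
    exists (Num.min e1 e2).
    by split; [rewrite lt_min e10|rewrite ge_min lexx|rewrite ge_min lexx orbT].
  exists (e / 2); first by rewrite divr_gt0.
  move=> z d zx de Oz; left => k kd; have zkx := shift z k e d zx de kd.
  have Ozk : Omega (z + k) by apply: eO; apply: lt_le_trans zkx ee2.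
  split=> //; apply: dom => //; first exact: lt_le_trans zkx ee1.
  by apply: lt_le_trans ee1; exact: small.
have bx : bdry Omega x by split=> // /interior_subset.
have loT : usc_reg Omega W x = -oo%E \/ ((c%:E <= usc_reg Omega phi x)%E /\
    forall r : R, (r%:E < usc_reg Omega phi x)%E ->
      \forall y \near x, Omega y -> (r%:E < P y)%E).
  have [BE|nBE] := pselect (B_singular Omega x \/ discontinuity_set Omega phi x).
    by left; exact: Wsing.
  right; split; first exact: ccl.
  move=> r rphi; have Pcvg : P z @[z --> within Omega (nbhs x)] --> usc_reg Omega phi x.
    by apply: (envelope_cvg_bdry cphi bx) => h; apply: nBE; [left|right].
  have near_r : nbhs (usc_reg Omega phi x) [set y | (r%:E < y)%E].
    by apply: open_nbhs_nbhs; split=> //; exact: open_ereal_gt_ereal.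
  exact: (Pcvg _ near_r).
have [e e0 dom] := local_domination eps0 Qphi QN W0 cP loT.
exists (e / 2); first by rewrite divr_gt0.
move=> z d zx de Oz; right => k kd Ozk; apply: dom => //; last exact: small.
exact: shift zx de kd.
Qed.

Lemma not_in_hull n (Omega A : set 'Cn[R]_n) z : Omega z -> ~ pluripolar_hull Omega A z ->
  exists w, [/\ psh Omega w, forall x, Omega x -> (w x < 0)%E,
    forall x, A x -> usc_reg Omega w x = -oo%E & w z != -oo%E].
Proof.
move=> Oz nH; apply: contrapT => nw; apply: nH; split; first exact: subset_closure.
move=> w [pw _] w0 wA; have [_ uw _] := pw; rewrite (usc_reg_id uw Oz).
by apply: contrapT => /eqP wz; apply: nw; exists w; split.
Qed.

(** Upper semicontinuity belongs to plurisubharmonicity. For the lower half, $P(y)$ is compared with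
    $Q(z_0)$ through the translation by $z_0-y$; neither [Q] nor its uniform radius depends on
    [y]. *)
Lemma envelope_continuous n (Omega : set 'Cn[R]_n) phi v (c : R) z0 :
  open Omega -> bounded_set Omega ->
  superharmonic_majorant Omega (usc_reg Omega phi) v ->
  strong_psh_majorant Omega (usc_reg Omega phi) v ->
  psh Omega (envelope Omega (usc_reg Omega phi)) ->
  (forall z, Omega z -> (c%:E <= phi z)%E) -> Omega z0 -> v z0 != +oo%E ->
  ~ pluripolar_hull Omega (B_singular Omega) z0 ->
  ~ pluripolar_hull Omega (discontinuity_set Omega phi) z0 ->
  {for z0, continuous (envelope Omega (usc_reg Omega phi))}.
Proof.
move=> oO bO maj strong pP cphi Oz0 vz0.
move=> /(not_in_hull Oz0)[w1 [pw1 w10 w1B w1z]] /(not_in_hull Oz0)[w2 [pw2 w20 w2E w2z]].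
have [vN lv _ _] := maj; have [_ _ pv _ _] := strong.
have [K K0 vK] := lsc_lbound (compact_closure_Cn bO) lv vN.
have vKO z : Omega z -> ((- K)%:E <= v z)%E by move=> /subset_closure /vK.
have Pphi z : Omega z -> (envelope Omega (usc_reg Omega phi) z <= usc_reg Omega phi z)%E.
  exact: envelope_le.
have cP : (c%:E <= envelope Omega (usc_reg Omega phi) z0)%E.
  apply: (le_envelope (u := fun=> c%:E)); first exact: psh_cst.
  by move=> y Oy; apply: le_trans (cphi _ Oy) (usc_reg_ge _ Oy).
have [Poo /usc_onP uscP _] := pP.
apply: (@cvg_ereal_of_bounds R _ (nbhs z0) (nbhs_filter z0)) => r; last first.
  move=> /(uscP _ Oz0); apply: filterS2 (open_nbhs_nbhs (conj oO Oz0)) => y Oy; exact.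
move=> rP.
pose W z := (w1 z + w2 z)%E.
have pW : psh Omega W by exact: psh_add.
have W0 y : Omega y -> (W y < 0)%E.
  move=> Oy; rewrite /W; have := w10 y Oy; have := w20 y Oy.
  case: (w1 y) (w2 y) => [a||] [b||] //; rewrite !lte_fin => h1 h2.
  by rewrite -[ltRHS]addr0 ltrD.
have Wle1 y : Omega y -> (W y <= w1 y)%E.
  by move=> Oy; rewrite /W -[leRHS]adde0 leeD2l // ltW // w20.
have Wle2 y : Omega y -> (W y <= w2 y)%E.
  by move=> Oy; rewrite /W -[leRHS]add0e leeD2r // ltW // w10.
have Wsing x : B_singular Omega x \/ discontinuity_set Omega phi x ->
    usc_reg Omega W x = -oo%E.
  move=> BE; apply/eqP; rewrite -leeNy_eq; case: BE => [/w1B <-|/w2E <-].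
    exact: usc_reg_mono.
  exact: usc_reg_mono.
have [w Ww] : exists w, W z0 = w%:E.
  rewrite /W; move: w1z w2z (w10 z0 Oz0) (w20 z0 Oz0).
  by case: (w1 z0) (w2 z0) => [a||] [b||] // _ _ _ _; exists (a + b).
have w0 : w < 0 by have := W0 _ Oz0; rewrite Ww lte_fin.
have [x vx] : exists x, v z0 = x%:E.
  by have := vN _ (subset_closure Oz0); case: (v z0) vz0 => [x||] // _ _; exists x.
have xK : 0 <= x + K by have := vKO _ Oz0; rewrite vx lee_fin; clear; lra.
have [p Pp] : exists p, envelope Omega (usc_reg Omega phi) z0 = p%:E.
  by move: cP (Poo _ Oz0); case: (envelope _ _ z0) => [p||] // _ _; exists p.
have rp : 0 < p - r by move: rP; rewrite Pp lte_fin subr_gt0.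
(* With $P(z_0)=p$, the corrections $\eta(x+K)$ and $\varepsilon(1-w)$ in $Q(z_0)$ each cost at most
   $(p-r)/4$, so $Q(z_0)>r$. The 1 added to $x+K$ avoids a division by zero, while $1-w$ comes from
   $\varepsilon W-\varepsilon$. *)
have [eta [eta0 etax]] : exists eta : R, 0 < eta /\ eta * (x + K) <= (p - r) / 4.
  have D : 0 < 1 + (x + K) by rewrite ltr_wpDr.
  exists ((p - r) / 4 / (1 + (x + K))); split; first by rewrite !divr_gt0.
  rewrite mulrAC ler_pdivrMr // ler_wpM2l ?lerDr //; first by rewrite ltW // divr_gt0.
have [eps [eps0 epsw]] : exists eps : R, 0 < eps /\ eps * (1 - w) = (p - r) / 4.
  have D : 0 < 1 - w by move: w0; clear; lra.
  exists ((p - r) / 4 / (1 - w)); split; first by rewrite !divr_gt0.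
  by rewrite divfK // gt_eqF.
have [N HN] := regularized_le eta0 maj strong K0 vKO.
pose Q z := (envelope Omega (usc_reg Omega phi) z + eta%:E * (- v z + (- K)%:E) +
  (eps%:E * W z + (- eps)%:E))%E.
have pQ : psh Omega Q.
  apply: (psh_add oO); first exact: (psh_regularized K oO pP pv.1 eta0).
  apply: (psh_add oO); first exact: psh_scale.
  exact: psh_cst.
have epsW y : Omega y -> (eps%:E * W y + (- eps)%:E <= (- eps)%:E)%E.
  move=> Oy; rewrite -[leRHS]add0e leeD2r //.
  by rewrite -(mule0 eps%:E) lee_wpmul2l ?lee_fin ?ltW // W0.
have Qphi y : Omega y -> (Q y <= usc_reg Omega phi y + (- eps)%:E)%E.
  move=> Oy; apply: leeD (epsW y Oy); apply: le_trans (Pphi y Oy).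
  rewrite -[leRHS]adde0 leeD2l // -(mule0 eta%:E) lee_wpmul2l ?lee_fin ?(ltW eta0) //.
  have := vKO y Oy; case: (v y) => [a||] //; last by rewrite /= leNye.
  by rewrite -EFinN -EFinD !lee_fin; clear; lra.
have QN y : Omega y -> (Q y <= N%:E + eps%:E * W y)%E.
  move=> Oy; apply: leeD; first exact: HN.
  by rewrite -[leRHS]adde0 leeD2l // lee_fin oppr_le0 ltW.
have [d d0 alt] := translate_radius oO bO eps0 cphi Qphi QN W0 Wsing.
have /nbhs_rnormP[rho rho0 rhoO] := open_nbhs_nbhs (conj oO Oz0).
(* With [d' <= rho], every [y] within [d' / 2] of [z0] remains in $\Omega$ under all translations
   shorter than [d' / 2], as the gluing lemma requires. *)
have [d' [d'0 d'd d'rho]] : exists d' : R, [/\ 0 < d', d' <= d & d' <= rho].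
  exists (Num.min d rho).
  by split; [rewrite lt_min d0|rewrite ge_min lexx|rewrite ge_min lexx orbT].
have alt' z : Omega z ->
    (forall k, rnorm k < d' -> Omega (z + k) /\ (Q (z + k)%R <= usc_reg Omega phi z)%E) \/
    (forall k, rnorm k < d' -> Omega (z + k) ->
       (Q (z + k)%R <= envelope Omega (usc_reg Omega phi) z)%E).
  by move=> /alt[H|H]; [left|right] => k kd; apply: H; exact: lt_le_trans kd d'd.
have d'20 : 0 < d' / 2 by rewrite divr_gt0.
apply: filterS (nbhs_rball z0 d'20) => y /= yz0.
have Uy k : rnorm k < d' / 2 -> Omega (y + k).
  move=> kd; apply: rhoO; rewrite addrAC; apply: le_lt_trans (rnormD _ _) _.
  by apply: lt_le_trans d'rho; rewrite [d']splitr ltrD.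
have h : rnorm (z0 - y) < d' / 2 by rewrite rnormB.
have := envelope_ge_translate oO pP pQ h alt' Uy.
rewrite addrC subrK; apply: lt_le_trans.
have -> : Q z0 = (p + eta * (- x + - K) + (eps * w + - eps))%:E by rewrite /Q Pp vx Ww.
rewrite lte_fin.
have -> : p + eta * (- x + - K) + (eps * w + - eps) = p - eta * (x + K) - eps * (1 - w) by ring.
by rewrite epsw; move: etax rp; clear; lra.
Qed.

End LowerSemicontinuity.

Unset Implicit Arguments.

(* "v not identically +oo" is required on Omega: superharmonic functions that
   are +oo throughout Omega are excluded. *)
Theorem theorem1p5 (R : realType) (n : nat) (n_gt0 : (0 < n)%N)
    (Omega : set 'Cn[R]_n) (phi v : 'Cn[R]_n -> \bar R) :
  quasi_B_regular Omega ->
  nearly_continuous Omega phi ->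
  superharmonic_majorant Omega (usc_reg Omega phi) v ->
  (exists2 z, Omega z & v z != +oo%E) ->
  psh Omega (envelope Omega (usc_reg Omega phi)) /\
  (forall theta : 'Cn[R]_n -> \bar R,
     psh_star Omega theta ->
     (forall z, Omega z -> (theta z <= phi z)%E) ->
     strong_psh_majorant Omega (usc_reg Omega phi) v ->
     (psh_star Omega (envelope Omega (usc_reg Omega phi)) /\
      quasi_upper_bounded Omega (envelope Omega (usc_reg Omega phi))) /\
     ((exists c : R, forall z, Omega z -> (c%:E <= theta z)%E) ->
      (forall z0, bdry Omega z0 ->
         ~ (B_singular Omega `|` discontinuity_set Omega phi) z0 ->
         envelope Omega (usc_reg Omega phi) z
           @[z --> within Omega (nbhs z0)] --> usc_reg Omega phi z0) /\
      (forall z0, Omega z0 ->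
         ~ ([set z | closure Omega z /\
                     usc_reg (closure Omega) v z = +oo%E]
            `|` pluripolar_hull Omega (B_singular Omega)
            `|` pluripolar_hull Omega (discontinuity_set Omega phi)) z0 ->
         {for z0, continuous (envelope Omega (usc_reg Omega phi))}))).
Proof.
move=> [[oO cO O0] bO _ _] _ maj vfin.
have pP := envelope_psh oO cO bO maj vfin.
split=> // theta [ptheta [z Oz thz]] theta_phi strong.
have theta_phi' y : Omega y -> (theta y <= usc_reg Omega phi y)%E.
  by move=> Oy; apply: le_trans (theta_phi _ Oy) (usc_reg_ge _ Oy).
split.
  split; last by apply: envelope_quasi_upper_bounded strong pP.
  split=> //; exists z => //; rewrite -ltNye.
  by apply: lt_le_trans (le_envelope z ptheta theta_phi'); rewrite ltNye.
move=> [c cth]; have cphi y : Omega y -> (c%:E <= phi y)%E.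
  by move=> Oy; apply: le_trans (cth _ Oy) (theta_phi _ Oy).
split=> [z0 bz0 nBE|z0 Oz0 nY].
  by apply: (envelope_cvg_bdry cphi bz0) => h; apply: nBE; [left|right].
apply: (envelope_continuous oO bO maj strong pP cphi Oz0).
(* As $v\le v^*$ on $\overline\Omega$, a point off $Y$ has [v] finite. *)
- apply/eqP => vz0; apply: nY; left; left; have cz0 := subset_closure Oz0; split=> //.
  by apply/eqP; rewrite -leye_eq -vz0; exact: usc_reg_ge.
- by move=> h; apply: nY; left; right.
- by move=> h; apply: nY; right.
Qed.
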